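(* For every $\delta>0$, the restrictions of $\mathrm d_{\mathrm D}$ and $\mathrm d_{\mathrm{mr}}$ to $\mathcal U_\delta(d)$ are strongly equivalent metrics. Consequently, their restrictions to $\mathcal U_0(d)$ are equivalent metrics.
   Context: Fix $d\in\mathbb N$. All unitary tuples act on separable Hilbert spaces. For $d$-tuples of unitaries $u=(u_1,\dots,u_d)$, $v=(v_1,\dots,v_d)$ write $u\sim v$ if there is a $*$-isomorphism $\pi\colon C^*(u)\to C^*(v)$ with $\pi(u_i)=v_i$ for all $i$ (here $C^*(u)$ is the C*-algebra generated by $u_1,\dots,u_d$). $\mathcal U(d)$ is the set of $\sim$-equivalence classes of $d$-tuples of unitaries; tuples are identified with their classes. For unitary tuples $u,v$ and $c>0$, write $u\prec cv$ if there exist Hilbert spaces $H\subseteq K$ and tuples $U\in B(H)^d$, $V\in B(K)^d$ with $U\sim u$, $V\sim v$ and $U_i=P_H\,cV_i|_H$ for all $i$, where $P_H$ is the orthogonal projection of $K$ onto $H$. Put $c(u,v)=\inf\{c: u\prec cv\}$ (with $\inf\emptyset=+\infty$). The matrix range of $A\in B(H)^d$ is $\mathcal W(A)=\bigcup_n\mathcal W_n(A)$ (disjoint union), where $\mathcal W_n(A)=\{(\phi(A_1),\dots,\phi(A_d)) : \phi\colon B(H)\to M_n(\mathbb C) \text{ unital completely positive}\}\subseteq M_n(\mathbb C)^d$; it depends only on the $\sim$-class of a unitary tuple. For matrix ranges, $\mathrm d_{\mathrm H}(\mathcal W(u),\mathcal W(v))=\sup_n \mathrm d_{\mathrm H}(\mathcal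 W_n(u),\mathcal W_n(v))$, where on the right $\mathrm d_{\mathrm H}$ is the Hausdorff distance with respect to the norm $\|X\|=\max_i\|X_i\|$ on $M_n(\mathbb C)^d$. Define $$\mathrm d_{\mathrm D}(u,v)=\log\max\{c(u,v),c(v,u)\},\qquad \mathrm d_{\mathrm{mr}}(u,v)=\mathrm d_{\mathrm H}(\mathcal W(u),\mathcal W(v)).$$ For $\delta>0$, $\mathcal U_\delta(d)$ is the set of $u\in\mathcal U(d)$ with $\mathcal W_1(u)\supseteq\{z\in\mathbb C^d:\|z\|<\delta\}$ ($\|\cdot\|$ the Euclidean norm), and $\mathcal U_0(d)$ is the set of $u\in\mathcal U(d)$ such that $\mathcal W_1(u)$ contains some neighborhood of the origin. Two metrics on the same set are equivalent if they generate the same topology, and strongly equivalent if each is bounded by a constant multiple of the other. *)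

(* Defs.v *)
From HB Require Import structures.
From mathcomp Require Import all_boot all_order all_algebra.
From mathcomp Require Import complex.
From mathcomp Require Import all_classical all_reals all_analysis.
Set Implicit Arguments.
Unset Strict Implicit.
Unset Printing Implicit Defensive.
Import Order.TTheory GRing.Theory Num.Theory.
Import numFieldNormedType.Exports.
Local Open Scope classical_set_scope.
Local Open Scope ring_scope.
Local Open Scope complex_scope.

(** * Hilbert spaces and bounded operators *)

(* Separable complex Hilbert spaces; [hdot] is linear in its first argument. *)
Record hilbert (R : realType) := Hilbert {
  hspace :> completeNormedModType R[i];
  hdot : {dot hspace for Num.conj};
  hdot_norm : forall x, hdot x x = `|x| ^+ 2;
  hseparable : exists2 D : set hspace, countable D & dense D }.

(* B(H), as a set of functions: sums and scalar multiples are pointwise, the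
   product is composition, and the unit is [idfun]. *)
Definition bounded_op (R : realType) (H : hilbert R) : set (H -> H) :=
  [set a | linear a /\ continuous a].

Definition is_adjoint (R : realType) (H : hilbert R) (a b : H -> H) :=
  forall x y, hdot H (a x) y = hdot H x (b y).

Definition unitary_op (R : realType) (H : hilbert R) (a : H -> H) :=
  bounded_op a /\
  exists b, [/\ bounded_op b, is_adjoint a b, b \o a = idfun & a \o b = idfun].

Record utuple (R : realType) (d : nat) := UTuple {
  usp : hilbert R;
  uop :> 'I_d -> usp -> usp;
  uopP : forall i, unitary_op (uop i) }.

(** * Generated C*-algebras and the relation u ~ v *)

Definition is_cstar_subalgebra (R : realType) (H : hilbert R)
    (S : set (H -> H)) :=
  [/\ S `<=` @bounded_op R H,
      forall (l : R[i]) a b, S a -> S b -> S (l \*: a \+ b),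
      forall a b, S a -> S b -> S (a \o b),
      forall a b, S a -> is_adjoint a b -> S b &
      (* closedness for the operator norm *)
      forall a, bounded_op a ->
        (forall e : R, 0 < e ->
           exists2 b, S b & forall x, `|a x - b x| <= e%:C * `|x|) -> S a].

Definition cstar (R : realType) (d : nat) (H : hilbert R)
    (A : 'I_d -> H -> H) : set (H -> H) :=
  smallest (@is_cstar_subalgebra R H) (range A).

Definition usim (R : realType) (d : nat) (u v : utuple R d) :=
  exists pi : (usp u -> usp u) -> (usp v -> usp v),
  [/\ set_bij (cstar u) (cstar v) pi,
      forall (l : R[i]) a b, cstar u a -> cstar u b ->
        pi (l \*: a \+ b) = l \*: pi a \+ pi b,
      forall a b, cstar u a -> cstar u b -> pi (a \o b) = pi a \o pi b,
      forall a b, cstar u a -> is_adjoint a b -> is_adjoint (pi a) (pi b) &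
      forall i, pi (u i) = v i].

(** * Dilations *)

(* The inclusion of H in K is an isometric embedding [J], and [P] is the
   orthogonal projection of K onto H, with values in H. *)
Definition dilates (R : realType) (d : nat) (u v : utuple R d) (c : R) :=
  exists (U V : utuple R d) (J : usp U -> usp V) (P : usp V -> usp U),
  [/\ usim U u /\ usim V v,
      linear J,
      forall x y, hdot (usp V) (J x) (J y) = hdot (usp U) x y,
      forall k h, hdot (usp V) (k - J (P k)) (J h) = 0 &
      forall i h, U i h = P (c%:C *: V i (J h))].

Definition dilation_const (R : realType) (d : nat) (u v : utuple R d) : \bar R :=
  ereal_inf [set c%:E | c in [set c : R | 0 < c /\ dilates u v c]].

Definition dD (R : realType) (d : nat) (u v : utuple R d) : \bar R :=
  lne (Order.max (dilation_const u v) (dilation_const v u)).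

(** * Matrix ranges *)

(* Unital completely positive maps B(H) -> M_(n+1)(C). Only the values on B(H)
   matter. An m x m matrix over B(H), or over M_(n+1)(C), is positive when its
   quadratic form on H^m, resp. (C^(n+1))^m, is nonnegative; in R[i], 0 <= z
   means that z is real and nonnegative. *)
Definition is_ucp (R : realType) (H : hilbert R) (n : nat)
    (phi : (H -> H) -> 'M[R[i]]_n.+1) :=
  [/\ forall (l : R[i]) a b, bounded_op a -> bounded_op b ->
        phi (l \*: a \+ b) = l *: phi a + phi b,
      phi idfun = 1%:M &
      forall (m : nat) (A : 'I_m -> 'I_m -> H -> H),
        (forall i j, bounded_op (A i j)) ->
        (forall x : 'I_m -> H,
           0 <= \sum_(i < m) \sum_(j < m) hdot H (A i j (x j)) (x i)) ->
        forall y : 'I_m -> 'cV[R[i]]_n.+1,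
          0 <= \sum_(i < m) \sum_(j < m)
                 (map_mx Num.conj (y i)^T *m phi (A i j) *m y j) 0 0].

(* The level of index [n] is W_(n+1), so that all levels n >= 1 are covered. *)
Definition matrix_range (R : realType) (d : nat) (H : hilbert R)
    (A : 'I_d -> H -> H) (n : nat) : set ('I_d -> 'M[R[i]]_n.+1) :=
  [set X | exists2 phi, is_ucp phi & X = fun i => phi (A i)].
Arguments matrix_range {R d H} A n.

Definition l2norm (R : realType) (n : nat) (y : 'cV[R[i]]_n) : R :=
  Num.sqrt (\sum_(i < n) Normc.normc (y i 0) ^+ 2).

(* The C*-norm on matrices; the canonical norm of the library on 'M_n is the
   entrywise maximum. *)
Definition mxopnorm (R : realType) (n : nat) (X : 'M[R[i]]_n) : R :=
  sup [set l2norm (X *m y) | y in [set y | l2norm y <= 1]].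

Definition tuple_dist (R : realType) (d n : nat)
    (X Y : 'I_d -> 'M[R[i]]_n) : R :=
  \big[Num.max/0]_(i < d) mxopnorm (X i - Y i).

Definition hausdorff (R : realType) (T : Type) (dist : T -> T -> R)
    (A B : set T) : \bar R :=
  Order.max
    (ereal_sup [set ereal_inf [set (dist a b)%:E | b in B] | a in A])
    (ereal_sup [set ereal_inf [set (dist a b)%:E | a in A] | b in B]).

Definition dmr (R : realType) (d : nat) (u v : utuple R d) : \bar R :=
  ereal_sup (range (fun n : nat =>
    hausdorff (@tuple_dist R d n.+1) (matrix_range u n) (matrix_range v n))).

(* C^d is identified with M_1(C)^d. *)
Definition U_ (R : realType) (d : nat) (delta : R) (u : utuple R d) : Prop :=
  forall z : 'cV[R[i]]_d, l2norm z < delta ->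
    matrix_range u 0 (fun i => (z i 0)%:M).

(* A neighborhood of the origin is a set containing a ball around it. *)
Definition U0 (R : realType) (d : nat) (u : utuple R d) : Prop :=
  exists2 e : R, 0 < e & U_ e u.

(** * Metrics on sets of equivalence classes *)

(* The type of unitary tuples is too large for the library's [set], whence the
   plain predicates here. *)

(* [rho] induces a (real-valued) metric on the quotient X/E: by the second,
   third and fourth conditions, [rho] depends only on the classes. *)
Definition is_metric_mod (R : realType) (T : Type) (E : T -> T -> Prop)
    (X : T -> Prop) (rho : T -> T -> \bar R) :=
  [/\ forall u v, X u -> X v -> rho u v \is a fin_num /\ (0 <= rho u v)%E,
      forall u v, X u -> X v -> (rho u v = 0%E <-> E u v),
      forall u v, X u -> X v -> rho u v = rho v u &
      forall u v w, X u -> X v -> X w ->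
        (rho u w <= rho u v + rho v w)%E].

(* Since rho u v = 0 for equivalent u and v, an open subset of X is saturated,
   so the open subsets of X are those of X/E. *)
Definition metric_open (R : realType) (T : Type) (X : T -> Prop)
    (rho : T -> T -> \bar R) (O : T -> Prop) :=
  (forall u, O u -> X u) /\
  forall u, O u -> exists2 e : R, 0 < e &
    forall v, X v -> (rho u v < e%:E)%E -> O v.

Definition equivalent_metrics (R : realType) (T : Type) (X : T -> Prop)
    (rho1 rho2 : T -> T -> \bar R) :=
  forall O : T -> Prop, metric_open X rho1 O <-> metric_open X rho2 O.

Definition strongly_equivalent (R : realType) (T : Type) (X : T -> Prop)
    (rho1 rho2 : T -> T -> \bar R) :=
  (exists C : R, forall u v, X u -> X v -> (rho1 u v <= C%:E * rho2 u v)%E) /\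
  (exists C : R, forall u v, X u -> X v -> (rho2 u v <= C%:E * rho1 u v)%E).

(* Main.v *)
(** Matrix ranges are handled through their dual description: a matrix pencil
    [L] is positive on [v] when its pairing with every Gram matrix
    [<v_q x_k, x_j>] is nonnegative, and [X] is in the matrix range of [v] exactly
    when every positive pencil is nonnegative at [X].  In this language
    [u < c v] means that [c^-1 W(u)] is contained in [W(v)]: Gram matrices of [u]
    are approximated by sums of Gram matrices of [v], an ultraproduct of these
    approximations gives a space on which a copy of [v] dilates [c^-1 u], and for
    [c = 1] the dilation is reducing.  So [dD] is the logarithm of the best
    inclusion constant; the infimum is attained, inclusions being closed conditions.

    If the first level of [v] contains the ball of radius [delta], then the
    coefficients of a positive pencil satisfy [|<L_i x, x>| <= <L_0 x, x> / delta],
    hence moving [X] by [e] in norm changes the value of the pencil by at most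
    [(2 d / delta) e] times its value at [0].  Thus a matrix range at distance [r]
    from [W(v)] lies in [(1 + 2 d r / delta) W(v)], which gives
    [dD <= (2 d / delta) dmr]; conversely [dmr <= 1 - 1/c <= log c].  Finally a
    tuple close in [dmr] to an element of [U_ delta] lies in [U_ (delta / 2 d)],
    so both metrics give the same neighborhoods in [U0]. *)

Require Import Defs.
From HB Require Import structures.
From mathcomp Require Import all_boot all_order all_algebra.
From mathcomp Require Import complex.
From mathcomp Require Import all_classical all_reals all_analysis.
From mathcomp Require Import ring lra.
Set Implicit Arguments.
Unset Strict Implicit.
Unset Printing Implicit Defensive.
Import Order.TTheory GRing.Theory Num.Theory.
Import numFieldNormedType.Exports.
Local Open Scope classical_set_scope.
Local Open Scope ring_scope.
Local Open Scope complex_scope.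
Local Notation Re := complex.Re.
Local Notation Im := complex.Im.
Local Notation normc := Normc.normc.

(** * Semi-inner products and ultralimits *)

(** Arveson extension and Stinespring dilation are replaced by limits of explicit objects. A point
    of the dual cone is a limit of finite sums of Gram matrices; an ultralimit of the corresponding
    vector functionals is a ucp map defined on all of B(H), and an ultralimit of the corresponding
    finite direct sums carries a representation of the unitaries. Since Hilbert spaces are separable
    by definition, the full ultraproduct is never formed: only the closed span of countably many
    vectors, stable under the unitaries and their adjoints, is kept, and this span is rebuilt from
    its Gram kernel alone.

    The link with the relation ~ has two halves of different nature. Equality of ranges yields a
    *-isomorphism through a comparison of the norms of noncommutative polynomials. Conversely, a
    *-isomorphism is only known to respect the algebraic structure, so that its positivity on
    matrices over C*(u) has to be derived: a slightly shifted positive matrix is written as a square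
    inside the algebra, the root being obtained by a contractive iteration. *)

Section ComplexNumbers.
Context {R : realType}.
Local Notation C := R[i].

Lemma normCE (z : C) : `|z| = (normc z)%:C. Proof. by []. Qed.

Lemma normc_ge0 (z : C) : 0 <= normc z.
Proof. by case: z => a b; exact: sqrtr_ge0. Qed.

Lemma normc_sqr (z : C) : normc z ^+ 2 = Re z ^+ 2 + Im z ^+ 2.
Proof. by case: z => a b /=; rewrite sqr_sqrtr // addr_ge0 // sqr_ge0. Qed.

Lemma normc_eq0 (z : C) : (normc z == 0) = (z == 0).
Proof.
by apply/eqP/eqP => [/Normc.eq0_normc//|->]; rewrite Normc.normc0.
Qed.

Lemma normcD (z w : C) : normc (z + w) <= normc z + normc w.
Proof. exact: le_normcD. Qed.

Lemma normcB (z w : C) : normc (z - w) = normc (w - z).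
Proof. by rewrite -normcN opprB. Qed.

Lemma normc_conj (z : C) : normc (conjc z) = normc z.
Proof. by case: z => a b /=; rewrite sqrrN. Qed.

Lemma normc_real (r : R) : normc r%:C = `|r|.
Proof. by rewrite /= expr0n addr0 sqrtr_sqr. Qed.

Lemma normc_nat (n : nat) : normc (n%:R : C) = n%:R.
Proof. by rewrite -(rmorph_nat (real_complex R)) normc_real ger0_norm. Qed.

Lemma ReD (z w : C) : Re (z + w) = Re z + Re w. Proof. by case: z; case: w. Qed.
Lemma ImD (z w : C) : Im (z + w) = Im z + Im w. Proof. by case: z; case: w. Qed.
Lemma ReN (z : C) : Re (- z) = - Re z. Proof. by case: z. Qed.
Lemma ImN (z : C) : Im (- z) = - Im z. Proof. by case: z. Qed.
Lemma ReB (z w : C) : Re (z - w) = Re z - Re w. Proof. by rewrite ReD ReN. Qed.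
Lemma Re_conj (z : C) : Re (conjc z) = Re z. Proof. by case: z. Qed.
Lemma Im_conj (z : C) : Im (conjc z) = - Im z. Proof. by case: z. Qed.
Lemma ReM (z w : C) : Re (z * w) = Re z * Re w - Im z * Im w.
Proof. by case: z; case: w. Qed.
Lemma ReZ (r : R) (w : C) : Re (r%:C * w) = r * Re w.
Proof. by rewrite ReM /= mul0r subr0. Qed.
Lemma Re_sum I (r : seq I) (P : pred I) (F : I -> C) :
  Re (\sum_(i <- r | P i) F i) = \sum_(i <- r | P i) Re (F i).
Proof. by apply: (big_morph _ ReD). Qed.

Lemma Re_le_normc (z : C) : `|Re z| <= normc z.
Proof. by have := normc_ge_Re z; rewrite normCE lecR. Qed.

Lemma Re_le (z : C) : Re z <= normc z.
Proof. exact: le_trans (ler_norm _) (Re_le_normc z). Qed.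

Lemma normc_le_ReIm (z : C) : normc z <= `|Re z| + `|Im z|.
Proof.
rewrite -(ler_pXn2r (ltn0Sn 1)) ?nnegrE ?normc_ge0 ?addr_ge0//.
rewrite normc_sqr sqrrD -(real_normK (num_real (Re z))).
rewrite -(real_normK (num_real (Im z))).
by rewrite lerD2r lerDl mulrn_wge0 // mulr_ge0.
Qed.

Lemma Im_le_normc (z : C) : `|Im z| <= normc z.
Proof.
rewrite -(ler_pXn2r (ltn0Sn 1)) ?nnegrE ?normc_ge0//.
by rewrite normc_sqr real_normK ?num_real// lerDr sqr_ge0.
Qed.

Lemma mulc_conj (z : C) : z * conjc z = (normc z ^+ 2)%:C.
Proof.
rewrite normc_sqr; case: z => a b /=.
by apply/eqP; rewrite eq_complex /=; apply/andP; split; apply/eqP; ring.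
Qed.

Lemma conjcM (z w : C) : conjc (z * w) = conjc z * conjc w.
Proof. exact: rmorphM. Qed.
Lemma conjcD (z w : C) : conjc (z + w) = conjc z + conjc w.
Proof. exact: rmorphD. Qed.
Lemma conjcN (z : C) : conjc (- z) = - conjc z.
Proof. exact: rmorphN. Qed.
Lemma conjc_sum I (r : seq I) (P : pred I) (F : I -> C) :
  conjc (\sum_(i <- r | P i) F i) = \sum_(i <- r | P i) conjc (F i).
Proof. exact: rmorph_sum. Qed.

Lemma complex_ext (z w : C) : Re z = Re w -> Im z = Im w -> z = w.
Proof. by case: z; case: w => a b c d /= -> ->. Qed.

Lemma ge0cE (z : C) : (0 <= z) = (Im z == 0) && (0 <= Re z).
Proof. by rewrite lecE. Qed.

Lemma normc_sum I (r : seq I) (P : pred I) (F : I -> C) :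
  normc (\sum_(i <- r | P i) F i) <= \sum_(i <- r | P i) normc (F i).
Proof.
elim/big_rec2: _ => [|i y x _ h]; first by rewrite Normc.normc0.
exact: le_trans (normcD _ _) (lerD _ _).
Qed.

End ComplexNumbers.

Lemma invS_gt0 (R : realType) (n : nat) : (0 : R) < n.+1%:R^-1.
Proof. by rewrite invr_gt0 ltr0n. Qed.

Lemma invS_le1 (R : realType) (n : nat) : n.+1%:R^-1 <= 1 :> R.
Proof. by rewrite invf_le1 ?ltr0n // ler1n. Qed.

Lemma harmonic_small (R : realType) (B e : R) : 0 < e ->
  exists N, forall n, (N <= n)%N -> B * n.+1%:R^-1 < e.
Proof.
move=> e0; exists (Num.Def.truncn (`|B| / e)) => n hn.
rewrite ltr_pdivrMr ?ltr0n //; apply: le_lt_trans (ler_norm B) _.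
rewrite mulrC -ltr_pdivrMr //; apply: lt_le_trans (truncnS_gt _) _.
by rewrite ler_nat ltnS.
Qed.

Lemma invS_small (R : realType) (e : R) : 0 < e ->
  exists N, forall n, (N <= n)%N -> n.+1%:R^-1 < e.
Proof. by move=> /(harmonic_small 1)[N hN]; exists N => n /hN; rewrite mul1r. Qed.

Lemma mk_linear (R : realType) (U V : lmodType R[i]) (f : U -> V) : linear f ->
  exists g : {linear U -> V}, g = f :> (U -> V).
Proof.
move=> lf; pose L := GRing.isLinear.Build R[i] U V *:%R f lf.
by pose g : {linear U -> V} := HB.pack f L; exists g.
Qed.

Section SemiDot.
Context {R : realType}.
Local Notation C := R[i].

(** Degenerate forms are allowed, so that the same inequalities serve inner products, their finite
    sums, forms on polynomials before completion, and the form of a positive operator. That [g x x]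
    is real follows from hermitian symmetry. *)
Record semidot (E : lmodType C) (g : E -> E -> C) : Prop := SemiDot {
  sd_lin : forall a x y z, g (a *: x + y) z = a * g x z + g y z;
  sd_herm : forall x y, g y x = conjc (g x y);
  sd_ge0 : forall x, 0 <= Re (g x x) }.

Definition snorm (E : Type) (g : E -> E -> C) (x : E) : R :=
  Num.sqrt (Re (g x x)).

Variables (E : lmodType C) (g : E -> E -> C).
Hypothesis gP : semidot g.

Lemma sdDl x y z : g (x + y) z = g x z + g y z.
Proof. by have := sd_lin gP 1 x y z; rewrite scale1r mul1r. Qed.
Lemma sd0l z : g 0 z = 0.
Proof. by apply: (addrI (g 0 z)); rewrite -sdDl addr0 addr0. Qed.
Lemma sdZl a x z : g (a *: x) z = a * g x z.
Proof. by have := sd_lin gP a x 0 z; rewrite addr0 sd0l addr0. Qed.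
Lemma sdNl x z : g (- x) z = - g x z.
Proof. by rewrite -scaleN1r sdZl mulN1r. Qed.
Lemma sdBl x y z : g (x - y) z = g x z - g y z.
Proof. by rewrite sdDl sdNl. Qed.
Lemma sd_suml I (r : seq I) (P : pred I) (F : I -> E) z :
  g (\sum_(i <- r | P i) F i) z = \sum_(i <- r | P i) g (F i) z.
Proof. exact: (big_morph (fun x => g x z) (fun x y => sdDl x y z) (sd0l z)). Qed.
Lemma sdDr x y z : g z (x + y) = g z x + g z y.
Proof. by rewrite !(sd_herm gP _ z) sdDl conjcD. Qed.
Lemma sd0r z : g z 0 = 0.
Proof. by rewrite (sd_herm gP) sd0l conjc0. Qed.
Lemma sdZr a x z : g z (a *: x) = conjc a * g z x.
Proof. by rewrite !(sd_herm gP _ z) sdZl conjcM. Qed.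
Lemma sdNr x z : g z (- x) = - g z x.
Proof. by rewrite !(sd_herm gP _ z) sdNl conjcN. Qed.
Lemma sdBr x y z : g z (x - y) = g z x - g z y.
Proof. by rewrite sdDr sdNr. Qed.
Lemma sd_sumr I (r : seq I) (P : pred I) (F : I -> E) z :
  g z (\sum_(i <- r | P i) F i) = \sum_(i <- r | P i) g z (F i).
Proof. exact: (big_morph (fun x => g z x) (fun x y => sdDr x y z) (sd0r z)). Qed.

Lemma sd_Im x : Im (g x x) = 0.
Proof. by have := congr1 (@complex.Im R) (sd_herm gP x x); rewrite Im_conj => ?; lra. Qed.
Lemma sd_real x : g x x = (Re (g x x))%:C.
Proof. by apply: complex_ext; rewrite //= sd_Im. Qed.
Lemma sd_Re_sym x y : Re (g x y) = Re (g y x).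
Proof. by rewrite (sd_herm gP) Re_conj. Qed.

Lemma snorm_ge0 x : 0 <= snorm g x. Proof. exact: sqrtr_ge0. Qed.
Lemma snorm_sqr x : snorm g x ^+ 2 = Re (g x x).
Proof. by rewrite sqr_sqrtr // (sd_ge0 gP). Qed.
Lemma snorm0 : snorm g 0 = 0. Proof. by rewrite /snorm sd0l sqrtr0. Qed.

Lemma snormZ a x : snorm g (a *: x) = normc a * snorm g x.
Proof.
rewrite /snorm sdZl sdZr mulrA mulc_conj ReZ sqrtrM ?sqr_ge0//.
by rewrite sqrtr_sqr ger0_norm // normc_ge0.
Qed.
Lemma snormN x : snorm g (- x) = snorm g x.
Proof. by rewrite -scaleN1r snormZ normcN Normc.normc1 mul1r. Qed.
Lemma snormB x y : snorm g (x - y) = snorm g (y - x).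
Proof. by rewrite -snormN opprB. Qed.

Lemma snormD_sqr x y :
  snorm g (x + y) ^+ 2 = snorm g x ^+ 2 + snorm g y ^+ 2 + 2 * Re (g x y).
Proof.
by rewrite !snorm_sqr sdDl !sdDr !ReD (sd_Re_sym y x); ring.
Qed.
Lemma snormB_sqr x y :
  snorm g (x - y) ^+ 2 = snorm g x ^+ 2 + snorm g y ^+ 2 - 2 * Re (g x y).
Proof. by rewrite snormD_sqr snormN sdNr ReN; ring. Qed.

Lemma parallelogram x y :
  snorm g (x + y) ^+ 2 + snorm g (x - y) ^+ 2 =
  2 * (snorm g x ^+ 2 + snorm g y ^+ 2).
Proof. by rewrite snormD_sqr snormB_sqr; ring. Qed.

Lemma cauchy_schwarz x y : normc (g x y) <= snorm g x * snorm g y.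
Proof.
have key (t : R) : 0 <= Re (g x x) + t ^+ 2 * normc (g x y) ^+ 2 * Re (g y y)
    - 2 * t * normc (g x y) ^+ 2.
  have := sqr_ge0 (snorm g (x - (t%:C * g x y) *: y)).
  rewrite snormB_sqr sdZr conjcM conjc_real -mulrA ReZ.
  rewrite [_^* * _]mulrC mulc_conj snormZ Normc.normcM normc_real -!snorm_sqr /=.
  by rewrite !exprMn real_normK ?num_real //; move=> h; lra.
have a0 := sd_ge0 gP x; have b0 := sd_ge0 gP y.
have n0 := normc_ge0 (g x y).
rewrite -(ler_pXn2r (ltn0Sn 1)) ?nnegrE ?mulr_ge0 ?snorm_ge0//.
rewrite exprMn !snorm_sqr.
move: key a0 b0 n0; set a := Re _; set b := Re _; set n := normc _.
move=> key a0 b0 n0.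
(* For a null vector [y] the optimal t = 1/b does not exist; t = (a + 1) / n^2 makes the quadratic
   expression negative unless n = 0. *)
have [b1|b1] := eqVneq b 0.
  have := key ((a + 1) / (n ^+ 2)); rewrite b1 mulr0 addr0.
  have [->|nn0] := eqVneq n 0; first by rewrite expr0n /= mulr_ge0.
  rewrite -mulrA divfK ?expf_neq0// => h; lra.
have bp : 0 < b by rewrite lt_neqAle eq_sym b1.
have := key b^-1; rewrite expr2.
have -> : b^-1 * b^-1 * n ^+ 2 * b = n ^+ 2 / b.
  by field.
move=> h; have : n ^+ 2 / b <= a by lra.
by rewrite ler_pdivrMr.
Qed.

Lemma snormD x y : snorm g (x + y) <= snorm g x + snorm g y.
Proof.
rewrite -(ler_pXn2r (ltn0Sn 1)) ?nnegrE ?addr_ge0 ?snorm_ge0//.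
rewrite snormD_sqr sqrrD.
have := Re_le (g x y); have := cauchy_schwarz x y; lra.
Qed.

Lemma snorm_trans y x z : snorm g (x - z) <= snorm g (x - y) + snorm g (y - z).
Proof. by rewrite -[X in snorm g X](subrKA y) snormD. Qed.

Lemma snorm_lip x y : `|snorm g x - snorm g y| <= snorm g (x - y).
Proof.
rewrite ler_norml; apply/andP; split.
  by have := snormD (y - x) x; rewrite subrK snormB => h; lra.
by have := snormD (x - y) y; rewrite subrK => h; lra.
Qed.

Lemma snorm_sum I (r : seq I) (P : pred I) (F : I -> E) :
  snorm g (\sum_(i <- r | P i) F i) <= \sum_(i <- r | P i) snorm g (F i).
Proof.
elim/big_rec2: _ => [|i y x _ h]; first by rewrite snorm0.
exact: le_trans (snormD _ _) (lerD _ _).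
Qed.

End SemiDot.

(** * Limits along a free ultrafilter *)

Section UltraLimit.
Context {R : realType}.
Local Notation C := R[i].

Lemma free_ultrafilter_exists :
  exists U : set_system nat, UltraFilter U /\ nbhs \oo `<=` U.
Proof. exact: ultraFilterLemma. Qed.

(** One ultrafilter is fixed for the whole development: all bounded sequences converge along it
    simultaneously, compatibly with sums and conjugation, so that no diagonal subsequence has to be
    extracted. *)
Definition freeU : set_system nat := proj1_sig (cid free_ultrafilter_exists).

Lemma freeU_ultra : UltraFilter freeU.
Proof. by rewrite /freeU; case: cid => ? []. Qed.

Global Instance freeU_proper : ProperFilter freeU.
Proof. by have := freeU_ultra; case. Qed.

Lemma freeU_tail (A : set nat) (N : nat) :
  (forall n, (N <= n)%N -> A n) -> freeU A.
Proof.
by move=> h; rewrite /freeU; case: cid => ? [_] /=; apply; exists N.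
Qed.

Lemma freeU_ex (A : set nat) : freeU A -> exists n, A n.
Proof. exact: filter_ex. Qed.

Lemma freeU_dichotomy (A : set nat) : freeU A \/ freeU (~` A).
Proof. by apply: in_ultra_setVsetC; exact: freeU_ultra. Qed.

(** The limit is the supremum of the thresholds which [x] reaches on a set of the ultrafilter; the
    dichotomy for sets turns failure above the supremum into an upper bound on a large set. *)
Lemma ultralimit_real (x : nat -> R) (M : R) : (forall n, `|x n| <= M) ->
  exists l : R, forall e : R, 0 < e -> freeU [set n | `|x n - l| < e].
Proof.
move=> xM; pose S := [set t : R | freeU [set n | t <= x n]].
have S1 : S (- M).
  apply: (@freeU_tail _ 0%N) => n _ /=.
  by have := xM n; rewrite ler_norml => /andP[].
have ubS : ubound S M.
  move=> t /freeU_ex[n /= tx]; apply: le_trans tx _.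
  by have := xM n; rewrite ler_norml => /andP[].
have hS : has_sup S by split; [exists (- M) | exists M].
exists (sup S) => e e0.
have e20 : 0 < e / 2 by rewrite divr_gt0.
have [t St lt] := sup_adherent e20 hS.
have nS : freeU (~` [set n | sup S + e / 2 <= x n]).
  have [h|//] := freeU_dichotomy [set n | sup S + e / 2 <= x n].
  have := ub_le_sup (ex_intro _ M ubS : has_ubound S) h.
  by move=> /= ?; lra.
apply: (filterS _ (filterI St nS)) => n /= [h1 /negP]; rewrite -ltNge => h2.
by rewrite ltr_norml; apply/andP; split; lra.
Qed.

Definition ucvg (x : nat -> C) : set C := fun l =>
  forall e : R, 0 < e -> freeU [set n | normc (x n - l) < e].

Definition ulim (x : nat -> C) : C := xget 0 (ucvg x).

Lemma ucvg_ulim (x : nat -> C) (M : R) :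
  (forall n, normc (x n) <= M) -> ucvg x (ulim x).
Proof.
move=> xM; suff [l xl] : exists l, ucvg x l by apply: (@xgetPex _ 0 (ucvg x)); exists l.
have [a ha] := @ultralimit_real (fun n => Re (x n)) M
  (fun n => le_trans (Re_le_normc _) (xM n)).
have [b hb] := @ultralimit_real (fun n => Im (x n)) M
  (fun n => le_trans (Im_le_normc _) (xM n)).
exists (a +i* b) => e e0; have e20 : 0 < e / 2 by rewrite divr_gt0.
apply: (filterS _ (filterI (ha _ e20) (hb _ e20))) => n /= [h1 h2].
apply: le_lt_trans (normc_le_ReIm _) _.
by rewrite ReD ImD ReN ImN /=; lra.
Qed.

Lemma ucvg_unique x l l' : ucvg x l -> ucvg x l' -> l = l'.
Proof.
move=> h h'; apply/eqP; rewrite -subr_eq0 -normc_eq0 eq_le normc_ge0 andbT.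
apply/ler_addgt0Pr => e e0; rewrite add0r; have e20 : 0 < e / 2 by rewrite divr_gt0.
have [n /= [h1 h2]] := freeU_ex (filterI (h _ e20) (h' _ e20)).
rewrite -(subrKA (x n)); apply: le_trans (normcD _ _) _.
by rewrite normcB; lra.
Qed.

Lemma ulimE x l : ucvg x l -> ulim x = l.
Proof.
by move=> h; apply: (@ucvg_unique x) => //; apply: (@xgetPex _ 0 (ucvg x)); exists l.
Qed.

Lemma ucvg_cst l : ucvg (fun _ => l) l.
Proof.
by move=> e e0; apply: (@freeU_tail _ 0%N) => n _ /=; rewrite subrr Normc.normc0.
Qed.

Lemma ucvgD x y l m : ucvg x l -> ucvg y m -> ucvg (fun n => x n + y n) (l + m).
Proof.
move=> hx hy e e0; have e20 : 0 < e / 2 by rewrite divr_gt0.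
apply: (filterS _ (filterI (hx _ e20) (hy _ e20))) => n /= [h1 h2].
rewrite opprD addrACA; apply: le_lt_trans (normcD _ _) _; lra.
Qed.

Lemma ucvgZ a x l : ucvg x l -> ucvg (fun n => a * x n) (a * l).
Proof.
move=> hx e e0.
have a0 := normc_ge0 a.
have e20 : 0 < e / (normc a + 1) by rewrite divr_gt0 //; lra.
apply: (filterS _ (hx _ e20)) => n /= h1.
rewrite -mulrBr Normc.normcM.
have := normc_ge0 (x n - l).
rewrite ltr_pdivlMr in h1; nra.
Qed.

Lemma ucvg_conj x l : ucvg x l -> ucvg (fun n => conjc (x n)) (conjc l).
Proof.
move=> hx e e0; apply: (filterS _ (hx _ e0)) => n /=.
by rewrite -conjcN -conjcD normc_conj.
Qed.

Lemma ucvg_sum (I : Type) (r : seq I) (x : I -> nat -> C) (l : I -> C) :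
  (forall i, ucvg (x i) (l i)) ->
  ucvg (fun n => \sum_(i <- r) x i n) (\sum_(i <- r) l i).
Proof.
move=> h; elim: r => [|i r IH].
  rewrite big_nil (_ : (fun n => _) = fun _ => 0); first exact: ucvg_cst.
  by apply/funext => n; rewrite big_nil.
rewrite big_cons (_ : (fun n => _) = fun n => x i n + \sum_(i <- r) x i n).
  exact: ucvgD.
by apply/funext => n; rewrite big_cons.
Qed.

Lemma ucvg_Re_ge x l (b : R) : ucvg x l -> freeU [set n | b <= Re (x n)] ->
  b <= Re l.
Proof.
move=> hx hb; apply/ler_addgt0Pr => e e0.
have [n /= [h1 h2]] := freeU_ex (filterI (hx _ e0) hb).
have := Re_le (x n - l); rewrite ReB; lra.
Qed.

Lemma ucvg_normc_le x l (b : R) : ucvg x l -> freeU [set n | normc (x n) <= b] ->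
  normc l <= b.
Proof.
move=> hx hb; apply/ler_addgt0Pr => e e0.
have [n /= [h1 h2]] := freeU_ex (filterI (hx _ e0) hb).
rewrite -[l](subrK (x n)); apply: le_trans (normcD _ _) _.
by rewrite normcB; lra.
Qed.

Lemma ucvg_eq (x y : nat -> C) l : ucvg x l ->
  (forall e : R, 0 < e -> exists N, forall n, (N <= n)%N -> normc (x n - y n) < e) ->
  ucvg y l.
Proof.
move=> hx h e e0; have e20 : 0 < e / 2 by rewrite divr_gt0.
have [N hN] := h _ e20.
have hN' : freeU [set n | normc (x n - y n) < e / 2] by exact: freeU_tail hN.
apply: (filterS _ (filterI (hx _ e20) hN')) => n /= [h1 h2].
rewrite -(subrKA (x n)); apply: le_lt_trans (normcD _ _) _.
by rewrite normcB; lra.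
Qed.

Lemma ucvg_lim (x : nat -> C) l :
  (forall e : R, 0 < e -> exists N, forall n, (N <= n)%N -> normc (x n - l) < e) ->
  ucvg x l.
Proof. by move=> h e e0; have [N hN] := h _ e0; exact: freeU_tail hN. Qed.

End UltraLimit.

(** * Separable Hilbert spaces *)

Section HilbertBasics.
Context {R : realType}.
Local Notation C := R[i].
Implicit Types (H K : hilbert R).

Lemma hdot_semidot H : semidot (hdot H).
Proof.
have lin a x y z : hdot H (a *: x + y) z = a * hdot H x z + hdot H y z.
  by rewrite linearDl linearZl_LR.
split=> // [x y|x]; first by rewrite hermitian_subproof expr0 mul1r.
have : 0 <= `|x| ^+ 2 by rewrite exprn_ge0.
by rewrite hdot_norm ge0cE => /andP[].
Qed.

(** The norm of the library takes its values in [R[i]]; this is its real-valued form. *)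
Definition hnorm H (x : H) : R := snorm (hdot H) x.

Lemma hnormE H (x : H) : `|x| = (hnorm x)%:C.
Proof.
apply/eqP; rewrite -(@eqrXn2 _ 2) //; last by rewrite lecR snorm_ge0.
have sP := hdot_semidot H.
by rewrite -rmorphXn /= snorm_sqr // -sd_real // hdot_norm.
Qed.

Lemma hnorm_eq0 H (x : H) : hnorm x = 0 -> x = 0.
Proof. by move=> h; apply: normr0_eq0; rewrite hnormE h. Qed.

Lemma hdot_inj H (x y : H) : (forall z, hdot H x z = hdot H y z) -> x = y.
Proof.
move=> h; apply/eqP; rewrite -subr_eq0; apply/eqP/hnorm_eq0.
by rewrite /hnorm /snorm (sdBl (hdot_semidot H)) h subrr sqrtr0.
Qed.

Lemma hnorm_le_eq0 H (x : H) : (forall e : R, 0 < e -> hnorm x <= e) -> x = 0.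
Proof.
move=> h; apply: hnorm_eq0; apply/eqP; rewrite eq_le (snorm_ge0) andbT.
by apply/ler_addgt0Pr => e /h; rewrite add0r.
Qed.

Definition cauchy_seq_for (T : Type) (d : T -> T -> R) (x : nat -> T) :=
  forall e : R, 0 < e -> exists N, forall m n, (N <= m)%N -> (N <= n)%N ->
    d (x m) (x n) < e.

Definition lim_for (T : Type) (d : T -> T -> R) (x : nat -> T) (l : T) :=
  forall e : R, 0 < e -> exists N, forall n, (N <= n)%N -> d (x n) l < e.

Lemma hilbert_complete H (x : nat -> H) :
  cauchy_seq_for (fun u v => hnorm (u - v)) x ->
  exists l, lim_for (fun u v => hnorm (u - v)) x l.
Proof.
move=> cx; have : cauchy (x @ \oo).
  apply/cauchy_ballP => e e0; rewrite /= near_map2.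
  have er : e = (Re e)%:C by rewrite RRe_real // gtr0_real.
  have er0 : 0 < Re e by move: e0; rewrite er ltcR.
  have [N hN] := cx _ er0.
  exists ([set n | (N <= n)%N], [set n | (N <= n)%N]); first by split; exists N.
  move=> [m n] /= [hm hn]; rewrite -ball_normE /= hnormE er ltcR.
  exact: hN.
move=> /cauchy_cvg /cvg_ex[l /cvgrPdist_lt xl]; exists l => e e0.
have e0' : (0 : C) < e%:C by rewrite ltcR.
have [N _ hN] := xl _ e0'.
by exists N => n /hN /=; rewrite distrC hnormE ltcR.
Qed.

Lemma hilbert_dense_seq H :
  exists s : nat -> H, forall x (e : R), 0 < e -> exists n, hnorm (x - s n) < e.
Proof.
have [D cD dD] := hseparable H.
have near_D (x : H) (e : R) : 0 < e -> exists2 y, D y & hnorm (x - y) < e.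
  move=> e0; have e0' : (0 : C) < e%:C by rewrite ltcR.
  have [||y [hy Dy]] := dD (ball x e%:C).
  - by exists x; exact: ballxx.
  - exact: ball_open.
  - by exists y => //; move: hy; rewrite -ball_normE /= hnormE ltcR.
have [y0 Dy0 _] := near_D 0 1 ltr01.
have [f fD] := countable_injP D cD.
(* [f] injects [D] into the integers; [s] inverts it, with the value [y0] off its image. *)
pose s n := xget y0 [set y | D y /\ f y = n].
exists s => x e /(near_D x)[y Dy hy]; exists (f y).
rewrite /s; case: xgetP => [z _ [Dz fz]|/(_ y)[]//].
by rewrite (fD z y) // inE.
Qed.

Lemma bounded_opP H K (a : H -> K) :
  (linear a /\ continuous a) <->
  linear a /\ exists2 M : R, 0 <= M & forall x, hnorm (a x) <= M * hnorm x.
Proof.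
split=> [[la ca]|[la [M M0 hM]]]; split=> //; have [g ga] := mk_linear la.
  have : continuous g by rewrite ga.
  move=> /linear_bounded_continuous /linear_boundedP /pinfty_ex_gt0[r r0 hr].
  have er : r = (Re r)%:C by rewrite RRe_real // gtr0_real.
  exists (Re r) => [|x]; first by move: (ltW r0); rewrite er lecR.
  by have := hr x; rewrite ga !hnormE er -rmorphM lecR.
rewrite -ga; apply/linear_bounded_continuous/linear_boundedP.
near=> r => x; have : M%:C <= r by near: r; apply: nbhs_pinfty_ge; rewrite complex_real.
move=> Mr; apply: le_trans (ler_wpM2r _ Mr) => //.
by rewrite ga !hnormE -rmorphM lecR.
Unshelve. all: by end_near. Qed.

End HilbertBasics.

Section HilbertOfSemidot.
Context {R : realType}.
Local Notation C := R[i].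
Variables (T : lmodType C) (g : T -> T -> C).
Hypothesis gP : semidot g.
Hypothesis g_eq0 : forall x, snorm g x = 0 -> x = 0.
Hypothesis g_complete : forall x : nat -> T,
  cauchy_seq_for (fun u v => snorm g (u - v)) x ->
  exists l, lim_for (fun u v => snorm g (u - v)) x l.
Hypothesis g_separable :
  exists s : nat -> T, forall x (e : R), 0 < e -> exists n, snorm g (x - s n) < e.

(* The carrier is a copy of [T], so that its norm can depend on [g]. *)
Definition dot_space (_ : semidot g) (_ : forall x, snorm g x = 0 -> x = 0) : Type := T.
Local Notation V := (dot_space gP g_eq0).

HB.instance Definition _ := GRing.Lmodule.copy V T.

Let norm (x : V) : C := (snorm g x)%:C.

Let normD (x y : V) : norm (x + y) <= norm x + norm y.
Proof. by rewrite /norm -rmorphD lecR; exact: snormD. Qed.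

Let normZ (l : C) (x : V) : norm (l *: x) = `|l| * norm x.
Proof. by rewrite /norm normCE -rmorphM /=; congr (_%:C); exact: snormZ. Qed.

Let norm_eq0 (x : V) : norm x = 0 -> x = 0.
Proof. by move=> [h]; exact: g_eq0. Qed.

HB.instance Definition _ := Lmodule_isNormed.Build C V normD normZ norm_eq0.

Let V_norm (x : V) : `|x| = (snorm g x)%:C. Proof. by []. Qed.

(** A Cauchy filter contains a ball of radius 1/(n+1) for each n; the centres form a Cauchy sequence
    and its limit is the limit of the filter. Sequential completeness of [g] is therefore enough. *)
Let V_complete (F : set_system V) : ProperFilter F -> cauchy F -> cvg F.
Proof.
move=> FF cF.
have /choice[p hp] n : exists p : V, F (ball p (n.+1%:R^-1 : R)%:C).
  have h0 : (0 : C) < (n.+1%:R^-1 : R)%:C by rewrite ltcR invS_gt0.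
  exact: (proj1 (cauchyP F) cF _ h0).
have dist n m : snorm g (p n - p m) < n.+1%:R^-1 + m.+1%:R^-1.
  have [z [hz1 hz2]] := filter_ex (filterI (hp n) (hp m)).
  move: hz1 hz2; rewrite -!ball_normE /= !V_norm !ltcR => hz1 hz2.
  apply: le_lt_trans (snorm_trans gP z _ _) _.
  by rewrite (snormB gP z) ltrD.
have [|l hl] := @g_complete p.
  move=> e e0; have e20 : 0 < e / 2 by rewrite divr_gt0.
  have [N hN] := invS_small e20; exists N => m n hm hn.
  apply: lt_trans (dist _ _) _.
  by rewrite [e]splitr ltrD // hN.
apply/cvg_ex; exists l; apply/cvgrPdist_lt => e e0.
have er : e = (Re e)%:C by rewrite RRe_real // gtr0_real.
have er0 : 0 < Re e by move: e0; rewrite er ltcR.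
have e20 : 0 < Re e / 2 by rewrite divr_gt0.
have [N hN] := invS_small e20; have [M hM] := hl _ e20.
have := hp (maxn N M); apply: filterS => z; rewrite -ball_normE /= !V_norm ltcR.
rewrite er ltcR => hz; apply: le_lt_trans (snorm_trans gP (p (maxn N M)) _ _) _.
rewrite (snormB gP l) [X in _ < X]splitr ltrD //; first exact: hM (leq_maxr N M).
exact: lt_trans hz (hN _ (leq_maxl N M)).
Qed.

HB.instance Definition _ := Uniform_isComplete.Build V V_complete.

Definition dot_space_dot (x y : V) : C := g x y.

Let dot_linr (x : V) : linear_for (Num.conj \; *%R) (dot_space_dot x).
Proof. by move=> a y z; rewrite /dot_space_dot sdDr // sdZr. Qed.
Let dot_linl (y : V) : linear_for *%R (dot_space_dot ^~ y).
Proof. by move=> a x z; rewrite /dot_space_dot sdDl // sdZl. Qed.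
HB.instance Definition _ :=
  @bilinear_isBilinear.Build C V V C *%R (Num.conj \; *%R) dot_space_dot
    (dot_linl, dot_linr).

Let dot_herm (x y : V) :
  dot_space_dot x y = (-1) ^+ false * Num.conj (dot_space_dot y x).
Proof. by rewrite expr0 mul1r; exact: (sd_herm gP). Qed.
HB.instance Definition _ :=
  @isHermitianSesquilinear.Build C V false Num.conj dot_space_dot dot_herm.

Let dot_gt0 (x : V) : x != 0 -> 0 < dot_space_dot x x.
Proof.
move=> x0; rewrite /dot_space_dot (sd_real gP) ltcR lt0r (sd_ge0 gP) andbT.
apply: contraNneq x0 => h; apply/eqP/g_eq0.
by rewrite /snorm h sqrtr0.
Qed.
HB.instance Definition _ := @isDotProduct.Build C V dot_space_dot dot_gt0.

Let dot_norm (x : V) : dot_space_dot x x = `|x| ^+ 2.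
Proof. by rewrite V_norm -rmorphXn /= snorm_sqr //; exact: (sd_real gP). Qed.

Let V_separable : exists2 D : set V, countable D & dense D.
Proof.
have [s hs] := g_separable; exists (range s); first exact: sub_countable (card_image_le _ _) _.
move=> O [x Ox] oO; have /nbhs_ballP[e /= e0 hO] : nbhs x O by exact: open_nbhs_nbhs.
have er : e = (Re e)%:C by rewrite RRe_real // gtr0_real.
have er0 : 0 < Re e by move: e0; rewrite er ltcR.
have [n hn] := hs x _ er0; exists (s n); split; last by exists n.
by apply: hO; rewrite -ball_normE /= V_norm er ltcR.
Qed.

Definition dot_hilbert : hilbert R :=
  @Hilbert R V dot_space_dot dot_norm V_separable.

End HilbertOfSemidot.

Lemma hilbert_of_semidot (R : realType) (T : lmodType R[i]) (g : T -> T -> R[i]) :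
  semidot g -> (forall x, snorm g x = 0 -> x = 0) ->
  (forall x : nat -> T, cauchy_seq_for (fun u v => snorm g (u - v)) x ->
     exists l, lim_for (fun u v => snorm g (u - v)) x l) ->
  (exists s : nat -> T, forall x (e : R), 0 < e -> exists n, snorm g (x - s n) < e) ->
  exists (H : hilbert R) (i : T -> H),
    [/\ linear i, forall x y, hdot H (i x) (i y) = g x y & forall h, exists x, i x = h].
Proof.
move=> gP g0 gc gs; exists (dot_hilbert gP g0 gc gs), id; split=> // h; by exists h.
Qed.

(** * Completion of a semi-inner product space *)

Section Completion.
Context {R : realType}.
Local Notation C := R[i].
Variables (E : lmodType C) (g : E -> E -> C).
Hypothesis gP : semidot g.

(* An element [f] of the completion is represented by the antilinear functional
   [q |-> <f, q>], which is a limit of functionals [g p] in the dual norm. *)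
Definition dual_approx (f : E -> C) (e : R) (p : E) :=
  forall q, normc (f q - g p q) <= e * snorm g q.
Definition in_completion : pred (E -> C) :=
  fun f => `[< forall e : R, 0 < e -> exists p, dual_approx f e p >].

Fact in_completion_submod : submod_closed in_completion.
Proof.
split=> [|a f h /asboolP hf /asboolP hh].
  by apply/asboolP => e e0; exists 0 => q; rewrite (sd0l gP) subr0 Normc.normc0
    mulr_ge0 ?snorm_ge0 // ltW.
apply/asboolP => e e0.
have a0 := normc_ge0 a.
have e1 : 0 < e / 2 / (normc a + 1) by rewrite !divr_gt0 //; lra.
have [p hp] := hf _ e1; have [|q hq] := hh (e / 2); first by rewrite divr_gt0.
exists (a *: p + q) => z; rewrite (sdDl gP) (sdZl gP) /= /GRing.scale /=.
have -> : a * f z + h z - (a * g p z + g q z) = a * (f z - g p z) + (h z - g q z).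
  by ring.
apply: le_trans (normcD _ _) _; rewrite Normc.normcM.
have := hp z; have := hq z; have z0 := snorm_ge0 g z => h1 h2.
have : normc a * normc (f z - g p z) <= e / 2 * snorm g z; last by lra.
apply: le_trans (ler_wpM2l a0 h2) _.
rewrite mulrA ler_wpM2r // mulrA ler_pdivrMr; last by lra.
by rewrite mulrC ler_wpM2l; lra.
Qed.

HB.instance Definition _ :=
  GRing.isSubmodClosed.Build C (E -> C) in_completion in_completion_submod.

Record completion := Completion {
  cfun : E -> C; cfunP : in_completion cfun }.

HB.instance Definition _ := [isSub for cfun].
HB.instance Definition _ := [Choice of completion by <:].
HB.instance Definition _ := [SubChoice_isSubLmodule of completion by <:].

Implicit Types f h : completion.

Lemma rep_exists f : exists r : nat -> E,
  forall n, dual_approx (cfun f) n.+1%:R^-1 (r n).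
Proof.
suff /choice[r hr] : forall n : nat, exists r, dual_approx (cfun f) n.+1%:R^-1 r.
  by exists r.
move=> n; have /asboolP := cfunP f; apply.
by rewrite invr_gt0 ltr0n.
Qed.

Definition rep f : nat -> E := proj1_sig (cid (rep_exists f)).

Lemma repP f n q : normc (cfun f q - g (rep f n) q) <= n.+1%:R^-1 * snorm g q.
Proof. by rewrite /rep; case: cid => r hr /=; apply: hr. Qed.

Lemma snorm_dual_le (p : E) (e : R) : 0 <= e ->
  (forall q, normc (g p q) <= e * snorm g q) -> snorm g p <= e.
Proof.
move=> e0 h; have := h p; have := snorm_sqr gP p; have := Re_le (g p p).
have := snorm_ge0 g p; set s := snorm _ _ => s0 h1 h2 h3.
have [->//|sn0] := eqVneq s 0.
have sp : 0 < s by rewrite lt0r sn0.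
rewrite -(ler_pM2r sp); move: h2; rewrite expr2; lra.
Qed.

Lemma cfun_ucvg f q : ucvg (fun n => g (rep f n) q) (cfun f q).
Proof.
apply: ucvg_lim => e e0; have [N hN] := harmonic_small (snorm g q) e0.
exists N => n /hN hn; rewrite normcB; apply: le_lt_trans (repP f n q) _.
by rewrite mulrC.
Qed.

Lemma cfunB f p q : cfun f (p - q) = cfun f p - cfun f q.
Proof.
apply: (ucvg_unique (cfun_ucvg f (p - q))).
rewrite (_ : (fun n => _) = fun n => g (rep f n) p + -1 * g (rep f n) q).
  rewrite -[X in _ - X]mul1r -mulNr.
  by apply: ucvgD (cfun_ucvg _ _) (ucvgZ _ (cfun_ucvg _ _)).
by apply/funext => n; rewrite (sdBr gP) mulN1r.
Qed.

Lemma cfun_bounded f : exists2 B, 0 <= B & forall q, normc (cfun f q) <= B * snorm g q.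
Proof.
exists (1 + snorm g (rep f 0)) => [|q]; first by rewrite addr_ge0 // snorm_ge0.
rewrite -[cfun f q](subrK (g (rep f 0) q)); apply: le_trans (normcD _ _) _.
rewrite mulrDl lerD //; last exact: cauchy_schwarz.
by have := repP f 0 q; rewrite invr1.
Qed.

Lemma rep_bounded f : exists2 B, 0 <= B & forall n, snorm g (rep f n) <= B.
Proof.
have [B B0 hB] := cfun_bounded f; exists (B + 1) => [|n]; first by lra.
apply: snorm_dual_le => [|q]; first by lra.
rewrite -[g _ q](subKr (cfun f q)); apply: le_trans (normcD _ _) _.
rewrite mulrDl lerD // normcN; apply: le_trans (repP _ _ _) _.
by rewrite ler_wpM2r ?snorm_ge0 // invf_le1 ?ltr0n // ler1n.
Qed.

(** Pairing [f] with approximants of [h] makes linearity in [f] immediate; hermitian symmetry is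
    read off [cdot_ucvg_rep], where both arguments are replaced by approximants. *)
Definition cdot f h : C := ulim (fun n => cfun f (rep h n)).

Lemma cdot_ucvg f h : ucvg (fun n => cfun f (rep h n)) (cdot f h).
Proof.
have [B B0 hB] := cfun_bounded f; have [D D0 hD] := rep_bounded h.
apply: (@ucvg_ulim _ _ (B * D)) => n; apply: le_trans (hB _) _.
by rewrite ler_wpM2l.
Qed.

Lemma cdot_ucvg_rep f h : ucvg (fun n => g (rep f n) (rep h n)) (cdot f h).
Proof.
apply: ucvg_eq (cdot_ucvg f h) _ => e e0; have [D D0 hD] := rep_bounded h.
have [N hN] := harmonic_small D e0; exists N => n /hN; apply: le_lt_trans.
apply: le_trans (repP _ _ _) _; rewrite mulrC ler_wpM2r // invr_ge0 //.
Qed.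

Lemma cdot_semidot : semidot cdot.
Proof.
split=> [a f h k|f h|f].
- apply: (ucvg_unique (cdot_ucvg _ _)).
  by apply: ucvgD (ucvgZ _ (cdot_ucvg _ _)) (cdot_ucvg _ _).
- apply: (ucvg_unique (cdot_ucvg_rep _ _)).
  rewrite (_ : (fun n => _) = fun n => conjc (g (rep f n) (rep h n))).
    exact: ucvg_conj (cdot_ucvg_rep _ _).
  by apply/funext => n; rewrite (sd_herm gP).
- apply: (ucvg_Re_ge (cdot_ucvg_rep f f)).
  by apply: (@freeU_tail _ 0%N) => n _ /=; exact: sd_ge0.
Qed.

Fact dual_in_completion (p : E) : in_completion (g p).
Proof.
apply/asboolP => e e0; exists p => q; rewrite subrr Normc.normc0.
by rewrite mulr_ge0 ?snorm_ge0 // ltW.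
Qed.

Definition to_completion (p : E) : completion := Completion (dual_in_completion p).

Lemma to_completion_linear : linear to_completion.
Proof.
move=> a p q; apply: val_inj; apply/funext => z.
by rewrite /= (sdDl gP) (sdZl gP).
Qed.

Lemma to_completionB p q : to_completion p - to_completion q = to_completion (p - q).
Proof. by apply: val_inj; apply/funext => z; rewrite /= (sdBl gP). Qed.

Lemma cdot_to f p : cdot f (to_completion p) = cfun f p.
Proof.
apply: ulimE; apply: ucvg_lim => e e0; have [B B0 hB] := cfun_bounded f.
have [N hN] := harmonic_small B e0; exists N => n /hN; apply: le_lt_trans.
rewrite -cfunB; apply: le_trans (hB _) _; rewrite ler_wpM2l // snormB //.
apply: snorm_dual_le => [|q]; first by rewrite invr_ge0.
by rewrite (sdBl gP); exact: (repP (to_completion p)).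
Qed.

Lemma cdot_to_to p q : cdot (to_completion p) (to_completion q) = g p q.
Proof. exact: cdot_to. Qed.

Lemma cfun_le_snorm f q : normc (cfun f q) <= snorm cdot f * snorm g q.
Proof.
rewrite -cdot_to; apply: le_trans (cauchy_schwarz cdot_semidot _ _) _.
by rewrite /snorm cdot_to_to.
Qed.

Lemma cdot_eq0 f : snorm cdot f = 0 -> f = 0.
Proof.
move=> f0; apply: val_inj; apply/funext => q; apply/eqP.
by rewrite -normc_eq0 eq_le normc_ge0 andbT; have := cfun_le_snorm f q;
  rewrite f0 mul0r.
Qed.

Lemma to_completion_dense f (e : R) : 0 < e ->
  exists p, snorm cdot (f - to_completion p) < e.
Proof.
(* In |f - p|^2 = <f, f> + <p, p> - 2 Re <f, p> the error of <p, p> counts once and that of <f, p>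
   twice, whence the third of e^2. *)
move=> e0; have e1 : 0 < e ^+ 2 / 3 by rewrite divr_gt0 // exprn_gt0.
have [n /= [h1 h2]] := freeU_ex (filterI (cdot_ucvg f f e1) (cdot_ucvg_rep f f e1)).
exists (rep f n); rewrite -(ltr_pXn2r (ltn0Sn 1)) ?nnegrE ?snorm_ge0 ?ltW //.
rewrite (snormB_sqr cdot_semidot) !(snorm_sqr cdot_semidot) cdot_to_to cdot_to.
have := Re_le_normc (cfun f (rep f n) - cdot f f).
have := Re_le_normc (g (rep f n) (rep f n) - cdot f f).
by rewrite !ReB !ler_norml => /andP[? ?] /andP[? ?]; lra.
Qed.

(** The bound is known only on vectors coming from [E]. Splitting <f, f> = <f, f - p> + <f, p> with
    [p] close to [f] gives N^2 <= e N for the norm N of [f]. *)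
Lemma cdot_dual_le f (e : R) : 0 <= e ->
  (forall q, normc (cfun f q) <= e * snorm g q) -> snorm cdot f <= e.
Proof.
move=> e0 h; set N := snorm cdot f.
have N0 : 0 <= N by exact: snorm_ge0.
have key d : 0 < d -> N ^+ 2 <= N * d + e * (N + d).
  move=> d0; have [p hp] := to_completion_dense f d0.
  rewrite (snorm_sqr cdot_semidot) -[X in cdot f X](subrK (to_completion p)).
  rewrite (sdDr cdot_semidot) ReD lerD //.
    apply: le_trans (Re_le _) _; apply: le_trans (cauchy_schwarz cdot_semidot _ _) _.
    by rewrite ler_wpM2l // ltW.
  rewrite cdot_to; apply: le_trans (Re_le _) _; apply: le_trans (h _) _.
  rewrite ler_wpM2l //.
  have <- : snorm cdot (to_completion p) = snorm g p by rewrite /snorm cdot_to_to.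
  rewrite -[to_completion p](subKr f); apply: le_trans (snormD cdot_semidot _ _) _.
  by rewrite (snormN cdot_semidot) lerD2l ltW.
have N2 : N ^+ 2 <= e * N.
  apply/ler_addgt0Pr => d d0.
  have s0 : 0 < N + e + 1 by lra.
  have := key (d / (N + e + 1)) (divr_gt0 d0 s0).
  have -> : N * (d / (N + e + 1)) + e * (N + d / (N + e + 1)) =
     e * N + (N + e) * (d / (N + e + 1)) by ring.
  move=> h1; apply: le_trans h1 _; rewrite lerD2l mulrA ler_pdivrMr // mulrC.
  by rewrite ler_wpM2l ?ltW //; lra.
have [->//|Nn0] := eqVneq N 0.
have Np : 0 < N by rewrite lt0r Nn0.
by rewrite -(ler_pM2r Np) -expr2.
Qed.

(** The functionals converge pointwise along the ultrafilter, and the Cauchy estimate, being uniform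
    in [q], passes to the limit: convergence holds in the dual norm, which is the norm of the
    completion. *)
Lemma completion_complete (x : nat -> completion) :
  cauchy_seq_for (fun u v => snorm cdot (u - v)) x ->
  exists l, lim_for (fun u v => snorm cdot (u - v)) x l.
Proof.
move=> cx; have [N0 hN0] := cx 1 ltr01.
have bx q n : normc (cfun (x (n + N0)%N) q) <= (snorm cdot (x N0) + 1) * snorm g q.
  apply: le_trans (cfun_le_snorm _ _) _; rewrite ler_wpM2r ?snorm_ge0 //.
  have := snormD cdot_semidot (x (n + N0)%N - x N0) (x N0); rewrite subrK.
  by have := hN0 (n + N0)%N N0 (leq_addl _ _) (leqnn _); lra.
pose F q := ulim (fun n => cfun (x (n + N0)%N) q).
have hF q := ucvg_ulim (bx q).
have FB (e : R) : 0 < e -> exists N, forall n q, (N <= n)%N ->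
    normc (cfun (x n) q - F q) <= e * snorm g q.
  move=> e0; have [N hN] := cx e e0; exists N => n q hn; rewrite normcB.
  have := ucvgD (hF q) (ucvg_cst (- cfun (x n) q)) => /ucvg_normc_le; apply.
  apply: (@freeU_tail _ N) => m hm /=.
  have -> : cfun (x (m + N0)%N) q - cfun (x n) q = cfun (x (m + N0)%N - x n) q by [].
  apply: le_trans (cfun_le_snorm _ _) _; rewrite ler_wpM2r ?snorm_ge0 // ltW //.
  by apply: hN => //; apply: leq_trans hm (leq_addr _ _).
have FK : in_completion F.
  apply/asboolP => e e0; have e20 : 0 < e / 2 by rewrite divr_gt0.
  have [N hN] := FB _ e20; have /asboolP /(_ _ e20)[p hp] := cfunP (x N).
  exists p => q; rewrite -(subrKA (cfun (x N) q)); apply: le_trans (normcD _ _) _.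
  rewrite normcB; have := hN _ q (leqnn N); have := hp q; lra.
exists (Completion FK) => e e0; have e20 : 0 < e / 2 by rewrite divr_gt0.
have [N hN] := FB _ e20; exists N => n hn.
apply: (@le_lt_trans _ _ (e / 2)); last by lra.
apply: cdot_dual_le => [|q]; first exact: ltW.
exact: hN.
Qed.

End Completion.

Lemma hilbert_completion (R : realType) (E : lmodType R[i]) (g : E -> E -> R[i]) :
  semidot g ->
  (exists s : nat -> E, forall x (e : R), 0 < e -> exists n, snorm g (x - s n) < e) ->
  exists (K : hilbert R) (J : E -> K),
    [/\ linear J, forall x y, hdot K (J x) (J y) = g x y &
        forall k (e : R), 0 < e -> exists x, hnorm (k - J x) < e].
Proof.
move=> gP [s hs].
have [||K [i [il ig ionto]]] := hilbert_of_semidot (cdot_semidot gP) (@cdot_eq0 _ _ _ gP).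
- exact: completion_complete.
- exists (fun n => to_completion g (s n)) => f e e0.
  have e20 : 0 < e / 2 by rewrite divr_gt0.
  have [p hp] := to_completion_dense gP f e20; have [n hn] := hs p _ e20.
  exists n; apply: le_lt_trans (snorm_trans (cdot_semidot gP) (to_completion g p) _ _) _.
  rewrite (to_completionB gP) [X in _ + X]/snorm (cdot_to_to gP); move: hp hn; rewrite /snorm; lra.
exists K, (fun p => i (to_completion g p)); split=> [a p q|p q|k e e0].
- by rewrite to_completion_linear il.
- by rewrite ig (cdot_to_to gP).
- have [f <-] := ionto k; have [p hp] := to_completion_dense gP f e0; exists p.
  have := il (-1) (to_completion g p) f; rewrite !scaleN1r => iB.
  by rewrite addrC -iB [X in i X]addrC /hnorm /snorm ig.
Qed.

(** * Total sequences and positive definite kernels *)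

Section Combinations.
Context {R : realType}.
Local Notation C := R[i].

(* Polynomials serve as finitely supported coefficient sequences. *)
Definition comb (V : lmodType C) (b : nat -> V) (p : {poly C}) : V :=
  \sum_(i < size p) p`_i *: b i.

Lemma comb_widen (V : lmodType C) (b : nat -> V) (p : {poly C}) n :
  (size p <= n)%N -> comb b p = \sum_(i < n) p`_i *: b i.
Proof.
move=> hn; rewrite /comb (big_ord_widen n (fun i => p`_i *: b i) hn) big_mkcond.
apply: eq_bigr => i _; case: ltnP => // h.
by rewrite nth_default // scale0r.
Qed.

Lemma comb_linear (V : lmodType C) (b : nat -> V) : linear (comb b).
Proof.
move=> a p q; pose n := maxn (size p) (size q).
have hp : (size p <= n)%N by exact: leq_maxl.
have hq : (size q <= n)%N by exact: leq_maxr.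
have hs : (size (a *: p + q)%R <= n)%N.
  apply: leq_trans (size_polyD _ _) _; rewrite geq_max hq andbT.
  exact: leq_trans (size_scale_leq _ _) hp.
rewrite (comb_widen b hp) (comb_widen b hq) (comb_widen b hs) scaler_sumr -big_split.
by apply: eq_bigr => i _; rewrite coefD coefZ scalerDl scalerA.
Qed.

Lemma combXn (V : lmodType C) (b : nat -> V) n : comb b 'X^n = b n.
Proof.
rewrite (@comb_widen _ _ _ n.+1) ?size_polyXn // (bigD1 ord_max) //= coefXn eqxx.
rewrite scale1r big1 ?addr0 // => i; rewrite -val_eqE /= => ni.
by rewrite coefXn (negPf ni) scale0r.
Qed.

Definition htotal (H : hilbert R) (a : nat -> H) :=
  forall x (e : R), 0 < e -> exists p, hnorm (x - comb a p) < e.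

(** Polynomials with coefficients in Q + iQ are countable, and a coefficientwise approximation is
    also one for [g], with weights the seminorms of the monomials. *)
Lemma rat_poly_dense (g : {poly C} -> {poly C} -> C) : semidot g ->
  exists s : nat -> {poly C}, forall x (e : R), 0 < e -> exists n, snorm g (x - s n) < e.
Proof.
move=> gP; pose toC (z : rat * rat) : C := ratr z.1 +i* ratr z.2.
pose s n := Poly (map toC (odflt [::] (unpickle n : option (seq (rat * rat))))).
exists s => p e e0; pose B := \sum_(i < size p) snorm g 'X^i.
have B0 : 0 <= B by apply: sumr_ge0 => i _; exact: snorm_ge0.
have d0 : 0 < e / (B + 1) by rewrite divr_gt0 //; lra.
have apx (x d : R) : 0 < d -> exists q : rat, `|x - ratr q| < d.
  move=> dp; have [|q] := @rat_in_itvoo _ (x - d) (x + d); first by lra.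
  by rewrite in_itv /= => /andP[h1 h2]; exists q; rewrite ltr_norml; apply/andP; split; lra.
have /choice[r hr] : forall z : C, exists q, normc (z - toC q) < e / (B + 1).
  move=> z; have d20 : 0 < e / (B + 1) / 2 by rewrite divr_gt0.
  have [q hq] := apx (Re z) _ d20; have [q' hq'] := apx (Im z) _ d20.
  exists (q, q'); apply: le_lt_trans (normc_le_ReIm _) _.
  by rewrite ReB ImD ImN /=; lra.
exists (pickle (map r p)); rewrite /s pickleK /= -map_comp.
have -> : p - Poly (map (toC \o r) p) = \sum_(i < size p) (p`_i - toC (r p`_i)) *: 'X^i.
  apply/polyP => j; rewrite coefB coef_Poly coef_sum.
  have [hj|hj] := ltnP j (size p).
    rewrite (nth_map 0) // (bigD1 (Ordinal hj)) //= coefZ coefXn eqxx mulr1.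
    rewrite big1 ?addr0 // => i; rewrite -val_eqE /= eq_sym => ni.
    by rewrite coefZ coefXn (negPf ni) mulr0.
  rewrite !nth_default ?size_map // subrr big1 // => i _.
  by rewrite coefZ coefXn gtn_eqF ?mulr0 // (leq_trans (ltn_ord i) hj).
apply: le_lt_trans (snorm_sum gP _ _ _) _.
apply: (@le_lt_trans _ _ (e / (B + 1) * B)); last first.
  by rewrite mulrAC ltr_pdivrMr; [rewrite ltr_pM2l //; lra|lra].
rewrite mulr_sumr; apply: ler_sum => i _; rewrite (snormZ gP).
by rewrite ler_wpM2r ?snorm_ge0 // ltW.
Qed.

(** Kolmogorov decomposition: the kernel defines a semi-inner product on [{poly C}] for which the
    monomials have Gram matrix [k], and [K] is its completion. *)
Lemma kolmogorov (k : nat -> nat -> C) :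
  (forall i j, k j i = conjc (k i j)) ->
  (forall n (c : nat -> C),
     0 <= Re (\sum_(i < n) \sum_(j < n) c i * conjc (c j) * k i j)) ->
  exists (K : hilbert R) (b : nat -> K),
    htotal b /\ forall i j, hdot K (b i) (b j) = k i j.
Proof.
move=> kh kp; pose g (p q : {poly C}) := 
  \sum_(i < size p) \sum_(j < size q) p`_i * conjc q`_j * k i j.
have gE (p q : {poly C}) n : (size p <= n)%N -> (size q <= n)%N ->
    g p q = \sum_(i < n) \sum_(j < n) p`_i * conjc q`_j * k i j.
  move=> hp hq.
  have -> : g p q = \sum_(i < size p) \sum_(j < n) p`_i * conjc q`_j * k i j.
    apply: eq_bigr => i _.
    rewrite (big_ord_widen n (fun j => p`_i * conjc q`_j * k i j) hq) big_mkcond.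
    apply: eq_bigr => j _; case: ltnP => // h.
    by rewrite (nth_default _ h) conjc0 mulr0 mul0r.
  rewrite (big_ord_widen n (fun i => \sum_(j < n) p`_i * conjc q`_j * k i j) hp).
  rewrite big_mkcond; apply: eq_bigr => i _; case: ltnP => // h.
  by rewrite big1 // => j _; rewrite (nth_default _ h) !mul0r.
have gP : semidot g.
  split=> [a p q r|p q|p]; last exact: kp.
    pose n := maxn (maxn (size p) (size q)) (size r).
    have hr : (size r <= n)%N by exact: leq_maxr.
    have hp : (size p <= n)%N by rewrite !leq_max leqnn.
    have hq : (size q <= n)%N by rewrite !leq_max leqnn orbT.
    have hs : (size (a *: p + q)%R <= n)%N.
      apply: leq_trans (size_polyD _ _) _; rewrite geq_max hq andbT.
      exact: leq_trans (size_scale_leq _ _) hp.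
    rewrite !(gE _ _ n) // mulr_sumr -big_split; apply: eq_bigr => i _ /=.
    rewrite mulr_sumr -big_split; apply: eq_bigr => j _ /=.
    by rewrite coefD coefZ; ring.
  rewrite /g conjc_sum exchange_big; apply: eq_bigr => i _; rewrite conjc_sum.
  by apply: eq_bigr => j _; rewrite (kh i j) !conjcM conjcK; ring.
have [K [J [Jl Jg Jd]]] := hilbert_completion gP (rat_poly_dense gP).
have combJ (p : {poly C}) : comb (fun i => J 'X^i) p = J p.
  pose L := GRing.isLinear.Build C _ _ *:%R J Jl.
  pose J' : {linear {poly C} -> K} := HB.pack J L.
  rewrite -[p in RHS]coefK poly_def -[J _]/(J' _) linear_sum.
  by apply: eq_bigr => i _; rewrite linearZ.
exists K, (fun i => J 'X^i); split=> [x e e0|i j].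
  by have [p hp] := Jd x e e0; exists p; rewrite combJ.
rewrite Jg; pose n := (maxn i j).+1.
rewrite (gE _ _ n) ?size_polyXn ?ltnS ?leq_maxl ?leq_maxr //.
have hi : (i < n)%N by rewrite ltnS leq_maxl.
have hj : (j < n)%N by rewrite ltnS leq_maxr.
rewrite (bigD1 (Ordinal hi)) //= [X in _ + X]big1 => [|l]; last first.
  rewrite -val_eqE /= => ni; rewrite big1 // => m _.
  by rewrite coefXn (negPf ni) !mul0r.
rewrite (bigD1 (Ordinal hj)) //= [X in _ + X + _]big1 => [|m]; last first.
  by rewrite -val_eqE /= => ni; rewrite [_`_m]coefXn (negPf ni) conjc0 mulr0 mul0r.
by rewrite !coefXn !eqxx conjc1 !mul1r !addr0.
Qed.

End Combinations.

(** * Isometries, nearest points and projections *)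

Section Isometries.
Context {R : realType}.
Local Notation C := R[i].
Implicit Types (H K : hilbert R).

Lemma lin0 (U V : lmodType C) (f : U -> V) : linear f -> f 0 = 0.
Proof. by move=> /mk_linear[g <-]; rewrite linear0. Qed.
Lemma linD (U V : lmodType C) (f : U -> V) x y : linear f -> f (x + y) = f x + f y.
Proof. by move=> /mk_linear[g <-]; rewrite linearD. Qed.
Lemma linB (U V : lmodType C) (f : U -> V) x y : linear f -> f (x - y) = f x - f y.
Proof. by move=> /mk_linear[g <-]; rewrite linearB. Qed.
Lemma linZ (U V : lmodType C) (f : U -> V) a x : linear f -> f (a *: x) = a *: f x.
Proof. by move=> /mk_linear[g <-]; rewrite linearZ. Qed.
Lemma lin_sum (U V : lmodType C) (f : U -> V) I (r : seq I) (P : pred I) (F : I -> U) :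
  linear f -> f (\sum_(i <- r | P i) F i) = \sum_(i <- r | P i) f (F i).
Proof. by move=> /mk_linear[g <-]; rewrite linear_sum. Qed.

Lemma lin_comb (U V : lmodType C) (f : U -> V) (b : nat -> U) p :
  linear f -> f (comb b p) = comb (f \o b) p.
Proof.
by move=> lf; rewrite /comb lin_sum //; apply: eq_bigr => i _; rewrite linZ.
Qed.

Lemma eq_comb (V : lmodType C) (b c : nat -> V) p :
  (forall i, b i = c i) -> comb b p = comb c p.
Proof. by move=> h; apply: eq_bigr => i _; rewrite h. Qed.

Lemma isometry_dot H K (J : H -> K) : linear J ->
  (forall x, hnorm (J x) = hnorm x) -> forall x y, hdot K (J x) (J y) = hdot H x y.
Proof.
move=> lJ nJ.
have re x y : Re (hdot K (J x) (J y)) = Re (hdot H x y).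
  have := snormD_sqr (hdot_semidot H) x y.
  have := snormD_sqr (hdot_semidot K) (J x) (J y).
  rewrite -linD // -![snorm _ _]/(hnorm _) !nJ; lra.
move=> x y; apply: complex_ext; first exact: re.
have key (z : C) : Re (conjc 'i%C * z) = Im z by case: z => c d /=; ring.
have := re x ('i%C *: y); rewrite linZ // (sdZr (hdot_semidot K)) (sdZr (hdot_semidot H)).
by rewrite !key.
Qed.

Lemma dot_isometry H K (J : H -> K) :
  (forall x y, hdot K (J x) (J y) = hdot H x y) -> forall x, hnorm (J x) = hnorm x.
Proof. by move=> h x; rewrite /hnorm /snorm h. Qed.

(** [J] is the closure of the relation between [comb a p] and [comb b p]. Equal Gram matrices make
    this relation norm-preserving, hence single-valued; totality of [a] and completeness of [K] make
    it everywhere defined. *)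
Lemma isometry_extend H K (a : nat -> H) (b : nat -> K) : htotal a ->
  (forall i j, hdot K (b i) (b j) = hdot H (a i) (a j)) ->
  exists J : H -> K, [/\ linear J, forall x y, hdot K (J x) (J y) = hdot H x y &
    forall i, J (a i) = b i].
Proof.
move=> ta hab.
have sH := hdot_semidot H; have sK := hdot_semidot K.
have ncomb p : hnorm (comb b p) = hnorm (comb a p).
  rewrite /hnorm /snorm; congr (Num.sqrt (Re _)).
  rewrite /comb (sd_suml sK) (sd_suml sH); apply: eq_bigr => i _.
  rewrite (sd_sumr sK) (sd_sumr sH); apply: eq_bigr => j _.
  by rewrite (sdZl sK) (sdZl sH) (sdZr sK) (sdZr sH) hab.
pose rel x y := forall e : R, 0 < e ->
  exists p, hnorm (x - comb a p) < e /\ hnorm (y - comb b p) < e.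
have rel_lin c x y x' y' : rel x y -> rel x' y' -> rel (c *: x + x') (c *: y + y').
  move=> h h' e e0; have c0 := normc_ge0 c.
  have d0 : 0 < e / 2 / (normc c + 1) by rewrite !divr_gt0 //; lra.
  have [p [hp1 hp2]] := h _ d0; have [|q [hq1 hq2]] := h' (e / 2); first by rewrite divr_gt0.
  have bnd L (z w : L : hilbert R) : hnorm z < e / 2 / (normc c + 1) -> hnorm w < e / 2 ->
      hnorm (c *: z + w) < e.
    move=> hz hw; apply: le_lt_trans (snormD (hdot_semidot L) _ _) _.
    rewrite (snormZ (hdot_semidot L)) -![snorm _ _]/(hnorm _).
    have : normc c * hnorm z <= e / 2; last by lra.
    have z0 : 0 <= hnorm z by exact: snorm_ge0.
    move: hz; rewrite ltr_pdivlMr; last by lra.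
    by move=> hz; nra.
  exists (c *: p + q); rewrite !comb_linear.
  by split; rewrite opprD addrACA -scalerBr; apply: bnd.
have rel_norm x y : rel x y -> hnorm y = hnorm x.
  move=> h; apply/eqP; rewrite -subr_eq0 -normr_eq0 eq_le normr_ge0 andbT.
  apply/ler_addgt0Pr => e e0; rewrite add0r.
  have [|p [hp1 hp2]] := h (e / 2); first by rewrite divr_gt0.
  have h1 := snorm_lip sH x (comb a p); have h2 := snorm_lip sK y (comb b p).
  have -> : hnorm y - hnorm x =
      (hnorm y - hnorm (comb b p)) - (hnorm x - hnorm (comb a p)) by rewrite ncomb; ring.
  apply: le_trans (ler_normB _ _) _.
  move: h1 h2; rewrite -![snorm _ _]/(hnorm _); lra.
have rel_ex x : exists y, rel x y.
  have /choice[p hp] n := ta x _ (invS_gt0 R n).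
  have [|y hy] := @hilbert_complete _ K (fun n => comb b (p n)).
    move=> e e0; have e20 : 0 < e / 2 by rewrite divr_gt0.
    have [N hN] := invS_small e20; exists N => m n hm hn.
    rewrite -scaleN1r addrC -comb_linear ncomb comb_linear scaleN1r addrC.
    apply: le_lt_trans (snorm_trans sH x _ _) _; rewrite (snormB sH _ x) [X in _ < X]splitr.
    have h1 := hN _ hn; have h2 := hN _ hm.
    by apply: ltrD; [apply: lt_trans (hp m) _|apply: lt_trans (hp n) _].
  exists y => e e0; have [N hN] := invS_small e0; have [M hM] := hy _ e0.
  exists (p (maxn N M)); split; last by rewrite /hnorm (snormB sK); exact: hM (leq_maxr _ _).
  by apply: lt_trans (hp _) _; exact: hN (leq_maxl _ _).
have rel_fun x y y' : rel x y -> rel x y' -> y = y'.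
  move=> h h'; apply/eqP; rewrite -subr_eq0; apply/eqP/hnorm_eq0.
  have := rel_norm _ _ (rel_lin (-1) _ _ _ _ h' h); rewrite !scaleN1r addrC addNr => ->.
  exact: snorm0.
have /choice[J hJ] := rel_ex.
have lJ : linear J by move=> c x y; apply: rel_fun (hJ _) (rel_lin _ _ _ _ _ _ _).
exists J; split=> //; first by apply: isometry_dot => // x; apply: rel_norm.
move=> i; apply: rel_fun (hJ _) _ => e e0; exists 'X^i.
by rewrite !combXn !subrr /hnorm !snorm0.
Qed.

Lemma total_eq H K (a : nat -> H) (f g : H -> K) : htotal a ->
  linear f /\ continuous f -> linear g /\ continuous g ->
  (forall i, f (a i) = g (a i)) -> f = g.
Proof.
move=> ta /bounded_opP[lf [M M0 hM]] /bounded_opP[lg [N N0 hN]] h.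
apply/funext => x; apply/eqP; rewrite -subr_eq0; apply/eqP/hnorm_le_eq0 => e e0.
have d0 : 0 < e / (M + N + 1) by rewrite divr_gt0 //; lra.
have [p hp] := ta x _ d0.
have fg : f (comb a p) = g (comb a p).
  by rewrite !lin_comb //; apply: eq_comb => i; exact: h.
have -> : f x - g x = f (x - comb a p) - g (x - comb a p).
  by rewrite (linB _ _ lf) (linB _ _ lg) fg opprB addrA subrK.
apply: le_trans (snormD (hdot_semidot K) _ _) _.
rewrite (snormN (hdot_semidot K)) -![snorm _ _]/(hnorm _).
have := hM (x - comb a p); have := hN (x - comb a p).
have : 0 <= hnorm (x - comb a p) by exact: snorm_ge0.
move: hp; rewrite ltr_pdivlMr; last by lra.
by set t := hnorm _ => ? ? ? ?; nra.
Qed.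

(** The parallelogram identity makes a minimising sequence Cauchy, and for this stability under
    midpoints suffices. [S] need not be closed, so [r] is only a limit of points of [S]. *)
Lemma nearest_point K (S : set K) (k : K) : S !=set0 ->
  (forall x y, S x -> S y -> S (2^-1 *: (x + y))) ->
  exists r, (forall e : R, 0 < e -> exists2 s, S s & hnorm (s - r) < e) /\
    forall s, S s -> hnorm (k - r) <= hnorm (k - s).
Proof.
move=> [s0 Ss0] mid; have sK := hdot_semidot K.
pose D := [set hnorm (k - s) | s in S].
have D0 : has_inf D.
  split; first by exists (hnorm (k - s0)), s0.
  by exists 0 => _ [s _ <-]; exact: snorm_ge0.
pose d := inf D.
have d0 : 0 <= d.
  by apply: lb_le_inf; [case: D0 | move=> _ [s _ <-]; exact: snorm_ge0].
have dle s : S s -> d <= hnorm (k - s).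
  by move=> Ss; apply: ge_inf; [case: D0 | exists s].
have /choice[s hs] n : exists s, S s /\ hnorm (k - s) < d + n.+1%:R^-1.
  have [_ [s Ss <-] h] := inf_adherent (invS_gt0 R n) D0.
  by exists s.
(* With distances below d + a and d + b, and the midpoint at distance at least d, the parallelogram
   identity leaves 4 d (a + b) + 2 (a^2 + b^2); as a and b are at most 1, their squares are replaced
   by a and b. *)
have near m n : hnorm (s m - s n) ^+ 2 <=
    4 * d * (m.+1%:R^-1 + n.+1%:R^-1) + 2 * (m.+1%:R^-1 + n.+1%:R^-1).
  have := parallelogram sK (k - s m) (k - s n).
  have -> : k - s m - (k - s n) = s n - s m by rewrite opprB addrC addrA subrK.
  have -> : k - s m + (k - s n) = 2 *: (k - 2^-1 *: (s m + s n)).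
    rewrite scalerBr scalerA divff ?pnatr_eq0 // scale1r scaler_nat mulr2n.
    by rewrite opprD addrACA.
  rewrite (snormB sK (s n)) -![snorm _ _]/(hnorm _).
  have -> : hnorm (2 *: (k - 2^-1 *: (s m + s n))) = 2 * hnorm (k - 2^-1 *: (s m + s n)).
    rewrite /hnorm (snormZ sK) (_ : normc 2 = 2) //.
    by rewrite -[2 in LHS](rmorph_nat (real_complex R)) normc_real ger0_norm.
  have := dle _ (mid _ _ (hs m).1 (hs n).1); have := (hs m).2; have := (hs n).2.
  have := dle _ (hs m).1; have := dle _ (hs n).1.
  have i1 := invS_le1 R m.
  have i2 := invS_le1 R n.
  have := invS_gt0 R m; have := invS_gt0 R n; move: i1 i2.
  set a := _^-1; set b := _^-1; set x := hnorm (k - s m); set y := hnorm (k - s n).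
  set z := hnorm (k - _ *: _); set w := hnorm (s m - s n).
  by move=> *; nra.
have [|r hr] := @hilbert_complete _ K s.
  move=> e e0; have e20 : 0 < e ^+ 2 / 2 by rewrite divr_gt0 // exprn_gt0.
  have [N hN] := harmonic_small (4 * d + 2) e20; exists N => m n hm hn.
  rewrite -(ltr_pXn2r (ltn0Sn 1)) ?nnegrE ?snorm_ge0 ?ltW //.
  apply: le_lt_trans (near _ _) _; have := hN _ hm; have := hN _ hn.
  by set a := m.+1%:R^-1; set b := n.+1%:R^-1 => *; lra.
exists r; split=> [e e0|t St].
  by have [N hN] := hr _ e0; exists (s N); [exact: (hs N).1 | exact: hN].
apply: le_trans (dle _ St); apply/ler_addgt0Pr => e e0.
have e20 : 0 < e / 2 by rewrite divr_gt0.
have [N hN] := hr _ e20; have [M hM] := invS_small e20.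
have h2 := hN _ (leq_maxl N M); have h1 := hM _ (leq_maxr N M).
have := (hs (maxn N M)).2 => h3.
apply: le_trans (snorm_trans sK (s (maxn N M)) _ _) _.
rewrite -![snorm _ _]/(hnorm _).
by move: h1 h2 h3 => /=; set a := (maxn N M).+1%:R^-1 => *; lra.
Qed.

(** The range of an isometry is complete, so the nearest point to [k] belongs to it, and minimality
    forces the difference to be orthogonal to the range. *)
Lemma isometry_projection H K (J : H -> K) : linear J ->
  (forall x y, hdot K (J x) (J y) = hdot H x y) ->
  exists P : K -> H, forall k h, hdot K (k - J (P k)) (J h) = 0.
Proof.
move=> lJ dJ; have sK := hdot_semidot K; have nJ := dot_isometry dJ.
suff /choice[P hP] : forall k, exists p, forall h, hdot K (k - J p) (J h) = 0 by exists P.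
move=> k; have [||r [hr1 hr2]] := @nearest_point K (range J) k.
- by exists (J 0), 0.
- by move=> _ _ [x _ <-] [y _ <-]; exists (2^-1 *: (x + y)) => //; rewrite (linZ _ _ lJ) (linD _ _ lJ).
have /choice[x hx] n : exists x, hnorm (J x - r) < n.+1%:R^-1.
  by have [_ [x _ <-] h] := hr1 _ (invS_gt0 R n); exists x.
have [|p hp] := @hilbert_complete _ H x.
  move=> e e0; have e20 : 0 < e / 2 by rewrite divr_gt0.
  have [N hN] := invS_small e20; exists N => m n hm hn.
  rewrite -nJ linB //; apply: le_lt_trans (snorm_trans sK r _ _) _.
  rewrite (snormB sK r) [X in _ < X]splitr.
  by apply: ltrD; [exact: lt_trans (hx m) (hN _ hm)|exact: lt_trans (hx n) (hN _ hn)].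
exists p; have -> : J p = r.
  apply/eqP; rewrite -subr_eq0; apply/eqP/hnorm_le_eq0 => e e0.
  have e20 : 0 < e / 2 by rewrite divr_gt0.
  have [N hN] := hp _ e20; have [M hM] := invS_small e20.
  have h1 := hN _ (leq_maxl N M); have h2 := hM _ (leq_maxr N M).
  have h3 := hx (maxn N M).
  apply: le_trans (snorm_trans sK (J (x (maxn N M))) _ _) _.
  rewrite -linB // -![snorm _ _]/(hnorm _) nJ.
  move: h1; rewrite /hnorm (snormB (hdot_semidot H)) -![snorm _ _]/(hnorm _).
  by move: h2 h3 => /=; set a := (maxn N M).+1%:R^-1 => *; lra.
move=> h; apply/eqP; rewrite -normc_eq0; set z := hdot _ _ _.
(* First-order condition: moving [r] by t z (J h), where z = <k - r, J h>, does not bring it closer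
   to [k]. Taking t small then forces z = 0. *)
have step (t : R) : 0 < t -> 2 * normc z ^+ 2 <= t * normc z ^+ 2 * hnorm (J h) ^+ 2.
  move=> t0; have : hnorm (k - r) <= hnorm (k - r - (t%:C * z) *: J h).
    apply/ler_addgt0Pr => e e0; have [_ [y _ <-] hy] := hr1 _ e0.
    have hS : range J (J (y + (t%:C * z) *: h)) by exists (y + (t%:C * z) *: h).
    apply: le_trans (hr2 _ hS) _; rewrite linD // linZ //.
    rewrite opprD addrA; have -> : k - J y - (t%:C * z) *: J h =
      (k - r - (t%:C * z) *: J h) - (J y - r).
      by rewrite opprB [in RHS](addrAC k) [RHS]addrA subrK addrAC.
    apply: le_trans (snormD sK _ _) _; rewrite lerD2l (snormN sK); exact: ltW.
  move=> hh0; have : hnorm (k - r) ^+ 2 <= hnorm (k - r - (t%:C * z) *: J h) ^+ 2.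
    by rewrite ler_pXn2r ?nnegrE ?snorm_ge0.
  rewrite /hnorm (snormB_sqr sK (k - r)) (sdZr sK).
  rewrite (snormZ sK) Normc.normcM normc_real gtr0_norm // conjcM conjc_real -[t%:C * _ * _]mulrA ReZ.
  rewrite -/z [_^* * _]mulrC mulc_conj /= !exprMn -![snorm _ _]/(hnorm _) => hh.
  rewrite -(ler_pM2l t0); lra.
have n0 := normc_ge0 z; rewrite eq_le n0 andbT leNgt; apply/negP => zp.
have b0 : 0 < hnorm (J h) ^+ 2 + 1 by have := sqr_ge0 (hnorm (J h)); lra.
have := step _ (divr_gt0 ltr01 b0); rewrite mulrAC mul1r.
have z2 : 0 < normc z ^+ 2 by rewrite exprn_gt0.
rewrite -subr_ge0 -mulrBl leNgt mulrC pmulr_rlt0 //.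
by rewrite subr_lt0 ltr_pdivrMl // => /negP; apply; lra.
Qed.

End Isometries.

(** * Positive pencils and their dual cones *)

Section ConeSeparation.
Context {R : realType}.
Local Notation C := R[i].

Definition pairing (I : finType) (L t : I -> C) : R := Re (\sum_z L z * t z).

Lemma pairingD (I : finType) (L s t : I -> C) :
  pairing L (fun z => s z + t z) = pairing L s + pairing L t.
Proof. by rewrite /pairing -ReD -big_split; congr Re; apply: eq_bigr => z _; rewrite mulrDr. Qed.

Lemma pairingZ (I : finType) (L t : I -> C) (r : R) :
  pairing L (fun z => r%:C * t z) = r * pairing L t.
Proof.
by rewrite /pairing -ReZ mulr_sumr; congr Re; apply: eq_bigr => z _; rewrite mulrCA.
Qed.

(* First-order condition at a point [w] of minimal norm. *)
Lemma min_variation (K : hilbert R) (w y : K) :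
  (forall t : R, 0 < t -> t <= 1 -> hnorm w <= hnorm (w - t%:C *: y)) ->
  Re (hdot K y w) <= 0.
Proof.
move=> h; have sK := hdot_semidot K.
have key (t : R) : 0 < t -> t <= 1 -> 2 * Re (hdot K y w) <= t * hnorm y ^+ 2.
  move=> t0 t1; have : hnorm w ^+ 2 <= hnorm (w - t%:C *: y) ^+ 2.
    by rewrite ler_pXn2r ?nnegrE ?snorm_ge0 // h.
  rewrite /hnorm (snormB_sqr sK w) (snormZ sK) normc_real gtr0_norm //.
  rewrite (sd_Re_sym sK w) (sdZl sK) ReZ exprMn => hh.
  rewrite -(ler_pM2l t0); lra.
apply/ler_addgt0Pr => e e0; rewrite add0r; have y0 := sqr_ge0 (hnorm y).
pose t := Num.min 1 (e / (hnorm y ^+ 2 + 1)).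
have d0 : 0 < hnorm y ^+ 2 + 1 by lra.
have t0 : 0 < t by rewrite lt_min ltr01 divr_gt0.
have := key t t0; rewrite ge_min lexx => /(_ isT) h1.
have : t * hnorm y ^+ 2 <= e.
  have : t <= e / (hnorm y ^+ 2 + 1) by rewrite ge_min lexx orbT.
  by rewrite ler_pdivlMr // => h2; nra.
lra.
Qed.

(** Bipolar theorem for a convex cone that is not assumed closed. If [t] were at distance at least
    [e] from [S], the vector [w] from the nearest point of the closed cone to [t] would define a
    functional that is nonnegative on [S] and negative at [t]. *)
Lemma cone_separation (I : finType) (S : set (I -> C)) (t : I -> C) :
  S !=set0 -> (forall x y, S x -> S y -> S (fun z => x z + y z)) ->
  (forall (r : R) x, 0 <= r -> S x -> S (fun z => r%:C * x z)) ->
  (forall L : I -> C, (forall s, S s -> 0 <= pairing L s) -> 0 <= pairing L t) ->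
  forall e : R, 0 < e -> exists2 s, S s & forall z, normc (s z - t z) < e.
Proof.
move=> [s0 Ss0] SD SZ dual e e0.
(* The kernel of an orthonormal sequence. Coordinate [z] is carried by the vector of index
   [pickle z], which makes [Phi] an embedding of the functions on [I] whose norm dominates each
   coordinate. *)
have [||K [b [_ bE]]] := @kolmogorov R (fun i j => (i == j)%:R).
- by move=> i j; rewrite eq_sym conjc_nat.
- move=> n c; rewrite Re_sum; apply: sumr_ge0 => i _; rewrite (bigD1 i) //= eqxx.
  rewrite mulr1 mulc_conj big1 ?addr0 /= ?sqr_ge0 // => j; rewrite -val_eqE /= eq_sym.
  by move=> /negPf ->; rewrite mulr0.
have sK := hdot_semidot K.
pose Phi (x : I -> C) : K := \sum_z x z *: b (pickle z).
have PhiB x y : Phi x - Phi y = Phi (fun z => x z - y z).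
  by rewrite /Phi -sumrB; apply: eq_bigr => z _; rewrite scalerBl.
have PhiD x y : Phi (fun z => x z + y z) = Phi x + Phi y.
  by rewrite /Phi -big_split; apply: eq_bigr => z _; rewrite scalerDl.
have PhiZ (r : C) x : Phi (fun z => r * x z) = r *: Phi x.
  by rewrite /Phi scaler_sumr; apply: eq_bigr => z _; rewrite scalerA.
have coord x z : hdot K (Phi x) (b (pickle z)) = x z.
  rewrite /Phi (sd_suml sK) (bigD1 z) //= (sdZl sK) bE eqxx mulr1 big1 ?addr0 // => y yz.
  rewrite (sdZl sK) bE (_ : (_ == _) = false) ?mulr0 //.
  by apply/negbTE; apply: contraNneq yz => /(pcan_inj pickleK) ->.
have coord_le x z : normc (x z) <= hnorm (Phi x).
  rewrite -coord; apply: le_trans (cauchy_schwarz sK _ _) _.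
  by rewrite [X in _ * X]/snorm bE eqxx sqrtr1 mulr1.
have [[s [Ss hs]]|far] := pselect (exists s, S s /\ hnorm (Phi s - Phi t) < e).
  by exists s => // z; apply: le_lt_trans hs; rewrite PhiB; exact: coord_le (fun z => s z - t z) z.
have far' s : S s -> e <= hnorm (Phi s - Phi t).
  by move=> Ss; rewrite leNgt; apply/negP => h; apply: far; exists s.
have [||r [hr1 hr2]] := @nearest_point _ K (Phi @` S) (Phi t).
- by exists (Phi s0), s0.
- move=> _ _ [x Sx <-] [y Sy <-]; exists (fun z => (2^-1)%:C * (x z + y z)).
    by apply: (SZ _ (fun z => x z + y z)) (SD _ _ Sx Sy); rewrite invr_ge0.
  by rewrite (PhiZ _ (fun z => x z + y z)) PhiD fmorphV rmorph_nat.
pose w := Phi t - r.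
have wmin u : (forall d : R, 0 < d -> exists2 s, S s & hnorm (Phi s - u) < d) ->
    hnorm w <= hnorm (Phi t - u).
  move=> hu; apply/ler_addgt0Pr => d d0; have [s Ss hs] := hu d d0.
  have hS : (Phi @` S) (Phi s) by exists s.
  apply: le_trans (hr2 _ hS) _; apply: le_trans (snorm_trans sK u _ _) _.
  by rewrite (snormB sK u) -![snorm _ _]/(hnorm _) lerD2l ltW.
have wn0 : e <= hnorm w.
  apply/ler_addgt0Pr => d d0; have [_ [s Ss <-] hs] := hr1 d d0.
  apply: le_trans (far' _ Ss) _; apply: le_trans (snorm_trans sK r _ _) _.
  by rewrite (snormB sK r) -![snorm _ _]/(hnorm _) addrC lerD2l ltW.
have wS s : S s -> Re (hdot K (Phi s) w) <= 0.
  move=> Ss; apply: min_variation => c c0 _; rewrite /w -addrA -opprD.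
  apply: wmin => d d0; have [_ [s' Ss' <-] hs'] := hr1 d d0.
  exists (fun z => s' z + c%:C * s z); first exact: SD Ss' (SZ _ _ (ltW c0) Ss).
  rewrite (PhiD s' (fun z => c%:C * s z)) PhiZ.
  by rewrite opprD addrACA subrr addr0.
(* Shrinking [r] to (1 - c) r stays in the closed cone and so cannot come closer to [Phi t]; hence
   <r, w> is nonnegative and <Phi t, w> >= |w|^2. *)
have wr : 0 <= Re (hdot K r w).
  have : Re (hdot K (- r) w) <= 0.
    apply: min_variation => c c0 c1; rewrite scalerN opprK /w -addrA.
    rewrite (_ : - r + _ = - ((1 - c)%:C *: r)); last first.
      by rewrite rmorphB rmorph1 scalerBl scale1r opprB addrC.
    apply: wmin => d d0; have [_ [s' Ss' <-] hs'] := hr1 d d0.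
    exists (fun z => (1 - c)%:C * s' z); first by apply: SZ => //; lra.
    rewrite PhiZ -scalerBr /hnorm (snormZ sK) normc_real ger0_norm; last by lra.
    have := snorm_ge0 (hdot K) (Phi s' - r); move: hs'; rewrite /hnorm => *; nra.
  by rewrite (sdNl sK) ReN; lra.
have wt : 0 < Re (hdot K (Phi t) w).
  rewrite -[Phi t](subrK r) (sdDl sK) ReD -/w -(snorm_sqr sK).
  have : 0 < hnorm w by lra.
  by rewrite /hnorm => h; have := exprn_gt0 2 h; lra.
pose L (z : I) := - conjc (hdot K w (b (pickle z))).
have LE (x : I -> C) : pairing L x = - Re (hdot K (Phi x) w).
  rewrite /pairing /Phi (sd_suml sK) -ReN -sumrN; congr Re; apply: eq_bigr => z _.
  by rewrite (sdZl sK) (sd_herm sK w) /L mulNr mulrC.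
have : 0 <= pairing L t by apply: dual => s /wS; rewrite LE; lra.
by rewrite LE; lra.
Qed.

End ConeSeparation.

(** * Affine matrix pencils and inclusions of ranges *)

Section Pencils.
Context {R : realType} {d : nat}.
Local Notation C := R[i].
Implicit Types (H K G : hilbert R).

(* The index [None] stands for the unit, so that functions on
   [pindex n] are the coefficients of affine matrix pencils. *)
Definition pindex (n : nat) := (option 'I_d * 'I_n * 'I_n)%type.

Definition ext (T : Type) (A : 'I_d -> T -> T) (o : option 'I_d) : T -> T :=
  if o is Some i then A i else idfun.

Definition gram H (A : 'I_d -> H -> H) n (x : 'I_n -> H) (z : pindex n) : C :=
  hdot H (ext A z.1.1 (x z.2)) (x z.1.2).

(* By [dual_approx_gram], [t] is in the closed convex cone generated by the
   Gram matrices of [A]. *)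
Definition dual_to H (A : 'I_d -> H -> H) n (t : pindex n -> C) :=
  forall L : pindex n -> C,
    (forall x, 0 <= pairing L (gram A x)) -> 0 <= pairing L t.

(** Effect on Gram matrices of replacing the tuple by its multiple by [c]: the coordinates of the
    unit are unchanged. *)
Definition scale_pencil n (c : R) (t : pindex n -> C) (z : pindex n) : C :=
  if z.1.1 is Some _ then c%:C * t z else t z.

Lemma pairing_scale n (c : R) (L t : pindex n -> C) :
  pairing (scale_pencil c L) t = pairing L (scale_pencil c t).
Proof.
rewrite /pairing; congr Re; apply: eq_bigr => -[[[i|] j] k] _ //.
by rewrite /scale_pencil /= mulrCA mulrA.
Qed.

Lemma scale_pencilM n (c c' : R) (t : pindex n -> C) :
  scale_pencil c (scale_pencil c' t) = scale_pencil (c * c') t.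
Proof.
by apply/funext => -[[[i|] j] k] //; rewrite /scale_pencil /= rmorphM mulrA.
Qed.

Lemma scale_pencil1 n (t : pindex n -> C) : scale_pencil 1 t = t.
Proof. by apply/funext => -[[[i|] j] k] //; rewrite /scale_pencil /= mul1r. Qed.

Lemma gramZ H (A : 'I_d -> H -> H) n (x : 'I_n -> H) (r : R) :
  (forall i, linear (A i)) ->
  gram A (fun k => r%:C *: x k) = fun z => (r ^+ 2)%:C * gram A x z.
Proof.
move=> lA; apply/funext => -[[q j] k]; rewrite /gram /=.
have -> : ext A q (r%:C *: x k) = r%:C *: ext A q (x k).
  by case: q => [i|] //=; rewrite (linZ _ _ (lA i)).
rewrite (sdZl (hdot_semidot H)) (sdZr (hdot_semidot H)) conjc_real mulrA -rmorphM.
by rewrite expr2.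
Qed.

Lemma dual_approx_gram H (A : 'I_d -> H -> H) n (t : pindex n -> C) :
  (forall i, linear (A i)) -> dual_to A t -> forall e : R, 0 < e ->
  exists ys : seq ('I_n -> H),
    forall z, normc (\sum_(x <- ys) gram A x z - t z) < e.
Proof.
move=> lA dt e e0.
pose S := [set s | exists ys : seq ('I_n -> H), s = fun z => \sum_(x <- ys) gram A x z].
have [||||_ [ys ->] h] := @cone_separation R (pindex n) S t _ _ _ _ e e0; last by exists ys.
- by exists (fun z => \sum_(x <- [::]) gram A x z), [::].
- move=> _ _ [xs ->] [ys ->]; exists (xs ++ ys); apply/funext => z.
  by rewrite big_cat.
(* The factor r is absorbed into the vectors as its square root, so sums of Gram matrices do form a
   cone. *)
- move=> r _ r0 [ys ->]; exists [seq (fun k => (Num.sqrt r)%:C *: x k) | x : 'I_n -> H <- ys].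
  apply/funext => z; rewrite big_map mulr_sumr; apply: eq_bigr => x _.
  by rewrite gramZ // sqr_sqrtr.
- move=> L hL; apply: dt => x.
  have : S (gram A x) by exists [:: x]; apply/funext => z; rewrite big_seq1.
  exact: hL.
Qed.

(* [c^-1] times the matrix range of [A] is contained in that of [B]. *)
Definition range_incl H K (c : R) (A : 'I_d -> H -> H) (B : 'I_d -> K -> K) :=
  forall n (x : 'I_n -> H), dual_to B (scale_pencil c^-1 (gram A x)).

(** Scaling is self-adjoint for the pairing and can be moved to the pencil: one that is positive on
    [D] becomes positive on [B] once it is scaled by the inverse of c'. *)
Lemma range_incl_trans H K G (c c' : R) (A : 'I_d -> H -> H) (B : 'I_d -> K -> K)
    (D : 'I_d -> G -> G) :
  range_incl c A B -> range_incl c' B D -> range_incl (c * c') A D.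
Proof.
move=> h h' n x L hL; rewrite invfM mulrC -scale_pencilM -pairing_scale.
by apply: h => y; rewrite pairing_scale; apply: h'.
Qed.

(** For a fixed pencil the pairing is an affine function p + q / c of the inverse of [c]. A negative
    value at [c] would persist for all slightly larger constants, some of which are admissible. *)
Lemma range_incl_closed H K (c : R) (A : 'I_d -> H -> H) (B : 'I_d -> K -> K) :
  0 < c ->
  (forall c1, c < c1 -> exists c', [/\ c <= c', c' < c1 & range_incl c' A B]) ->
  range_incl c A B.
Proof.
move=> c0 h n x L hL.
have split_pair r : pairing L (scale_pencil r (gram A x)) =
    pairing L (scale_pencil 0 (gram A x)) +
    r * (pairing L (gram A x) - pairing L (scale_pencil 0 (gram A x))).
  have -> : scale_pencil r (gram A x) = fun z =>
      scale_pencil 0 (gram A x) z + r%:C * (gram A x z + (-1)%:C * scale_pencil 0 (gram A x) z).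
    apply/funext => -[[[i|] j] k]; rewrite /scale_pencil /=.
      by rewrite mul0r mulr0 addr0 add0r.
    by rewrite rmorphN rmorph1 mulN1r subrr mulr0 addr0.
  by rewrite pairingD pairingZ pairingD pairingZ mulN1r.
rewrite split_pair; set p := pairing _ _; set q := _ - p.
rewrite leNgt; apply/negP => neg.
have [q0|q0] := lerP 0 q.
  have [c' [cc' _ h']] := h (c + 1) (ltr_pwDr ltr01 (lexx c)).
  have := h' n x L hL; rewrite split_pair -/p -/q.
  have c1 : c'^-1 <= c^-1 by rewrite lef_pV2 ?posrE //; lra.
  by have := ler_wpM2r q0 c1; lra.
have ic0 : 0 < c^-1 by rewrite invr_gt0.
(* [e] is such that lowering the inverse of [c] by [e] halves the negative value p + q / c; the
   maximum defining [r] keeps it positive. *)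
pose e := - (p + c^-1 * q) / (2 * (- q)).
have e0 : 0 < e by rewrite divr_gt0 //; lra.
pose r := Num.max (c^-1 / 2) (c^-1 - e).
have r0 : 0 < r by rewrite lt_max divr_gt0.
have rc : r < c^-1 by rewrite gt_max; apply/andP; split; lra.
have cr : c < r^-1 by rewrite -[c]invrK ltf_pV2 ?posrE.
have [c' [cc' c'r h']] := h _ cr; have := h' n x L hL; rewrite split_pair -/p -/q.
have rc' : r <= c'^-1 by rewrite -[r]invrK lef_pV2 ?posrE ?invr_gt0 //; lra.
have re : c^-1 - e <= r by rewrite le_max lexx orbT.
have eq : e * q = (p + c^-1 * q) / 2.
  by rewrite /e; field; lra.
by nra.
Qed.

End Pencils.

(** * Generated C*-algebras *)

Section Operators.
Context {R : realType}.
Local Notation C := R[i].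
Implicit Types (H K : hilbert R).

Definition opbound H K (M : R) (a : H -> K) := forall x, hnorm (a x) <= M * hnorm x.

Lemma hnorm_ge0 H (x : H) : 0 <= hnorm x. Proof. exact: snorm_ge0. Qed.

Lemma hilbert_normB H (x y : H) : hnorm (x - y) = hnorm (y - x).
Proof. exact: snormB (hdot_semidot H) _ _. Qed.

Lemma hilbert_normD H (x y : H) : hnorm (x + y) <= hnorm x + hnorm y.
Proof. exact: snormD (hdot_semidot H) _ _. Qed.

Lemma hnorm_trans H (y x z : H) : hnorm (x - z) <= hnorm (x - y) + hnorm (y - z).
Proof. exact: snorm_trans (hdot_semidot H) _ _ _. Qed.

Lemma hilbert_normZ H (c : C) (x : H) : hnorm (c *: x) = normc c * hnorm x.
Proof. exact: snormZ (hdot_semidot H) _ _. Qed.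

Lemma opbound_le H K (M N : R) (a : H -> K) : M <= N -> opbound M a -> opbound N a.
Proof. by move=> MN h x; apply: le_trans (h x) _; rewrite ler_wpM2r ?hnorm_ge0. Qed.

Lemma opboundD H K (M N : R) (a b : H -> K) : opbound M a -> opbound N b ->
  opbound (M + N) (a \+ b).
Proof.
move=> ha hb x; apply: le_trans (hilbert_normD _ _) _.
by rewrite mulrDl lerD // ?ha ?hb.
Qed.

Lemma opbound_comp H K L (M N : R) (a : K -> L : hilbert R) (b : H -> K) : 0 <= M ->
  opbound M a -> opbound N b -> opbound (M * N) (a \o b).
Proof.
move=> M0 ha hb x; apply: le_trans (ha _) _.
by rewrite -mulrA ler_wpM2l.
Qed.

Lemma bounded_op_linear H (a : H -> H) : bounded_op a -> linear a.
Proof. by case. Qed.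

Lemma bounded_op_bound H (a : H -> H) : bounded_op a -> exists2 M, 0 <= M & opbound M a.
Proof. by move=> /bounded_opP[]. Qed.

Lemma bounded_op_mk H (a : H -> H) (M : R) : linear a -> 0 <= M -> opbound M a -> bounded_op a.
Proof. by move=> la M0 ha; apply/bounded_opP; split => //; exists M. Qed.

Lemma linear_lin H K (c : C) (a b : H -> K) : linear a -> linear b -> linear (c \*: a \+ b).
Proof.
move=> la lb z x y /=; rewrite la lb !scalerDr !scalerA (mulrC c) -!addrA; congr (_ + _).
by rewrite addrCA.
Qed.

Lemma bounded_op_lin H (c : C) (a b : H -> H) :
  bounded_op a -> bounded_op b -> bounded_op (c \*: a \+ b).
Proof.
move=> ba bb; have [M M0 hM] := bounded_op_bound ba; have [N N0 hN] := bounded_op_bound bb.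
apply: (@bounded_op_mk _ _ (normc c * M + N)).
- by apply: linear_lin; apply: bounded_op_linear.
- by rewrite addr_ge0 // mulr_ge0 // normc_ge0.
- apply: opboundD => // x /=; rewrite hilbert_normZ -mulrA ler_wpM2l ?normc_ge0 //.
Qed.

Lemma bounded_op_comp H (a b : H -> H) : bounded_op a -> bounded_op b -> bounded_op (a \o b).
Proof.
move=> ba bb; have [M M0 hM] := bounded_op_bound ba; have [N N0 hN] := bounded_op_bound bb.
apply: (@bounded_op_mk _ _ (M * N)); rewrite ?mulr_ge0 //; last exact: opbound_comp.
by move=> z x y /=; rewrite (bounded_op_linear bb) (bounded_op_linear ba).
Qed.

Lemma bounded_op_id H : bounded_op (@idfun H).
Proof. by apply: (@bounded_op_mk _ _ 1) => // x; rewrite mul1r. Qed.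

Lemma adjoint_sym H (a b : H -> H) : is_adjoint a b -> is_adjoint b a.
Proof.
by move=> h x y; rewrite (sd_herm (hdot_semidot H) y) -h -(sd_herm (hdot_semidot H)).
Qed.

Lemma adjoint_unique H (a b c : H -> H) : is_adjoint a b -> is_adjoint a c -> b = c.
Proof.
move=> hb hc; apply/funext => y; apply: hdot_inj => x.
rewrite (sd_herm (hdot_semidot H) x) [RHS](sd_herm (hdot_semidot H) x).
by rewrite -hb -hc.
Qed.

Lemma adjoint_linear H (a b : H -> H) : is_adjoint a b -> linear b.
Proof.
move=> /adjoint_sym h c x y; apply: hdot_inj => z.
by rewrite h !(sd_lin (hdot_semidot H)) !h.
Qed.

Lemma adjoint_opbound H (a b : H -> H) (M : R) : 0 <= M -> is_adjoint a b ->
  opbound M a -> opbound M b.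
Proof.
move=> M0 hab ha y; have sH := hdot_semidot H.
have [->|n0] := eqVneq (hnorm (b y)) 0; first by rewrite mulr_ge0 // hnorm_ge0.
have np : 0 < hnorm (b y) by rewrite lt0r n0 hnorm_ge0.
rewrite -(ler_pM2r np) -expr2 /hnorm (snorm_sqr sH) -hab.
apply: le_trans (Re_le _) _; apply: le_trans (cauchy_schwarz sH _ _) _.
by rewrite mulrAC ler_wpM2r ?snorm_ge0 //; apply: ha.
Qed.

Lemma adjoint_bounded H (a b : H -> H) : bounded_op a -> is_adjoint a b -> bounded_op b.
Proof.
move=> ba hab; have [M M0 hM] := bounded_op_bound ba.
by apply: (bounded_op_mk (adjoint_linear hab) M0); apply: adjoint_opbound hM.
Qed.

Lemma adjoint_lin H (c : C) (a a' b b' : H -> H) : is_adjoint a a' -> is_adjoint b b' ->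
  is_adjoint (c \*: a \+ b) (conjc c \*: a' \+ b').
Proof.
move=> ha hb x y /=; rewrite (sd_lin (hdot_semidot H)) (sdDr (hdot_semidot H)).
by rewrite (sdZr (hdot_semidot H)) conjcK ha hb.
Qed.

Lemma adjoint_comp H (a a' b b' : H -> H) : is_adjoint a a' -> is_adjoint b b' ->
  is_adjoint (a \o b) (b' \o a').
Proof. by move=> ha hb x y /=; rewrite ha hb. Qed.

Lemma opboundB H K (M : R) (a b : H -> K) :
  opbound M (a \- b) -> opbound M (b \- a).
Proof. by move=> h x; have := h x; rewrite /= hilbert_normB. Qed.

Lemma opbound_trans H K (M N : R) (b a c : H -> K) :
  opbound M (a \- b) -> opbound N (b \- c) -> opbound (M + N) (a \- c).
Proof.
move=> h h' x; apply: le_trans (hnorm_trans (b x) _ _) _.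
by rewrite mulrDl lerD // ?h ?h'.
Qed.

Lemma adjoint_sub H (a a' b b' : H -> H) : is_adjoint a a' -> is_adjoint b b' ->
  is_adjoint (a \- b) (a' \- b').
Proof.
by move=> ha hb x y /=; rewrite (sdBl (hdot_semidot H)) (sdBr (hdot_semidot H)) ha hb.
Qed.

Lemma op_eq_of_small H K (a b : H -> K) :
  (forall e : R, 0 < e -> opbound e (a \- b)) -> a = b.
Proof.
move=> h; apply/funext => x; apply/eqP; rewrite -subr_eq0; apply/eqP/hnorm_le_eq0 => e e0.
have d0 : 0 < hnorm x + 1 by have := hnorm_ge0 x; lra.
have := h _ (divr_gt0 e0 d0) x => /= h1; apply: le_trans h1 _.
rewrite mulrAC ler_pdivrMr // ler_wpM2l ?ltW //; lra.
Qed.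

Lemma op_cauchy_lim H (a : nat -> H -> H) : (forall n, bounded_op (a n)) ->
  (forall e : R, 0 < e -> exists N, forall m n, (N <= m)%N -> (N <= n)%N ->
     opbound e (a m \- a n)) ->
  exists2 b : H -> H, bounded_op b &
    forall e : R, 0 < e -> exists N, forall n, (N <= n)%N -> opbound e (a n \- b).
Proof.
move=> ba ca.
have /choice[b hb] : forall x, exists y, lim_for (fun u v : H => hnorm (u - v)) (fun n => a n x) y.
  move=> x; apply: hilbert_complete => e e0.
  have d0 : 0 < hnorm x + 1 by have := hnorm_ge0 x; lra.
  have [N hN] := ca _ (divr_gt0 e0 d0); exists N => m n hm hn.
  apply: le_lt_trans (hN m n hm hn x) _.
  rewrite mulrAC ltr_pdivrMr // ltr_pM2l //; lra.
have close (e : R) : 0 < e -> exists N, forall n, (N <= n)%N -> opbound e (a n \- b).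
  move=> e0; have [N hN] := ca e e0; exists N => n hn x /=.
  apply/ler_addgt0Pr => c c0; have [M hM] := hb x c c0.
  apply: le_trans (hnorm_trans (a (maxn N M) x) _ _) _; apply: lerD.
    exact: (hN n (maxn N M) hn (leq_maxl _ _) x).
  by apply: ltW; apply: hM; exact: leq_maxr.
exists b => //.
have lb : linear b.
  move=> c x y; apply/eqP; rewrite -subr_eq0; apply/eqP/hnorm_le_eq0 => e e0.
  have c0 := normc_ge0 c.
  have d0 : 0 < e / (3 * (normc c + 1)) by rewrite divr_gt0 //; lra.
  have [N1 h1] := hb x _ d0; have [N2 h2] := hb y _ d0.
  have [N3 h3] := hb (c *: x + y) _ d0; pose n := maxn N1 (maxn N2 N3).
  have {}h1 := h1 n (leq_maxl _ _).
  have {}h2 : hnorm (a n y - b y) < _ := h2 n (leq_trans (leq_maxl _ _) (leq_maxr _ _)).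
  have {}h3 : hnorm (a n (c *: x + y) - b (c *: x + y)) < _ :=
    h3 n (leq_trans (leq_maxr _ _) (leq_maxr _ _)).
  apply: le_trans (hnorm_trans (a n (c *: x + y)) _ _) _.
  rewrite hilbert_normB (bounded_op_linear (ba n)) in h3 *.
  have -> : c *: a n x + a n y - (c *: b x + b y) = c *: (a n x - b x) + (a n y - b y).
    by rewrite opprD addrACA scalerBr.
  have := hilbert_normD (c *: (a n x - b x)) (a n y - b y); rewrite hilbert_normZ => h4.
  set E := e / _ in d0 h1 h2 h3.
  have eE : e = 3 * (normc c + 1) * E by rewrite /E; field; lra.
  have := hnorm_ge0 (a n x - b x); move: h1 => /= h1 h5.
  have : normc c * hnorm (a n x - b x) <= normc c * E by rewrite ler_wpM2l // ltW.
  have : 0 <= normc c * E by rewrite mulr_ge0 // ltW.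
  rewrite eE; lra.
have [N hN] := close 1 ltr01; have [M M0 hM] := bounded_op_bound (ba N).
apply: (@bounded_op_mk _ _ (1 + M)) => //; first by lra.
move=> x; rewrite -[b x](subrK (a N x)); apply: le_trans (hilbert_normD _ _) _.
rewrite mulrDl lerD // hilbert_normB; exact: (hN N (leqnn _) x).
Qed.

End Operators.

(** * Noncommutative polynomials and the algebras they generate *)

Section GeneratedAlgebra.
Context {R : realType} {d : nat}.
Local Notation C := R[i].
Implicit Types (u v w : utuple R d).

Unset Implicit Arguments.
Definition uinv u (i : 'I_d) : usp u -> usp u :=
  proj1_sig (cid (proj2 (uopP u i))).

Set Implicit Arguments.
Lemma uinvP u i : [/\ bounded_op (uinv u i), is_adjoint (u i) (uinv u i),
  uinv u i \o u i = idfun & u i \o uinv u i = idfun].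
Proof. by rewrite /uinv; case: cid. Qed.

Unset Implicit Arguments.
(** The Boolean is true for the unitary and false for its adjoint, so that words in the letters are
    *-monomials. *)
Definition letter u (l : 'I_d * bool) : usp u -> usp u :=
  if l.2 then u l.1 else uinv u l.1.
Set Implicit Arguments.
Definition linv (l : 'I_d * bool) := (l.1, ~~ l.2).

Lemma letter_bounded u l : bounded_op (letter u l).
Proof.
case: l => i [] /=; first by have [] := uopP u i.
by have [] := uinvP u i.
Qed.

Lemma letter_linear u l : linear (letter u l).
Proof. exact: bounded_op_linear (letter_bounded u l). Qed.

Lemma letter_adjoint u l : is_adjoint (letter u l) (letter u (linv l)).
Proof.
case: l => i [] /=; have [_ h _ _] := uinvP u i => //.
exact: adjoint_sym.
Qed.

Lemma letterK u l x : letter u (linv l) (letter u l x) = x.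
Proof.
by case: l => i [] /=; have [_ _ h h'] := uinvP u i;
  rewrite /letter /=; [exact: (congr1 (@^~ x) h)|exact: (congr1 (@^~ x) h')].
Qed.

Lemma letter_dot u l x y : hdot (usp u) (letter u l x) (letter u l y) = hdot (usp u) x y.
Proof. by rewrite letter_adjoint letterK. Qed.

Lemma letter_norm u l x : hnorm (letter u l x) = hnorm x.
Proof. exact: dot_isometry (letter_dot l) x. Qed.

(** The pairs formed by the values at [u] and at [v] of one and the same noncommutative
    *-polynomial; the relation dispenses with a syntax of polynomials. *)
Inductive gen u v : (usp u -> usp u) -> (usp v -> usp v) -> Prop :=
| gen_letter l : gen (letter u l) (letter v l)
| gen_lin (c : C) a a' b b' : gen a a' -> gen b b' ->
    gen (c \*: a \+ b) (c \*: a' \+ b')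
| gen_comp a a' b b' : gen a a' -> gen b b' -> gen (a \o b) (a' \o b').

Lemma gen_sym u v a a' : gen a a' -> @gen v u a' a.
Proof. by elim=> *; constructor. Qed.

Lemma gen_bounded u v a a' : @gen u v a a' -> bounded_op a.
Proof.
elim=> [l|c p p' q q' _ h _ h'|p p' q q' _ h _ h'].
- exact: letter_bounded.
- exact: bounded_op_lin.
- exact: bounded_op_comp.
Qed.

Lemma gen_boundedr u v a a' : @gen u v a a' -> bounded_op a'.
Proof. by move=> /gen_sym; exact: gen_bounded. Qed.

Lemma gen_adjoint u v a a' : @gen u v a a' ->
  exists b b', [/\ @gen u v b b', is_adjoint a b & is_adjoint a' b'].
Proof.
elim=> [l|c p p' q q' _ [r [r' [g1 h1 h1']]] _ [s [s' [g2 h2 h2']]]|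
  p p' q q' _ [r [r' [g1 h1 h1']]] _ [s [s' [g2 h2 h2']]]].
- exists (letter u (linv l)), (letter v (linv l)); split.
  + exact: gen_letter.
  + exact: letter_adjoint.
  + exact: letter_adjoint.
- exists (conjc c \*: r \+ s), (conjc c \*: r' \+ s'); split.
  + exact: gen_lin.
  + exact: adjoint_lin.
  + exact: adjoint_lin.
- exists (s \o r), (s' \o r'); split.
  + exact: gen_comp.
  + exact: adjoint_comp.
  + exact: adjoint_comp.
Qed.

Lemma gen_sub u v a a' b b' : @gen u v a a' -> gen b b' -> @gen u v (a \- b) (a' \- b').
Proof.
move=> ha hb; have := gen_lin (-1) hb ha.
by congr gen; apply/funext => x /=; rewrite scaleN1r addrC.
Qed.

Lemma cstar_letter u l : cstar u (letter u l).
Proof.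
have hg i : cstar u (u i) by move=> S [_ hS]; apply: hS; exists i.
case: l => i []; first exact: hg.
move=> S hS; have [[_ _ _ ha _] _] := hS; have [_ h _ _] := uinvP u i; exact: ha (hg i S hS) h.
Qed.

Lemma cstar_subalgebra u : is_cstar_subalgebra (cstar u).
Proof.
split.
- move=> a ha; apply: (ha [set b | bounded_op b]); split.
    split=> //.
    + by move=> *; exact: bounded_op_lin.
    + by move=> *; exact: bounded_op_comp.
    + by move=> b b' hb; exact: adjoint_bounded.
  by move=> _ [i _ <-]; have [] := uopP u i.
- by move=> l a b ha hb S hS; have [[_ h _ _ _] _] := hS; apply: h; [exact: ha|exact: hb].
- by move=> a b ha hb S hS; have [[_ _ h _ _] _] := hS; apply: h; [exact: ha|exact: hb].
- by move=> a b ha hb S hS; have [[_ _ _ h _] _] := hS; apply: h hb; exact: ha.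
- move=> a ba ha S hS; have [[_ _ _ _ h] _] := hS; apply: h => // e e0.
  by have [b hb he] := ha e e0; exists b => //; exact: hb.
Qed.

Lemma cstar_closed u a : bounded_op a ->
  (forall e : R, 0 < e -> exists2 b, cstar u b & opbound e (a \- b)) -> cstar u a.
Proof.
move=> ba ha; have [_ _ _ _ h] := cstar_subalgebra u; apply: h => // e e0.
have [b hb he] := ha e e0; exists b => // x.
by have := he x; rewrite /= !hnormE -rmorphM lecR.
Qed.

Lemma gen_cstar u v a a' : @gen u v a a' -> cstar u a.
Proof.
have [_ hl hc _ _] := cstar_subalgebra u.
by elim=> *; [exact: cstar_letter|exact: hl|exact: hc].
Qed.

Definition approximable u v (a : usp u -> usp u) := bounded_op a /\
  forall e : R, 0 < e -> exists p p', @gen u v p p' /\ opbound e (a \- p).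

(** Norm closure of the pairs (p(u), p(v)): the graph of the prospective isomorphism from C*(u) to
    C*(v). *)
Definition cstar_rel u v (a : usp u -> usp u) (a' : usp v -> usp v) :=
  [/\ bounded_op a, bounded_op a' & forall e : R, 0 < e ->
    exists p p', [/\ @gen u v p p', opbound e (a \- p) & opbound e (a' \- p')]].

Lemma cstar_rel_lin u v (c : C) a a' b b' : @cstar_rel u v a a' -> @cstar_rel u v b b' ->
  @cstar_rel u v (c \*: a \+ b) (c \*: a' \+ b').
Proof.
move=> [ba ba' h1] [bb bb' h2]; split; try exact: bounded_op_lin.
move=> e e0; have c0 := normc_ge0 c.
have d0 : 0 < e / 2 / (normc c + 1) by rewrite !divr_gt0 //; lra.
have [p [p' [g1 hp hp']]] := h1 _ d0; have [|q [q' [g2 hq hq']]] := h2 (e / 2).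
  by rewrite divr_gt0.
exists (c \*: p \+ q), (c \*: p' \+ q').
have bnd (H : hilbert R) (f f1 k k1 : H -> H) : opbound (e / 2 / (normc c + 1)) (f \- f1) ->
    opbound (e / 2) (k \- k1) -> opbound e ((c \*: f \+ k) \- (c \*: f1 \+ k1)).
  move=> hf hg x /=; rewrite opprD addrACA -scalerBr; apply: le_trans (hilbert_normD _ _) _.
  rewrite hilbert_normZ; have := hf x; have := hg x => /= e2 e1; have x0 := hnorm_ge0 x.
  have : normc c * hnorm (f x - f1 x) <= e / 2 * hnorm x; last by lra.
  apply: le_trans (ler_wpM2l c0 e1) _.
  rewrite mulrA ler_wpM2r // mulrA ler_pdivrMr; last by lra.
  by rewrite mulrC ler_wpM2l; lra.
by split; [exact: gen_lin|exact: bnd|exact: bnd].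
Qed.

Lemma cstar_rel_comp u v a a' b b' : @cstar_rel u v a a' -> @cstar_rel u v b b' ->
  @cstar_rel u v (a \o b) (a' \o b').
Proof.
move=> [ba ba' h1] [bb bb' h2]; split; try exact: bounded_op_comp.
move=> e e0; have [M M0 hM] := bounded_op_bound ba; have [M' M'0 hM'] := bounded_op_bound ba'.
have [N N0 hN] := bounded_op_bound bb; have [N' N'0 hN'] := bounded_op_bound bb'.
(* With factors approximated within D = e / (2 B + e), a product with norms F and G changes by at
   most F D + D (D + G) <= D (F + G + 1) <= e; the summand [e] of the denominator ensures D <= 1. *)
pose B := M + M' + N + N' + 1; have B0 : 0 < B by rewrite /B; lra.
have d0 : 0 < e / (2 * B + e) by rewrite divr_gt0 //; lra.
have d1 : e / (2 * B + e) <= 1 by rewrite ler_pdivrMr; lra.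
have [p [p' [g1 hp hp']]] := h1 _ d0; have [q [q' [g2 hq hq']]] := h2 _ d0.
exists (p \o q), (p' \o q').
have bnd (H : hilbert R) (f f1 k k1 : H -> H) (F G : R) : bounded_op f ->
    0 <= F -> F <= B -> opbound F f -> 0 <= G -> F + G + 1 <= B -> opbound G k ->
    opbound (e / (2 * B + e)) (f \- f1) -> opbound (e / (2 * B + e)) (k \- k1) ->
    opbound e ((f \o k) \- (f1 \o k1)).
  move=> bf F0 FB hf G0 GB hg hf1 hg1.
  have eq : e / (2 * B + e) * (2 * B + e) = e by rewrite divfK //; lra.
  set D := e / _ in d0 d1 hf1 hg1 eq.
  apply: (@opbound_le _ _ _ (F * D + D * (D + G))); first by nra.
  apply: (@opbound_trans _ _ _ _ _ (f \o k1)).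
    move=> x /=; rewrite -(linB _ _ (bounded_op_linear bf)); apply: le_trans (hf _) _.
    by rewrite -mulrA ler_wpM2l //; apply: hg1.
  move=> x /=; apply: le_trans (hf1 _) _; rewrite -mulrA; apply: ler_wpM2l; first exact: ltW.
  rewrite -[k1 x](subrK (k x)); apply: le_trans (hilbert_normD _ _) _.
  by rewrite mulrDl lerD ?hg // hilbert_normB; exact: hg1.
split; first exact: gen_comp.
  by apply: (bnd _ _ _ _ _ M N) => //; rewrite /B; lra.
by apply: (bnd _ _ _ _ _ M' N') => //; rewrite /B; lra.
Qed.

Lemma cstar_rel_letter u v l : @cstar_rel u v (letter u l) (letter v l).
Proof.
split; try exact: letter_bounded; move=> e e0; exists (letter u l), (letter v l).
by split; [exact: gen_letter| |]; move=> x /=; rewrite subrr /hnorm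
  (snorm0 (hdot_semidot _)) mulr_ge0 ?hnorm_ge0 // ltW.
Qed.

(** The operators related to themselves form a C*-subalgebra containing the generators, so
    minimality of [cstar] applies: polynomials are norm dense in C*(u). *)
Lemma cstar_rel_diag u a : cstar u a -> @cstar_rel u u a a.
Proof.
move=> ha; apply: (ha [set a | cstar_rel a a]); split; last first.
  by move=> _ [i _ <-]; exact: (cstar_rel_letter u u (i, true)).
split=> [b []//|c b b' /= hb hb'|b b' /= hb hb'|b b' /= [bb _ hb] adj|b bb hb].
- exact: cstar_rel_lin.
- exact: cstar_rel_comp.
- have bb' := adjoint_bounded bb adj; split=> // e e0; have [p [p' [g h h']]] := hb e e0.
  have [r [r' [g1 h1 h1']]] := gen_adjoint g; exists r, r'; split => //.
    by apply: (adjoint_opbound (ltW e0)) h; exact: adjoint_sub.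
  by apply: (adjoint_opbound (ltW e0)) h'; exact: adjoint_sub.
- split=> // e e0; have e20 : 0 < e / 2 by rewrite divr_gt0.
  have [b1 [_ _ hb1] hbb] := hb _ e20; have [p [p' [g h h']]] := hb1 _ e20.
  have bb1 : opbound (e / 2) (b \- b1) by move=> x; have := hbb x; rewrite !hnormE -rmorphM lecR.
  by exists p, p'; split; rewrite // [e]splitr; apply: (opbound_trans bb1).
Qed.

Lemma gen_exists u v a a' : @gen u u a a' -> exists b, @gen u v a b.
Proof.
elim=> [l|c p p' q q' _ [b hb] _ [b' hb']|p p' q q' _ [b hb] _ [b' hb']].
- by exists (letter v l); exact: gen_letter.
- by exists (c \*: b \+ b'); exact: gen_lin.
- by exists (b \o b'); exact: gen_comp.
Qed.

Lemma cstar_approximable u v a : cstar u a -> approximable v a.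
Proof.
move=> /cstar_rel_diag[ba _ ha]; split=> // e /ha[p [p' [g hp _]]].
by have [b hb] := gen_exists v g; exists p, b.
Qed.

Lemma approximable_cstar u v a : approximable v a -> cstar u a.
Proof.
move=> [ba ha]; apply: cstar_closed => // e e0.
by have [p [p' [/gen_cstar hp h]]] := ha e e0; exists p.
Qed.

(** The norm of p(u) is at most that of p(v) for every *-polynomial p, which is what makes the
    assignment of p(u) to p(v) extend continuously to C*(v). *)
Definition weakly_contained u v := forall a a', @gen u v a a' ->
  forall M : R, 0 <= M -> opbound M a' -> opbound M a.

Lemma cstar_rel_sym u v a a' : @cstar_rel u v a a' -> cstar_rel a' a.
Proof.
move=> [h1 h2 h]; split=> // e e0; have [p [p' [g hp hp']]] := h e e0.
by exists p', p; split => //; exact: gen_sym.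
Qed.

Lemma cstar_rel_cstar u v a a' : @cstar_rel u v a a' -> cstar u a.
Proof.
move=> [h1 h2 h]; apply: (@approximable_cstar u v); split=> // e /h[p [p' [g hp _]]].
by exists p, p'.
Qed.

Section Isomorphism.
Variables (u v : utuple R d).
Hypothesis vu : weakly_contained v u.

Lemma gen_bound_transfer a a' (M : R) : @gen u v a a' -> 0 <= M -> opbound M a -> opbound M a'.
Proof. by move=> /gen_sym g; exact: vu g M. Qed.

(** If polynomials p_n(u) converge to [a], the norm comparison makes the sequence p_n(v) Cauchy, and
    its limit is the partner of [a]. *)
Lemma cstar_rel_exists a : cstar u a -> exists a', @cstar_rel u v a a'.
Proof.
move=> /(cstar_approximable v)[ba ha].
have /choice[p hp] n := ha _ (invS_gt0 R n).
have /choice[p' hp'] := hp.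
have [||b bb hb] := @op_cauchy_lim _ _ p'.
- by move=> n; have [g _] := hp' n; exact: gen_boundedr g.
- move=> e e0; have e20 : 0 < e / 2 by rewrite divr_gt0.
  have [N hN] := invS_small e20; exists N => m n hm hn.
  have [g1 h1] := hp' m; have [g2 h2] := hp' n.
  apply: (gen_bound_transfer (gen_sub g1 g2) (ltW e0)).
  rewrite [e]splitr; apply: (@opbound_trans _ _ _ _ _ a).
    by apply: opboundB; apply: opbound_le h1; exact: ltW (hN _ hm).
  by apply: opbound_le h2; exact: ltW (hN _ hn).
- exists b; split=> // e e0; have [N hN] := invS_small e0; have [M hM] := hb e e0.
  have [g h] := hp' (maxn N M); exists (p (maxn N M)), (p' (maxn N M)); split => //.
    by apply: opbound_le h; exact: ltW (hN _ (leq_maxl N M)).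
  by apply: opboundB; apply: hM; exact: leq_maxr.
Qed.

Lemma cstar_rel_fun a a' a'' : @cstar_rel u v a a' -> @cstar_rel u v a a'' -> a' = a''.
Proof.
move=> [_ _ h1] [_ _ h2]; apply: op_eq_of_small => e e0.
have e40 : 0 < e / 4 by rewrite divr_gt0.
have [p [p' [g1 hp hp']]] := h1 _ e40; have [q [q' [g2 hq hq']]] := h2 _ e40.
have -> : e = e / 4 + (e / 4 + e / 4 + e / 4) by lra.
apply: (opbound_trans hp'); apply: opbound_trans (opboundB hq').
apply: (gen_bound_transfer (gen_sub g1 g2)); first by lra.
exact: opbound_trans (opboundB hp) hq.
Qed.

Lemma cstar_rel_adjoint a a' b b' : @cstar_rel u v a a' -> @cstar_rel u v b b' ->
  is_adjoint a b -> is_adjoint a' b'.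
Proof.
move=> [ba ba' h1] [bb bb' h2] adj.
(* [f e] is a polynomial in [v] close to a', whose adjoint is within 3e of b'. The three errors are
   that of q' against b', that of [q] against [b], and that of [b] against the adjoint of [p]; the
   last two are transferred from [u] to [v]. *)
have /choice[f hf] : forall e : R, exists p', 0 < e ->
   exists q', [/\ is_adjoint p' q', opbound e (a' \- p') & opbound (e + e + e) (b' \- q')].
  move=> e; have [e0|_] := ltrP 0 e; last by exists idfun.
  have [p [p' [g1 hp hp']]] := h1 _ e0; have [q [q' [g2 hq hq']]] := h2 _ e0.
  have [r [r' [g3 hr hr']]] := gen_adjoint g1; exists p' => _; exists r'; split => //.
  rewrite -addrA; apply: (opbound_trans hq').
  apply: (gen_bound_transfer (gen_sub g2 g3)); first by lra.
  apply: (opbound_trans (opboundB hq)).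
  by apply: (adjoint_opbound (ltW e0)) hp; exact: adjoint_sub.
move=> x y; apply/eqP; rewrite -subr_eq0 -normc_eq0 eq_le normc_ge0 andbT.
apply/ler_addgt0Pr => e e0; rewrite add0r.
(* The factor 4 collects one error on a' and three on b'. *)
have B0 : 0 < 4 * hnorm x * hnorm y + 1.
  by have := mulr_ge0 (hnorm_ge0 x) (hnorm_ge0 y); lra.
have [q' [ad h3 h4]] := hf _ (divr_gt0 e0 B0); set p' := f _ in ad h3.
have s := hdot_semidot (usp v).
have -> : hdot (usp v) (a' x) y - hdot (usp v) x (b' y) =
  hdot (usp v) (a' x - p' x) y - hdot (usp v) x (b' y - q' y).
  by rewrite (sdBl s) (sdBr s) ad; ring.
apply: le_trans (normcD _ _) _; rewrite normcN.
have := cauchy_schwarz s (a' x - p' x) y; have := cauchy_schwarz s x (b' y - q' y).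
rewrite -![snorm _ _]/(hnorm _).
have := h3 x; have := h4 y; rewrite /=; set D := e / _ => h5 h6.
have eq : e = D * (4 * hnorm x * hnorm y + 1) by rewrite /D divfK //; lra.
have D0 : 0 < D by rewrite divr_gt0.
have := ler_wpM2r (hnorm_ge0 y) h6; have := ler_wpM2l (hnorm_ge0 x) h5.
rewrite eq; lra.
Qed.

End Isomorphism.

(** [pi] is the function with graph [cstar_rel]. One comparison of norms makes the relation a
    function, the other makes its transpose one, whence bijectivity. *)
Lemma usim_of_weakly_contained u v :
  weakly_contained u v -> weakly_contained v u -> usim u v.
Proof.
move=> uv vu; pose pi a := xget (fun _ => 0) [set a' | @cstar_rel u v a a'].
have piP a : cstar u a -> cstar_rel a (pi a).
  by move=> /(cstar_rel_exists vu) h; exact: (@xgetPex _ _ [set a' | cstar_rel a a']).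
have piE a a' : @cstar_rel u v a a' -> pi a = a'.
  by move=> h; apply: (cstar_rel_fun vu _ h); apply: piP; exact: cstar_rel_cstar h.
exists pi; split.
- split.
  + by move=> a /piP /cstar_rel_sym /cstar_rel_cstar.
  + move=> a b; rewrite !inE => /piP /cstar_rel_sym ha /piP /cstar_rel_sym hb e.
    by move: ha; rewrite e => ha; exact: (cstar_rel_fun uv ha hb).
  + move=> b /(cstar_rel_exists uv)[a ha]; exists a.
      by apply: cstar_rel_cstar; exact: cstar_rel_sym ha.
    by apply: piE; exact: cstar_rel_sym.
- by move=> l a b ha hb; apply: piE; exact: cstar_rel_lin (piP _ ha) (piP _ hb).
- by move=> a b ha hb; apply: piE; exact: cstar_rel_comp (piP _ ha) (piP _ hb).
- move=> a b ha ab; apply: (cstar_rel_adjoint vu (piP _ ha) (piP b _) ab).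
  by have [_ _ _ h _] := cstar_subalgebra u; exact: h ab.
- by move=> i; apply: piE; exact: (cstar_rel_letter u v (i, true)).
Qed.

End GeneratedAlgebra.

Section StrongLimits.
Context {R : realType}.
Local Notation C := R[i].
Implicit Types (H : hilbert R).

Definition hcvg H (x : nat -> H) (l : H) :=
  forall e : R, 0 < e -> exists N, forall n, (N <= n)%N -> hnorm (x n - l) < e.

Lemma hcvg_unique H (x : nat -> H) l m : hcvg x l -> hcvg x m -> l = m.
Proof.
move=> h h'; apply/eqP; rewrite -subr_eq0; apply/eqP/hnorm_le_eq0 => e e0.
have e20 : 0 < e / 2 by rewrite divr_gt0.
have [N hN] := h _ e20; have [M hM] := h' _ e20.
apply: le_trans (hnorm_trans (x (maxn N M)) _ _) _.
rewrite hilbert_normB; have := hN _ (leq_maxl N M); have := hM _ (leq_maxr N M); lra.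
Qed.

Lemma hcvg_cst H (l : H) : hcvg (fun _ => l) l.
Proof. by move=> e e0; exists 0%N => n _; rewrite subrr /hnorm (snorm0 (hdot_semidot H)). Qed.

Lemma hcvgD H (x y : nat -> H) l m : hcvg x l -> hcvg y m -> hcvg (fun n => x n + y n) (l + m).
Proof.
move=> h h' e e0; have e20 : 0 < e / 2 by rewrite divr_gt0.
have [N hN] := h _ e20; have [M hM] := h' _ e20; exists (maxn N M) => n.
rewrite geq_max => /andP[/hN h1 /hM h2]; rewrite opprD addrACA.
by apply: le_lt_trans (hilbert_normD _ _) _; lra.
Qed.

Lemma hcvgZ H (c : C) (x : nat -> H) l : hcvg x l -> hcvg (fun n => c *: x n) (c *: l).
Proof.
move=> h e e0; have c0 := normc_ge0 c.
have d0 : 0 < e / (normc c + 1) by rewrite divr_gt0 //; lra.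
have [N hN] := h _ d0; exists N => n /hN; rewrite -scalerBr hilbert_normZ.
have := hnorm_ge0 (x n - l); rewrite ltr_pdivlMr; last by lra.
by move=> *; nra.
Qed.

Lemma hcvg_sum H (I : Type) (r : seq I) (x : I -> nat -> H) (l : I -> H) :
  (forall i, hcvg (x i) (l i)) ->
  hcvg (fun n => \sum_(i <- r) x i n) (\sum_(i <- r) l i).
Proof.
move=> h; elim: r => [|i r IH].
  rewrite big_nil (_ : (fun n => _) = fun _ => 0); first exact: hcvg_cst.
  by apply/funext => n; rewrite big_nil.
rewrite big_cons (_ : (fun n => _) = fun n => x i n + \sum_(i <- r) x i n).
  exact: hcvgD.
by apply/funext => n; rewrite big_cons.
Qed.

Lemma hcvg_shift H (x : nat -> H) l : hcvg x l -> hcvg (fun n => x n.+1) l.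
Proof.
by move=> h e /h[N hN]; exists N => n hn; apply: hN; apply: leq_trans hn _.
Qed.

Lemma adjoint_lim H (a b : nat -> H -> H) (a' b' : H -> H) :
  (forall n, is_adjoint (a n) (b n)) -> (forall x, hcvg (fun n => a n x) (a' x)) ->
  (forall x, hcvg (fun n => b n x) (b' x)) -> is_adjoint a' b'.
Proof.
move=> adj ha hb x y; have s := hdot_semidot H.
apply/eqP; rewrite -subr_eq0 -normc_eq0 eq_le normc_ge0 andbT.
apply/ler_addgt0Pr => e e0; rewrite add0r.
have xy0 : 0 < hnorm x + hnorm y + 1 by have := hnorm_ge0 x; have := hnorm_ge0 y; lra.
have e1 := divr_gt0 e0 xy0; have [N hN] := ha x _ e1; have [M hM] := hb y _ e1.
have {}hN := hN _ (leq_maxl N M); have {}hM := hM _ (leq_maxr N M).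
set m := maxn N M in hN hM.
have -> : hdot H (a' x) y - hdot H x (b' y) =
   hdot H (a' x - a m x) y - hdot H x (b' y - b m y).
  by rewrite (sdBl s) (sdBr s) adj; ring.
apply: le_trans (normcD _ _) _; rewrite normcN.
have := cauchy_schwarz s (a' x - a m x) y.
have := cauchy_schwarz s x (b' y - b m y); rewrite -![snorm _ _]/(hnorm _).
rewrite hilbert_normB in hN; rewrite hilbert_normB in hM.
have := ler_wpM2r (hnorm_ge0 y) (ltW hN); have := ler_wpM2l (hnorm_ge0 x) (ltW hM).
have : e / (hnorm x + hnorm y + 1) * (hnorm x + hnorm y + 1) = e by rewrite divfK // gt_eqF.
by move: (ltW e1); set D := _ / _; lra.
Qed.

Lemma hcvg_of_opbound H (a : nat -> H -> H) (b : H -> H) x :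
  (forall e : R, 0 < e -> exists N, forall n, (N <= n)%N -> opbound e (a n \- b)) ->
  hcvg (fun n => a n x) (b x).
Proof.
move=> h e e0; have x0 : 0 < hnorm x + 1 by have := hnorm_ge0 x; lra.
have [N hN] := h _ (divr_gt0 e0 x0); exists N => n /hN /(_ x) /= hx.
by apply: le_lt_trans hx _; rewrite mulrAC ltr_pdivrMr // ltr_pM2l //; lra.
Qed.

Lemma hcvg_comp H (a : nat -> H -> H) (b : H -> H) (x : nat -> H) l (M : R) :
  (forall n, linear (a n)) -> (forall n, opbound M (a n)) -> 0 <= M ->
  (forall y, hcvg (fun n => a n y) (b y)) -> hcvg x l -> hcvg (fun n => a n (x n)) (b l).
Proof.
move=> la hM M0 hb hx e e0.
have d0 : 0 < e / 2 / (M + 1) by rewrite !divr_gt0 //; lra.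
have [N1 h1] := hx _ d0; have [|N2 h2] := hb l (e / 2); first by rewrite divr_gt0.
exists (maxn N1 N2) => n; rewrite geq_max => /andP[/h1 h3 /h2 h4].
apply: le_lt_trans (hnorm_trans (a n l) _ _) _; rewrite -(linB _ _ (la n)).
have := hM n (x n - l); move: h3; have := hnorm_ge0 (x n - l).
rewrite ltr_pdivlMr; last by lra.
by move=> *; nra.
Qed.

End StrongLimits.

(** * Operator matrices and square roots over C*(u) *)

Section MatrixSquareRoot.
Context {R : realType}.
Local Notation C := R[i].
Variables (H : hilbert R) (n : nat).
Local Notation E := ('I_n -> H).

Definition adot (I : finType) (K : hilbert R) (x y : I -> K) : C :=
  \sum_j hdot K (x j) (y j).

Lemma adot_semidot (I : finType) (K : hilbert R) : semidot (@adot I K).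
Proof.
have s := hdot_semidot K; split=> [a x y z|x y|x].
- rewrite /adot mulr_sumr -big_split; apply: eq_bigr => j _ /=.
  exact: (sd_lin s).
- by rewrite /adot conjc_sum; apply: eq_bigr => j _; rewrite (sd_herm s).
- by rewrite /adot Re_sum; apply: sumr_ge0 => j _; exact: sd_ge0.
Qed.

Lemma hnorm_le_adot (I : finType) (K : hilbert R) (x : I -> K) j :
  hnorm (x j) <= snorm (@adot I K) x.
Proof.
rewrite /hnorm /snorm ler_wsqrtr // /adot (bigD1 j) //= ReD lerDl Re_sum.
by apply: sumr_ge0 => k _; exact: (sd_ge0 (hdot_semidot K)).
Qed.

Definition opm (K : hilbert R) (t : 'I_n -> 'I_n -> K -> K) (x : 'I_n -> K) : 'I_n -> K :=
  fun j => \sum_k t j k (x k).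

Lemma opm_linear (t : 'I_n -> 'I_n -> H -> H) : (forall j k, linear (t j k)) -> linear (opm t).
Proof.
move=> lt a x y; apply/funext => j.
change (opm t (a *: x + y) j = a *: opm t x j + opm t y j).
rewrite /opm scaler_sumr -big_split.
by apply: eq_bigr => k _ /=; exact: (lt j k).
Qed.

Definition single (k : 'I_n) (a : H) : E := fun j => if j == k then a else 0.

Lemma opm_single (t : 'I_n -> 'I_n -> H -> H) j k a : (forall j k, linear (t j k)) ->
  opm t (single k a) j = t j k a.
Proof.
move=> lt; rewrite /opm (bigD1 k) //= /single eqxx big1 ?addr0 // => l /negPf ->.
exact: lin0.
Qed.

Lemma snorm_single k a : snorm (@adot 'I_n H) (single k a) = hnorm a.
Proof.
rewrite /hnorm /snorm; congr (Num.sqrt (Re _)); rewrite /adot (bigD1 k) //= /single eqxx.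
by rewrite big1 ?addr0 // => l /negPf ->; exact: sd0l (hdot_semidot H) _.
Qed.

Lemma opm_adjoint (t : 'I_n -> 'I_n -> H -> H) : (forall j k, is_adjoint (t j k) (t k j)) ->
  forall x y, adot (opm t x) y = adot x (opm t y).
Proof.
move=> ht x y; rewrite /adot /opm.
under eq_bigr do rewrite (sd_suml (hdot_semidot H)).
under [RHS]eq_bigr do rewrite (sd_sumr (hdot_semidot H)).
rewrite exchange_big; apply: eq_bigr => k _; apply: eq_bigr => j _.
by rewrite ht.
Qed.

(** Cauchy-Schwarz for the semi-inner product <X x, y>, applied to [x] and [X x]: the square of |X
    x| is at most the product of the two form seminorms, each bounded by the square root of q times
    the norm. *)
Lemma contraction_of_form (q : R) (X : E -> E) : 0 <= q -> linear X ->
  (forall x y, adot (X x) y = adot x (X y)) ->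
  (forall x, 0 <= Re (adot (X x) x) <= q * snorm (@adot _ _) x ^+ 2) ->
  forall x, snorm (@adot _ _) (X x) <= q * snorm (@adot _ _) x.
Proof.
move=> q0 lX sX fX x; have s := adot_semidot 'I_n H.
pose f x y := adot (X x) y.
have hP : semidot f.
  split=> [a x1 y z|x1 y|x1]; first by rewrite /f lX (sd_lin s).
    by rewrite /f sX (sd_herm s).
  by have /andP[] := fX x1.
have up y : snorm f y ^+ 2 <= q * snorm (@adot _ _) y ^+ 2.
  by rewrite (snorm_sqr hP); have /andP[] := fX y.
have := cauchy_schwarz hP x (X x); have := Re_le (f x (X x)).
have : Re (f x (X x)) = snorm (@adot _ _) (X x) ^+ 2 by rewrite (snorm_sqr s).
have := up x; have := up (X x); have := snorm_ge0 f x; have := snorm_ge0 f (X x).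
have := snorm_ge0 (@adot _ _) x; have := snorm_ge0 (@adot _ _) (X x).
set a := snorm (@adot _ _) (X x); set b := snorm (@adot _ _) x.
set p := snorm f (X x); set r := snorm f x.
move=> a0 b0 p0 r0 h1 h2 -> h3 h4.
have h5 : a ^+ 2 <= r * p by exact: le_trans h3 h4.
have h6 : (a ^+ 2) ^+ 2 <= (q * b ^+ 2) * (q * a ^+ 2).
  apply: (@le_trans _ _ ((r * p) ^+ 2)); first by rewrite ler_pXn2r ?nnegrE ?sqr_ge0 ?mulr_ge0.
  by rewrite exprMn ler_pM ?sqr_ge0.
have [a1|a1] := eqVneq a 0; first by rewrite a1 mulr_ge0.
have ap : 0 < a by rewrite lt0r a1.
rewrite -(ler_pXn2r (ltn0Sn 1)) ?nnegrE ?mulr_ge0 //.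
rewrite -(ler_pM2r (exprn_gt0 2 ap)) exprMn; apply: le_trans h6 _.
by rewrite (_ : q * b ^+ 2 * (q * a ^+ 2) = q ^+ 2 * b ^+ 2 * a ^+ 2) //; ring.
Qed.

End MatrixSquareRoot.

Lemma geometric_small (R : realType) (q e : R) : 0 <= q -> q < 1 -> 0 < e ->
  exists N, q ^+ N < e.
Proof.
move=> q0 q1 e0; have : `|q| < 1 by rewrite ger0_norm.
move=> /cvg_expr /cvgrPdist_lt /(_ e e0)[N _ hN]; exists N.
by have := hN N (leqnn _); rewrite /= sub0r normrN ger0_norm // exprn_ge0.
Qed.

Section SquareRoot.
Context {R : realType} {d : nat}.
Local Notation C := R[i].
Variables (u : utuple R d) (n : nat).
Local Notation H := (usp u).
Local Notation E := ('I_n -> H).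
Local Notation nrm := (snorm (@adot R 'I_n H)).
Hypothesis cstar_id : cstar u idfun.

Lemma cstar_lin (c : C) a b : cstar u a -> cstar u b -> cstar u (c \*: a \+ b).
Proof. by have [_ h _ _ _] := cstar_subalgebra u; exact: h. Qed.
Lemma cstar_comp a b : cstar u a -> cstar u b -> cstar u (a \o b).
Proof. by have [_ _ h _ _] := cstar_subalgebra u; exact: h. Qed.
Lemma cstar_bounded a : cstar u a -> bounded_op a.
Proof. by have [h _ _ _ _] := cstar_subalgebra u; exact: h. Qed.
Lemma cstar_linear a : cstar u a -> linear a.
Proof. by move=> /cstar_bounded /bounded_op_linear. Qed.
Lemma cstar0 : cstar u (fun _ => 0).
Proof.
have := cstar_lin (-1) cstar_id cstar_id; congr (cstar u _).
by apply/funext => x /=; rewrite scaleN1r addNr.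
Qed.
Lemma cstarD a b : cstar u a -> cstar u b -> cstar u (fun x => a x + b x).
Proof.
move=> ha hb; have := cstar_lin 1 ha hb; congr (cstar u _).
by apply/funext => x /=; rewrite scale1r.
Qed.
Lemma cstarZ (c : C) a : cstar u a -> cstar u (fun x => c *: a x).
Proof.
move=> ha; have := cstar_lin c ha cstar0; congr (cstar u _).
by apply/funext => x /=; rewrite addr0.
Qed.
Lemma cstar_sum (I : Type) (r : seq I) (f : I -> H -> H) : (forall i, cstar u (f i)) ->
  cstar u (fun x => \sum_(i <- r) f i x).
Proof.
move=> hf; elim: r => [|i r IH].
  rewrite (_ : (fun x => _) = fun _ => 0); first exact: cstar0.
  by apply/funext => x; rewrite big_nil.
rewrite (_ : (fun x => _) = fun x => f i x + \sum_(i <- r) f i x); first exact: cstarD.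
by apply/funext => x; rewrite big_cons.
Qed.

Definition delta_op (K : hilbert R) (j k : 'I_n) : K -> K := fun a => if j == k then a else 0.

Lemma cstar_delta j k : cstar u (@delta_op H j k).
Proof.
rewrite /delta_op; case: eqP => _; [exact: cstar_id|exact: cstar0].
Qed.

Lemma delta_adjoint (K : hilbert R) j k : is_adjoint (@delta_op K j k) (@delta_op K k j).
Proof.
move=> x y; rewrite /delta_op eq_sym; case: eqP => // _.
by rewrite (sd0l (hdot_semidot K)) (sd0r (hdot_semidot K)).
Qed.

Lemma delta_sum (K : hilbert R) (x : 'I_n -> K) j : \sum_k @delta_op K j k (x k) = x j.
Proof.
rewrite (bigD1 j) //= /delta_op eqxx big1 ?addr0 // => k kj.
by rewrite eq_sym (negPf kj).
Qed.

Variables (t : 'I_n -> 'I_n -> H -> H) (delta : R).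
Hypothesis delta_gt0 : 0 < delta.
Hypothesis delta_le1 : delta <= 1.
Hypothesis t_cstar : forall j k, cstar u (t j k).
Hypothesis t_adj : forall j k, is_adjoint (t j k) (t k j).
Hypothesis t_form : forall x : E,
  delta * nrm x ^+ 2 <= Re (adot (opm t x) x) <= nrm x ^+ 2.

Let xi j k : H -> H := fun a => @delta_op H j k a - t j k a.
Let q := 1 - delta.
Let q0 : 0 <= q. Proof. by rewrite subr_ge0. Qed.
Let q1 : q < 1. Proof. by rewrite ltrBlDr ltrDl. Qed.

Let xi_cstar j k : cstar u (xi j k).
Proof.
have := cstar_lin (-1) (t_cstar j k) (cstar_delta j k); congr (cstar u _).
by apply/funext => x /=; rewrite scaleN1r addrC.
Qed.

Let xi_adj j k : is_adjoint (xi j k) (xi k j).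
Proof. exact: adjoint_sub (@delta_adjoint H j k) (t_adj j k). Qed.

(* The limit [z] of this iteration solves [z = (xi + z^2) / 2], that is
   [(1 - z)^2 = 1 - xi = t]. *)
Fixpoint sqrt_iter (m : nat) (j k : 'I_n) : H -> H := if m is m'.+1 then
    fun a => (2^-1 : C) *: (xi j k a + \sum_l sqrt_iter m' j l (sqrt_iter m' l k a))
  else fun _ => 0.
Local Notation y := sqrt_iter.

Let y_cstar m j k : cstar u (y m j k).
Proof.
elim: m j k => [|m IH] j k /=; first exact: cstar0.
by apply: cstarZ; apply: cstarD => //; apply: cstar_sum => l; exact: cstar_comp.
Qed.

Let y_lin m j k : linear (y m j k). Proof. exact: cstar_linear. Qed.

Let y_adj m j k : is_adjoint (y m j k) (y m k j).
Proof.
have s := hdot_semidot H; elim: m j k => [|m IH] j k a b /=.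
  by rewrite (sd0l s) (sd0r s).
rewrite (sdZl s) (sdZr s) (sdDl s) (sdDr s) xi_adj (sd_suml s) (sd_sumr s).
rewrite (_ : conjc 2^-1 = 2^-1); last by rewrite conjc_inv conjc_nat.
by congr (_ * (_ + _)); apply: eq_bigr => l _; rewrite !IH.
Qed.

Let Y m : E -> E := opm (y m).
Let YS m x : Y m.+1 x = (2^-1 : C) *: (opm xi x + Y m (Y m x)).
Proof.
apply/funext => j.
change (opm (y m.+1) x j = (2^-1 : C) *: (opm xi x j + Y m (Y m x) j)).
rewrite /Y /opm /= -scaler_sumr big_split /=; congr (_ *: (_ + _)).
rewrite exchange_big; apply: eq_bigr => l _.
by rewrite (lin_sum _ _ _ (y_lin m j l)).
Qed.

Let s := adot_semidot 'I_n H.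
Let Ylin m : linear (Y m). Proof. by apply: opm_linear. Qed.

Let xi_bound x : nrm (opm xi x) <= q * nrm x.
Proof.
apply: (contraction_of_form q0).
- by apply: opm_linear => j k; exact: cstar_linear.
- exact: opm_adjoint.
- move=> z; have -> : opm xi z = z - opm t z.
    apply/funext => j; change (opm xi z j = z j - opm t z j).
    by rewrite /opm -(delta_sum z j) -sumrB.
  rewrite (sdBl s) ReB -(snorm_sqr s); have /andP[h1 h2] := t_form z.
  rewrite /q; apply/andP; split; lra.
Qed.

Let half_norm (x : E) : nrm ((2^-1 : C) *: x) = 2^-1 * nrm x.
Proof.
by rewrite (snormZ s) Normc.normcV normc_nat.
Qed.

Let Y_bound m x : nrm (Y m x) <= q * nrm x.
Proof.
elim: m x => [|m IH] x.
  rewrite (_ : Y 0 x = 0); first by rewrite (snorm0 s) mulr_ge0 ?q0 ?snorm_ge0.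
  by apply/funext => j; rewrite /Y /opm big1.
rewrite YS half_norm; have := snormD s (opm xi x) (Y m (Y m x)).
have := xi_bound x; have := IH (Y m x); have := ler_wpM2l q0 (IH x).
have := snorm_ge0 (@adot R 'I_n H) x; have : q * q * nrm x <= q * nrm x.
  by rewrite ler_wpM2r ?snorm_ge0 // ler_piMr // ltW.
lra.
Qed.

(** The difference of two successive squares splits as Y' (Y' - Y) + (Y' - Y) Y, each term being at
    most q times the previous difference; the factor 1/2 of the iteration compensates for there
    being two. Geometric convergence thus rests on the lower bound [delta] of [t], which makes q <
    1. *)
Let Y_step m x : nrm (Y m.+1 x - Y m x) <= q ^+ m * nrm x.
Proof.
elim: m x => [|m IH] x.
  have -> : Y 0 x = 0 by apply/funext => j; rewrite /Y /opm big1.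
  rewrite subr0 expr0 mul1r; apply: le_trans (Y_bound _ _) _.
  by rewrite ler_piMl ?snorm_ge0 // ltW.
rewrite (YS m.+1) [X in _ - X](YS m) -scalerBr half_norm opprD addrACA subrr add0r -/(Y m.+1 _).
have -> : Y m.+1 (Y m.+1 x) - Y m (Y m x) =
  Y m.+1 (Y m.+1 x - Y m x) + (Y m.+1 (Y m x) - Y m (Y m x)).
  by rewrite (linB _ _ (Ylin m.+1)) addrA subrK.
have := snormD s (Y m.+1 (Y m.+1 x - Y m x)) (Y m.+1 (Y m x) - Y m (Y m x)).
have := Y_bound m.+1 (Y m.+1 x - Y m x); have := IH (Y m x).
have := ler_wpM2l q0 (IH x); have := ler_wpM2l (exprn_ge0 m q0) (Y_bound m x).
rewrite exprS; lra.
Qed.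

Let Y_cauchy m p x : nrm (Y (m + p) x - Y m x) <= q ^+ m / (1 - q) * nrm x.
Proof.
have d0 : 0 < 1 - q by rewrite subr_gt0.
have : nrm (Y (m + p) x - Y m x) <= (q ^+ m - q ^+ (m + p)) / (1 - q) * nrm x.
  elim: p => [|p IH]; first by rewrite addn0 !subrr (snorm0 s) mul0r mul0r.
  rewrite addnS; apply: le_trans (snorm_trans s (Y (m + p) x) _ _) _.
  apply: le_trans (lerD (Y_step _ _) IH) _; rewrite -mulrDl.
  rewrite ler_wpM2r ?snorm_ge0 // exprS.
  rewrite (_ : q ^+ (m + p) = q ^+ (m + p) * (1 - q) / (1 - q)); last by rewrite mulfK // gt_eqF.
  set a := q ^+ m; set b := q ^+ (m + p).
  rewrite -[X in X <= _]mulrDl ler_pM2r ?invr_gt0 // mulfK ?gt_eqF //; lra.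
move/le_trans; apply; rewrite ler_wpM2r ?snorm_ge0 //.
apply: ler_wpM2r; first by rewrite invr_ge0 ltW.
by rewrite lerBlDr lerDl exprn_ge0.
Qed.

Let entry_bound m j k : opbound 1 (y m j k).
Proof.
move=> a; rewrite -(opm_single j k a (y_lin m)); apply: le_trans (hnorm_le_adot _ _) _.
apply: le_trans (Y_bound m _) _; rewrite snorm_single.
by rewrite ler_wpM2r ?hnorm_ge0 // ltW.
Qed.

Let entry_cauchy m p j k : opbound (q ^+ m / (1 - q)) (y (m + p) j k \- y m j k).
Proof.
move=> a /=; rewrite -(opm_single j k a (y_lin (m + p))) -(opm_single j k a (y_lin m)).
have := Y_cauchy m p (single k a); rewrite snorm_single; apply: le_trans.
exact: (hnorm_le_adot (Y (m + p) (single k a) - Y m (single k a)) j).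
Qed.

Let y_lim j k : exists z, [/\ cstar u z, opbound 1 z & forall a, hcvg (fun m => y m j k a) (z a)].
Proof.
have d0 : 0 < 1 - q by rewrite subr_gt0.
have small (e : R) : 0 < e -> exists N, forall m, (N <= m)%N -> q ^+ m / (1 - q) < e.
  move=> e0; have [N hN] := geometric_small q0 q1 (mulr_gt0 e0 d0); exists N => m hm.
  rewrite ltr_pdivrMr //; apply: le_lt_trans hN.
  by rewrite -(subnK hm) exprD ler_piMl ?exprn_ge0 // exprn_ile1 // ltW.
have [||z bz hz] := @op_cauchy_lim _ _ (fun m => y m j k).
- by move=> m; exact: cstar_bounded.
- move=> e e0; have [N hN] := small e e0; exists N.
  have half a b : (N <= a)%N -> (a <= b)%N -> opbound e (y b j k \- y a j k).
    move=> ha hab; rewrite -(subnKC hab); apply: opbound_le (@entry_cauchy a (b - a)%N j k).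
    exact: ltW (hN _ ha).
  move=> a b ha hb; have [hab|hab] := leqP a b; last by apply: half => //; exact: ltnW.
  by apply: opboundB; exact: half.
have cvz a : hcvg (fun m => y m j k a) (z a).
  exact: (@hcvg_of_opbound _ _ (fun m => y m j k)).
exists z; split => //.
  apply: cstar_closed => // e e0; have [N hN] := hz e e0; exists (y N j k) => //.
  by apply: opboundB; exact: hN.
move=> a; apply/ler_addgt0Pr => e e0; have [N hN] := cvz a e e0.
rewrite -[z a](subrK (y N j k a)); apply: le_trans (hilbert_normD _ _) _.
rewrite addrC lerD //; first exact: entry_bound.
by rewrite hilbert_normB ltW // hN.
Qed.

(** The root is 1 - z. Its entries belong to C*(u), as they must if a map defined only on C*(u) is
    to be applied to them: every iterate is a polynomial in the entries of [t], and the limits are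
    taken in norm. *)
Lemma matrix_sqrt : exists f : 'I_n -> 'I_n -> H -> H,
  [/\ forall j k, cstar u (f j k), forall j k, is_adjoint (f j k) (f k j) &
      forall j k, t j k = fun a => \sum_l f j l (f l k a)].
Proof.
have /choice[z hz] : forall j, exists f : 'I_n -> H -> H, forall k, [/\ cstar u (f k),
    opbound 1 (f k) & forall a, hcvg (fun m => y m j k a) (f k a)].
  by move=> j; have [f hf] := choice (y_lim j); exists f.
have zadj j k : is_adjoint (z j k) (z k j).
  have [_ _ h1] := hz j k; have [_ _ h2] := hz k j.
  apply: (@adjoint_lim _ _ (fun m => y m j k) (fun m => y m k j)) h1 h2 => m; exact: y_adj.
have zfix j k a : z j k a = (2^-1 : C) *: (xi j k a + \sum_l z j l (z l k a)).
  have [_ _ h] := hz j k; apply: hcvg_unique (hcvg_shift (h a)) _ => /=.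
  apply: hcvgZ; apply: hcvgD; first exact: hcvg_cst.
  apply: hcvg_sum => l; have [_ _ h1] := hz j l; have [_ _ h2] := hz l k.
  exact: (@hcvg_comp _ _ (fun m => y m j l) (z j l) (fun m => y m l k a) (z l k a) 1).
exists (fun j k a => @delta_op H j k a - z j k a); split=> [j k|j k|j k].
- have [h _ _] := hz j k; have := cstar_lin (-1) h (cstar_delta j k); congr (cstar u _).
  by apply/funext => x /=; rewrite scaleN1r addrC.
- exact: adjoint_sub (@delta_adjoint H j k) (zadj j k).
- apply/funext => a; rewrite sumrB delta_sum.
  have -> : \sum_l z j l (@delta_op H l k a - z l k a) = z j k a - \sum_l z j l (z l k a).
    have lz l : linear (z j l) by have [/cstar_linear] := hz j l.
    under eq_bigr do rewrite (linB _ _ (lz _)).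
    rewrite sumrB; congr (_ - _); rewrite (bigD1 k) //= /delta_op eqxx big1 ?addr0 //.
    by move=> l /negPf ->; exact: lin0 (lz l).
  have : xi j k a + \sum_l z j l (z l k a) = z j k a + z j k a.
    rewrite [in RHS](zfix j k a) -mulr2n -scaler_nat scalerA.
    by rewrite mulfV ?scale1r // pnatr_eq0.
  rewrite /xi => h.
  by rewrite opprB addrACA -opprD -h opprD opprB addrACA subrr addr0 addrC subrK.
Qed.

End SquareRoot.

(** * Positivity is preserved by *-isomorphisms *)

Section UsimPositivity.
Context {R : realType} {d : nat}.
Local Notation C := R[i].
Hypothesis d_gt0 : (0 < d)%N.

(** [cstar] is generated without adjoining a unit; the product of the adjoint of the first unitary
    with that unitary supplies it, whence the need for a coordinate. *)
Lemma cstar_idfun (u : utuple R d) : cstar u idfun.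
Proof.
pose i0 := Ordinal d_gt0.
have := cstar_comp (@cstar_letter R d u (linv (i0, true))) (@cstar_letter R d u (i0, true)).
by congr (cstar u _); apply/funext => x; exact: letterK.
Qed.

Lemma pindex_sum (V : nmodType) n (F : pindex (d := d) n -> V) :
  \sum_z F z = \sum_j \sum_k \sum_q F (q, j, k).
Proof.
transitivity (\sum_q \sum_j \sum_k F (q, j, k)).
  by rewrite !pair_bigA; apply: eq_bigr => -[[q j] k].
rewrite exchange_big; apply: eq_bigr => j _; exact: exchange_big.
Qed.

(** The hermitian part of the operator matrix obtained by evaluating the pencil at [u]. As [pairing]
    takes real parts, its quadratic form is exactly the pairing with Gram matrices. *)
Definition pencil_op (u : utuple R d) n (L : pindex (d := d) n -> C) (j k : 'I_n) (a : usp u) :=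
  \sum_q (2^-1 : C) *: (L (q, j, k) *: ext u q a + conjc (L (q, k, j)) *: ext (uinv u) q a).

Lemma ext_adjoint (u : utuple R d) q : is_adjoint (ext u q) (ext (uinv u) q).
Proof. by case: q => [i|] //; have [] := uinvP u i. Qed.

Lemma conjc_half : conjc (2^-1 : C) = 2^-1.
Proof. by rewrite conjc_inv conjc_nat. Qed.

Lemma pencil_op_adjoint (u : utuple R d) n (L : pindex (d := d) n -> C) j k :
  is_adjoint (@pencil_op u n L j k) (@pencil_op u n L k j).
Proof.
move=> x y; have s := hdot_semidot (usp u).
rewrite /pencil_op (sd_suml s) (sd_sumr s); apply: eq_bigr => q _.
rewrite (sdZl s) (sdZr s) conjc_half; congr (_ * _).
rewrite (sdDl s) (sdDr s) !(sdZl s) !(sdZr s) conjcK addrC.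
by rewrite ext_adjoint (adjoint_sym (@ext_adjoint u q)).
Qed.

Lemma pencil_op_form (u : utuple R d) n (L : pindex (d := d) n -> C) (x : 'I_n -> usp u) :
  adot (opm (@pencil_op u n L) x) x = (pairing L (gram u x))%:C.
Proof.
have s := hdot_semidot (usp u).
have -> : adot (opm (@pencil_op u n L) x) x = 2^-1 *
    (\sum_z L z * gram u x z + conjc (\sum_z L z * gram u x z)).
  rewrite conjc_sum !pindex_sum /adot mulrDr [in X in _ + X]exchange_big /= !mulr_sumr.
  rewrite -big_split; apply: eq_bigr => j _ /=; rewrite /opm (sd_suml s) !mulr_sumr.
  rewrite -big_split; apply: eq_bigr => k _ /=; rewrite /pencil_op (sd_suml s) !mulr_sumr.
  rewrite -big_split; apply: eq_bigr => q _ /=; rewrite (sdZl s) (sdDl s) !(sdZl s) mulrDr.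
  rewrite /gram /= conjcM; congr (_ + _ * (_ * _)).
  by rewrite (adjoint_sym (@ext_adjoint u q)) (sd_herm s).
by rewrite addcJ mulrA mulVf ?mul1r // pnatr_eq0.
Qed.

Lemma ext_cstar (u : utuple R d) q : cstar u (ext u q) /\ cstar u (ext (uinv u) q).
Proof.
case: q => [i|]; last by split; exact: cstar_idfun.
by split; [exact: (@cstar_letter R d u (i, true))|exact: (@cstar_letter R d u (i, false))].
Qed.

Lemma pencil_op_cstar (u : utuple R d) n (L : pindex (d := d) n -> C) j k :
  cstar u (@pencil_op u n L j k).
Proof.
have id := @cstar_idfun u; apply: cstar_sum => // q; have [h1 h2] := ext_cstar u q.
by apply: cstarZ => //; apply: cstarD; apply: cstarZ.
Qed.

(** A pencil positive on [u] gives a positive matrix [T] over C*(u). Shifted by [lam] and divided by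
    [M], it has spectrum away from 0 and is the square of a self-adjoint matrix [f]; its image is
    the square of the self-adjoint matrix with entries pi(f j k), hence positive. The shift then
    tends to 0. *)
Lemma usim_range_incl (u v : utuple R d) : usim u v -> range_incl 1 v u.
Proof.
move=> [pi [[piB _ _] piL piM piA piG]] n y L hL; rewrite invr1 scale_pencil1.
have idu := @cstar_idfun u; have idv := @cstar_idfun v.
have sH := hdot_semidot (usp u); have sK := hdot_semidot (usp v).
have pi0 : pi (fun _ => 0) = fun _ => 0.
  have := piL (-1) _ _ idu idu.
  rewrite (_ : -1 \*: idfun \+ idfun = fun _ => 0); last first.
    by apply/funext => x /=; rewrite scaleN1r addNr.
  by move=> ->; apply/funext => x /=; rewrite scaleN1r addNr.
have piD a b : cstar u a -> cstar u b -> pi (fun x => a x + b x) = fun x => pi a x + pi b x.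
  move=> ha hb; have := piL 1 _ _ ha hb; rewrite (_ : 1 \*: a \+ b = fun x => a x + b x).
    by move=> ->; apply/funext => x /=; rewrite scale1r.
  by apply/funext => x /=; rewrite scale1r.
have piZ (c : C) a : cstar u a -> pi (fun x => c *: a x) = fun x => c *: pi a x.
  move=> ha; have := piL c _ _ ha (cstar0 idu); rewrite (_ : c \*: a \+ _ = fun x => c *: a x).
    by move=> ->; apply/funext => x /=; rewrite pi0 addr0.
  by apply/funext => x /=; rewrite addr0.
have pi_sum (I : Type) (r : seq I) (f : I -> usp u -> usp u) : (forall i, cstar u (f i)) ->
    pi (fun x => \sum_(i <- r) f i x) = fun x => \sum_(i <- r) pi (f i) x.
  move=> hf; elim: r => [|i r IH].
    rewrite (_ : (fun x => _) = fun _ => 0); last by apply/funext => x; rewrite big_nil.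
    by rewrite pi0; apply/funext => x; rewrite big_nil.
  rewrite (_ : (fun x => _) = fun x => f i x + \sum_(i <- r) f i x).
    rewrite piD ?IH //; last exact: cstar_sum.
    by apply/funext => x; rewrite big_cons.
  by apply/funext => x; rewrite big_cons.
have pi_inv i : pi (uinv u i) = uinv v i.
  have [_ h _ _] := uinvP u i; have [_ h' _ _] := uinvP v i.
  have := piA _ _ (@cstar_letter R d u (i, true)) h; rewrite /letter /= piG => h2.
  exact: adjoint_unique h2 h'.
have pi_id : pi idfun = idfun.
  pose i := Ordinal d_gt0.
  have := piM _ _ (@cstar_letter R d u (i, false)) (@cstar_letter R d u (i, true)).
  rewrite /letter /= pi_inv piG; have [_ _ -> _] := uinvP u i => ->.
  by have [] := uinvP v i.
have pi_ext q : pi (ext u q) = ext v q /\ pi (ext (uinv u) q) = ext (uinv v) q.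
  by case: q => [i|] /=; split.
pose T := @pencil_op u n L.
have piT j k : pi (T j k) = @pencil_op v n L j k.
  rewrite /T /pencil_op pi_sum => [|q]; last first.
    by have [h1 h2] := ext_cstar u q; apply: cstarZ => //; apply: cstarD; apply: cstarZ.
  apply/funext => x; apply: eq_bigr => q _; have [h1 h2] := ext_cstar u q.
  have [e1 e2] := pi_ext q.
  rewrite piZ ?piD ?piZ ?e1 ?e2 //; try exact: cstarZ.
  by apply: cstarD; apply: cstarZ.
apply/ler_addgt0Pr => e e0.
pose nrm2 := snorm (@adot R 'I_n (usp v)) y ^+ 2.
have nrm0 : 0 <= nrm2 by rewrite sqr_ge0.
(* Chosen so that the shift contributes at most [e] to the form at the given vectors [y]. *)
pose lam : R := e / (nrm2 + 1); have lam0 : 0 < lam by rewrite divr_gt0 //; lra.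
have su := adot_semidot 'I_n (usp u); have sv := adot_semidot 'I_n (usp v).
(* The sum of the moduli of the coefficients bounds [T], the unitaries being isometric. *)
have [B B0 hB] : exists2 B, 0 <= B & forall x, pairing L (gram u x) <=
    B * snorm (@adot R 'I_n (usp u)) x ^+ 2.
  exists (\sum_z normc (L z)) => [|x]; first by apply: sumr_ge0 => z _; exact: normc_ge0.
  apply: le_trans (Re_le _) _; rewrite mulr_suml.
  apply: le_trans (normc_sum _ _ _) _; apply: ler_sum => z _; rewrite Normc.normcM ler_wpM2l ?normc_ge0 //.
  rewrite /gram; apply: le_trans (cauchy_schwarz sH _ _) _; rewrite expr2.
  apply: ler_pM; rewrite ?snorm_ge0 //; last exact: hnorm_le_adot.
  apply: le_trans (hnorm_le_adot x z.2); case: (z.1.1) => [i|] //=.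
  by have := letter_norm (i, true) (x z.2); rewrite /letter /hnorm /= => ->.
pose M := B + lam + lam; have M0 : 0 < M by rewrite /M; lra.
pose t j k : usp u -> usp u := fun a =>
  (M^-1)%:C *: (T j k a + lam%:C *: @delta_op R n (usp u) j k a).
have T_cstar j k : cstar u (T j k) by exact: pencil_op_cstar.
have t_cstar j k : cstar u (t j k).
  by apply: cstarZ => //; apply: cstarD => //; apply: cstarZ => //; exact: cstar_delta.
have t_form x : adot (opm t x) x = (M^-1 *
    (pairing L (gram u x) + lam * snorm (@adot _ _ _) x ^+ 2))%:C.
  have -> : opm t x = (M^-1)%:C *: (opm T x + lam%:C *: x).
    apply/funext => j; change (opm t x j = (M^-1)%:C *: (opm T x j + lam%:C *: x j)).
    rewrite /opm -scaler_sumr big_split /=; congr (_ *: (_ + _)).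
    by rewrite -scaler_sumr delta_sum.
  rewrite (sdZl su) (sdDl su) (sdZl su) pencil_op_form (sd_real su x) -(snorm_sqr su).
  by rewrite !(rmorphM, rmorphD).
have t_adj j k : is_adjoint (t j k) (t k j).
  move=> a b; rewrite /t (sdZl sH) (sdZr sH) conjc_real (sdDl sH) (sdDr sH).
  by rewrite (sdZl sH) (sdZr sH) conjc_real pencil_op_adjoint delta_adjoint.
have [|||f [f_cstar f_adj f_sq]] := @matrix_sqrt R d u n idu t (lam / M) _ _ t_cstar t_adj.
- by rewrite divr_gt0.
- by rewrite ler_pdivrMr // /M; lra.
- move=> x; rewrite t_form /=; have := hL x; have := hB x.
  set N := snorm _ x ^+ 2; have N0 : 0 <= N by rewrite sqr_ge0.
  move=> h1 h2; rewrite [lam / M]mulrC -mulrA ler_pM2l ?invr_gt0 // mulrC.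
  by rewrite ler_pdivrMl // mulrC /M; apply/andP; split; nra.
have piTv j k a : pi (t j k) a = (M^-1)%:C *: (@pencil_op v n L j k a +
    lam%:C *: @delta_op R n (usp v) j k a).
  have pid : pi (@delta_op R n (usp u) j k) = @delta_op R n (usp v) j k.
    by rewrite /delta_op; case: eqP => _; [exact: pi_id|exact: pi0].
  rewrite /t piZ ?piD ?piZ ?piT ?pid //; try exact: cstar_delta.
    by apply: cstarZ => //; exact: cstar_delta.
  by apply: cstarD => //; apply: cstarZ => //; exact: cstar_delta.
(* The form of the image of [t] at [y] is the squared norm of the image of [f] applied to [y]. *)
have pos : 0 <= Re (adot (opm (fun j k => pi (t j k)) y) y).
  have -> : opm (fun j k => pi (t j k)) y =
      opm (fun j k => pi (f j k)) (opm (fun j k => pi (f j k)) y).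
    apply/funext => j; rewrite /opm.
    have lf l : linear (pi (f j l)) by apply: cstar_linear; exact: piB.
    under [RHS]eq_bigr do rewrite (lin_sum _ _ _ (lf _)).
    rewrite exchange_big; apply: eq_bigr => k _.
    rewrite f_sq pi_sum => [|l]; last exact: cstar_comp.
    apply: eq_bigr => l _.
    by have := congr1 (@^~ (y k)) (piM _ _ (f_cstar j l) (f_cstar l k)).
  by rewrite opm_adjoint => [|j k]; [exact: sd_ge0|exact: piA].
have : Re (adot (opm (fun j k => pi (t j k)) y) y) =
    M^-1 * (pairing L (gram v y) + lam * nrm2).
  have -> : opm (fun j k => pi (t j k)) y = (M^-1)%:C *: (opm (@pencil_op v n L) y + lam%:C *: y).
    apply/funext => j; change (opm (fun j k => pi (t j k)) y j =
      (M^-1)%:C *: (opm (@pencil_op v n L) y j + lam%:C *: y j)).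
    rewrite /opm; under eq_bigr do rewrite piTv.
    rewrite -scaler_sumr big_split /=; congr (_ *: (_ + _)).
    by rewrite -scaler_sumr delta_sum.
  rewrite (sdZl sv) (sdDl sv) (sdZl sv) pencil_op_form (sd_real sv y) -(snorm_sqr sv).
  by rewrite -!(rmorphM, rmorphD).
move=> h; move: pos; rewrite h pmulr_rge0 ?invr_gt0 // => h1.
apply: le_trans h1 _; rewrite lerD2l /lam mulrAC ler_pdivrMr ?ltr_wpDl //.
by rewrite ler_pM2l // lerDl.
Qed.

(** Each approximating polynomial has an explicit adjoint; these adjoints are Cauchy in norm and
    converge to an adjoint of [a]. *)
Lemma cstar_adjoint_exists (u : utuple R d) a : cstar u a -> exists a', is_adjoint a a'.
Proof.
move=> /(cstar_approximable u)[ba ha].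
have /choice[p hp] m : exists p, [/\ bounded_op p, exists p', is_adjoint p p' &
    opbound m.+1%:R^-1 (a \- p)].
  have [p [q [g h]]] := ha _ (invS_gt0 R m); have [p' [_ [_ adj _]]] := gen_adjoint g.
  by exists p; split; [exact: gen_bounded g|exists p'|].
have /choice[p' hp'] m : exists p', is_adjoint (p m) p' by have [_ h _] := hp m.
have [||b' bb' hb'] := @op_cauchy_lim _ _ p'.
- by move=> m; have [h _ _] := hp m; exact: adjoint_bounded h (hp' m).
- move=> e e0; have e20 : 0 < e / 2 by rewrite divr_gt0.
  have [N hN] := invS_small e20; exists N => m n hm hn.
  apply: (adjoint_opbound (ltW e0) (adjoint_sub (hp' m) (hp' n))).
  have [_ _ h1] := hp m; have [_ _ h2] := hp n.
  rewrite [e]splitr; apply: (@opbound_trans _ _ _ _ _ a).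
    by apply: opboundB; apply: opbound_le h1; exact: ltW (hN _ hm).
  by apply: opbound_le h2; exact: ltW (hN _ hn).
- exists b'; apply: (@adjoint_lim _ _ p p') => // x; apply: hcvg_of_opbound => // e e0.
  have [N hN] := invS_small e0; exists N => m hm; have [_ _ h] := hp m.
  by apply: opboundB; apply: opbound_le h; exact: ltW (hN _ hm).
Qed.

(** Only compatibility of the inverse with adjoints is not formal: the adjoint of a preimage must be
    known to exist before [pi] can be applied to it. *)
Lemma usim_sym (u v : utuple R d) : usim u v -> usim v u.
Proof.
move=> [pi [[piB piI piS] piL piM piA piG]].
pose rho b := xget (fun _ => 0) [set a | cstar u a /\ pi a = b].
have rhoP b : cstar v b -> cstar u (rho b) /\ pi (rho b) = b.
  move=> /piS[a ha ab].
  by apply: (@xgetPex _ _ [set a | cstar u a /\ pi a = b]); exists a.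
have inj a b : cstar u a -> cstar u b -> pi a = pi b -> a = b.
  by move=> ha hb; apply: piI; rewrite inE.
have rhoE a b : cstar u a -> pi a = b -> rho b = a.
  move=> ha e; have [h1 h2] : cstar u (rho b) /\ pi (rho b) = b.
    by apply: rhoP; rewrite -e; exact: piB.
  by apply: inj => //; rewrite h2.
exists rho; split.
- split.
  + by move=> b /rhoP[].
  + move=> b b'; rewrite !inE => /rhoP[_ h1] /rhoP[_ h2] e.
    by rewrite -h1 e h2.
  + by move=> a ha; exists (pi a); [exact: piB|exact: rhoE].
- move=> l a b /rhoP[h1 e1] /rhoP[h2 e2]; apply: rhoE; first exact: cstar_lin.
  by rewrite piL // e1 e2.
- move=> a b /rhoP[h1 e1] /rhoP[h2 e2]; apply: rhoE; first exact: cstar_comp.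
  by rewrite piM // e1 e2.
- move=> b b' /rhoP[h1 e1] adj; have [a' ha'] := cstar_adjoint_exists h1.
  have ca' : cstar u a' by have [_ _ _ h _] := cstar_subalgebra u; exact: h ha'.
  have := piA _ _ h1 ha'; rewrite e1 => h2.
  have -> : rho b' = a' by apply: rhoE => //; exact: adjoint_unique h2 adj.
  exact: ha'.
- move=> i; apply: rhoE; last exact: piG.
  exact: (@cstar_letter R d u (i, true)).
Qed.

End UsimPositivity.

(** * Dilations *)

Section UltraproductRepresentation.
Context {R : realType} {d : nat}.
Local Notation C := R[i].
Variables (v : utuple R d) (I : nat -> finType).
Variables (eta : forall k : nat, nat -> (I k -> usp v)) (B : nat -> R).
Variable sigma : 'I_d * bool -> nat -> nat.
Hypothesis eta_bound : forall k n, snorm (@adot R (I k) (usp v)) (@eta k n) <= B n.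
Hypothesis eta_sigma : forall k l n, @eta k (sigma l n) = fun i => letter v l (@eta k n i).

Local Notation ad k := (@adot R (I k) (usp v)).

Let kernel i j := ulim (fun k => ad k (@eta k i) (@eta k j)).

Lemma kernel_ucvg i j : ucvg (fun k => ad k (@eta k i) (@eta k j)) (kernel i j).
Proof.
apply: (@ucvg_ulim _ _ (B i * B j)) => k.
apply: le_trans (cauchy_schwarz (adot_semidot _ _) _ _) _.
by apply: ler_pM; [exact: snorm_ge0|exact: snorm_ge0|exact: eta_bound|exact: eta_bound].
Qed.

Lemma kernel_ucvg_sum n (c e : nat -> C) :
  ucvg (fun k => ad k (\sum_(i < n) c i *: @eta k i) (\sum_(j < n) e j *: @eta k j))
    (\sum_(i < n) \sum_(j < n) c i * conjc (e j) * kernel i j).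
Proof.
rewrite (_ : (fun k => _) = fun k =>
    \sum_(i < n) \sum_(j < n) c i * conjc (e j) * ad k (@eta k i) (@eta k j)); last first.
  apply/funext => k; have s := adot_semidot (I k) (usp v).
  rewrite (sd_suml s); apply: eq_bigr => i _; rewrite (sd_sumr s); apply: eq_bigr => j _.
  by rewrite (sdZl s) (sdZr s) mulrA.
apply: (@ucvg_sum R 'I_n _ (fun (i : 'I_n) k =>
    \sum_(j < n) c i * conjc (e j) * ad k (@eta k i) (@eta k j))) => i.
apply: (@ucvg_sum R 'I_n _ (fun (j : 'I_n) k =>
    c i * conjc (e j) * ad k (@eta k i) (@eta k j))) => j.
exact: ucvgZ (kernel_ucvg i j).
Qed.

(** [b n] plays the class of the sequence of the [eta k n] in an ultraproduct of finite direct sums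
    of copies of the space of [v]. Keeping countably many classes makes the space separable, and
    [sigma] records that they are permuted among themselves by the letters, which therefore act on
    their closed span. *)
Lemma ultraproduct_representation : exists (V : utuple R d) (b : nat -> usp V),
  [/\ htotal b,
      forall i j, ucvg (fun k => ad k (@eta k i) (@eta k j)) (hdot (usp V) (b i) (b j)),
      forall l n, letter V l (b n) = b (sigma l n) &
      weakly_contained V v].
Proof.
have [||K [b [tb bE]]] := @kolmogorov R kernel.
- move=> i j; apply: (ucvg_unique (kernel_ucvg j i)).
  rewrite (_ : (fun k => _) = fun k => conjc (ad k (@eta k i) (@eta k j))).
    exact: ucvg_conj (kernel_ucvg i j).
  by apply/funext => k; rewrite (sd_herm (adot_semidot _ _)).
- move=> n c; apply: (ucvg_Re_ge (kernel_ucvg_sum n c c)).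
  by apply: (@freeU_tail _ 0%N) => k _ /=; exact: (sd_ge0 (adot_semidot _ _)).
have sK := hdot_semidot K.
have comb_ucvg p : ucvg (fun k => ad k (comb (@eta k) p) (comb (@eta k) p))
    (hdot K (comb b p) (comb b p)).
  have := kernel_ucvg_sum (size p) (fun i => p`_i) (fun i => p`_i); congr ucvg.
  rewrite /comb (sd_suml sK); apply: eq_bigr => i _; rewrite (sd_sumr sK).
  by apply: eq_bigr => j _; rewrite (sdZl sK) (sdZr sK) bE mulrA.
(* Distinct indices may carry the same vectors, for instance after cancellation of a letter with its
   inverse; they must then have the same class. *)
have b_eq i j : (forall k, @eta k i = @eta k j) -> b i = b j.
  move=> h; apply/eqP; rewrite -subr_eq0; apply/eqP/hnorm_eq0.
  have := comb_ucvg ('X^i - 'X^j).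
  have lc (U : lmodType C) (g : nat -> U) : comb g ('X^i - 'X^j) = g i - g j.
    by rewrite (linB _ _ (comb_linear g)) !combXn.
  rewrite lc => h1; rewrite /hnorm /snorm.
  have := ucvg_unique h1; rewrite (_ : (fun k => _) = fun _ => 0).
    by move=> /(_ _ (ucvg_cst 0)) ->; rewrite sqrtr0.
  apply/funext => k; rewrite lc h subrr.
  exact: sd0l (adot_semidot _ _) _.
have /choice[V hV] : forall l, exists V : K -> K, [/\ linear V,
    forall x y, hdot K (V x) (V y) = hdot K x y & forall n, V (b n) = b (sigma l n)].
  move=> l; apply: (isometry_extend tb) => i j; rewrite !bE.
  apply: (ucvg_unique (kernel_ucvg _ _)); have := kernel_ucvg i j; congr ucvg.
  apply/funext => k; rewrite !eta_sigma; apply: eq_bigr => x _.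
  by rewrite letter_dot.
have V_lin l : linear (V l) by have [] := hV l.
have V_dot l x y : hdot K (V l x) (V l y) = hdot K x y by have [_ h _] := hV l.
have V_b l n : V l (b n) = b (sigma l n) by have [_ _ h] := hV l.
have V_bounded l : bounded_op (V l).
  apply: (@bounded_op_mk _ _ _ 1) => // x; rewrite mul1r.
  by rewrite (dot_isometry (V_dot l)).
have VK l : V (linv l) \o V l = idfun.
  apply: (total_eq tb).
  - exact: bounded_op_comp.
  - exact: bounded_op_id.
  - move=> n /=; rewrite !V_b; apply: b_eq => k; rewrite !eta_sigma.
    by apply/funext => i; rewrite letterK.
have V_adj l : is_adjoint (V l) (V (linv l)).
  move=> x y; rewrite -(V_dot (linv l) (V l x)).
  by have := congr1 (@^~ x) (VK l) => /= ->.
have VP i : unitary_op (V (i, true)).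
  split; first exact: V_bounded.
  exists (V (i, false)); split; first exact: V_bounded.
  - exact: (V_adj (i, true)).
  - exact: (VK (i, true)).
  - exact: (VK (i, false)).
pose W := @UTuple R d K (fun i => V (i, true)) VP.
have W_letter l : letter W l = V l.
  case: l => i [] //; rewrite /letter /=; have [_ h _ _] := uinvP W i.
  exact: adjoint_unique h (V_adj (i, true)).
exists W, b; split => //.
- by move=> i j; rewrite bE; exact: kernel_ucvg.
- by move=> l n; rewrite W_letter V_b.
move=> a a' g M M0 hM.
(* A polynomial in the letters acts on coefficient sequences in the same way for [b] and for every
   [eta k], so the norm bound can be used in each coordinate and then passed to the limit. *)
have key p : exists p', a (comb b p) = comb b p' /\
    forall k, comb (@eta k) p' = fun i => a' (comb (@eta k) p i).
  elim: g p {hM} => [l|c f f' g g' _ IHf _ IHg|f f' g g' _ IHf _ IHg] p.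
  - exists (comb (fun i => 'X^(sigma l i)) p); split.
      rewrite W_letter (lin_comb _ _ (V_lin l)) (lin_comb _ _ (comb_linear b)).
      by apply: eq_comb => i /=; rewrite V_b combXn.
    move=> k; rewrite (lin_comb _ _ (comb_linear (@eta k))).
    rewrite (@eq_comb _ _ _ (fun n i => letter v l (@eta k n i))); last first.
      by move=> n /=; rewrite combXn eta_sigma.
    apply/funext => i; rewrite /comb.
    have app (F : nat -> (I k -> usp v)) : (\sum_(j < size p) p`_j *: F j) i =
        \sum_(j < size p) p`_j *: F j i.
      by rewrite fct_sumE; apply: eq_bigr.
    rewrite [in RHS]app (lin_sum _ _ _ (@letter_linear R d v l)).
    apply: etrans (app (fun n i => letter v l (@eta k n i))) _; apply: eq_bigr => j _.
    by rewrite (linZ _ _ (@letter_linear R d v l)).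
  - have [p1 [e1 h1]] := IHf p; have [p2 [e2 h2]] := IHg p.
    exists (c *: p1 + p2); split; first by rewrite comb_linear /= e1 e2.
    by move=> k; rewrite comb_linear h1 h2.
  - have [p2 [e2 h2]] := IHg p; have [p1 [e1 h1]] := IHf p2.
    by exists p1; split; [rewrite /= e2|move=> k; rewrite h1 h2].
have comb_le p : hnorm (a (comb b p)) <= M * hnorm (comb b p).
  have [p' [-> hp']] := key p.
  have Mp0 : 0 <= M * hnorm (comb b p) by rewrite mulr_ge0 // hnorm_ge0.
  suff : hnorm (comb b p') ^+ 2 <= (M * hnorm (comb b p)) ^+ 2.
    by rewrite ler_pXn2r ?nnegrE ?hnorm_ge0.
  rewrite exprMn /hnorm !(snorm_sqr sK) -subr_ge0.
  have h := ucvgD (ucvgZ (M ^+ 2)%:C (comb_ucvg p)) (ucvgZ (-1) (comb_ucvg p')).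
  have := @ucvg_Re_ge _ _ _ 0 h; rewrite ReD ReZ mulN1r ReN; apply.
  apply: (@freeU_tail _ 0%N) => k _ /=; have s := adot_semidot (I k) (usp v).
  rewrite ReD ReZ mulN1r ReN subr_ge0 hp' /adot !Re_sum mulr_sumr.
  apply: ler_sum => i _.
  have Mi0 : 0 <= M * hnorm (comb (@eta k) p i) by rewrite mulr_ge0 // hnorm_ge0.
  have : hnorm (a' (comb (@eta k) p i)) ^+ 2 <= (M * hnorm (comb (@eta k) p i)) ^+ 2.
    by rewrite ler_pXn2r ?nnegrE ?hnorm_ge0.
  by rewrite exprMn /hnorm !(snorm_sqr (hdot_semidot (usp v))).
have ba := gen_bounded g; have [N N0 hN] := bounded_op_bound ba.
move=> x; apply/ler_addgt0Pr => e e0.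
have d0 : 0 < e / (M + N + 1) by rewrite divr_gt0 //; lra.
have [p hp] := tb x _ d0.
have h1 := hN (x - comb b p); have h2 := comb_le p.
rewrite -[x in a x](subrK (comb b p)) (linD _ _ (bounded_op_linear ba)).
apply: le_trans (hilbert_normD _ _) _.
have h3 : hnorm (comb b p) <= hnorm (x - comb b p) + hnorm x.
  by have := hilbert_normD (comb b p - x) x; rewrite subrK hilbert_normB.
have := ler_wpM2l M0 h3; move: hp; rewrite ltr_pdivlMr; last by lra.
have := hnorm_ge0 (x - comb b p); move: h1 h2; set t := hnorm (x - _) => *; nra.
Qed.

End UltraproductRepresentation.

Section Dilation.
Context {R : realType} {d : nat}.
Local Notation C := R[i].
Implicit Types u v : utuple R d.

Lemma dense_total (H : hilbert R) (a : nat -> H) :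
  (forall x (e : R), 0 < e -> exists n, hnorm (x - a n) < e) -> htotal a.
Proof. by move=> ha x e /(ha x)[n hn]; exists 'X^n; rewrite combXn. Qed.

Lemma htotal_sub (H : hilbert R) (a b : nat -> H) :
  htotal a -> (forall i, exists j, a i = b j) -> htotal b.
Proof.
move=> ta ab x e /(ta x)[p hp]; have /choice[f hf] := ab.
exists (comb (fun i => 'X^(f i)) p).
rewrite (lin_comb _ _ (comb_linear b)) (@eq_comb _ _ _ a) // => i /=.
by rewrite combXn.
Qed.

Lemma htotal_inj (H : hilbert R) (a : nat -> H) x y : htotal a ->
  (forall n, hdot H x (a n) = hdot H y (a n)) -> x = y.
Proof.
move=> ta h; have s := hdot_semidot H.
apply/eqP; rewrite -subr_eq0; apply/eqP/hnorm_le_eq0 => e e0.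
have [p hp] := ta (x - y) _ e0.
have orth : hdot H (x - y) (comb a p) = 0.
  rewrite /comb (sd_sumr s) big1 // => i _.
  by rewrite (sdZr s) (sdBl s) h subrr mulr0.
have [->|n0] := eqVneq (hnorm (x - y)) 0; first exact: ltW.
have np : 0 < hnorm (x - y) by rewrite lt0r n0 hnorm_ge0.
rewrite -(ler_pM2r np) -expr2 /hnorm (snorm_sqr s).
rewrite -[X in hdot H _ X](subrK (comb a p)) (sdDr s) orth addr0.
apply: le_trans (Re_le _) _; apply: le_trans (cauchy_schwarz s _ _) _.
by rewrite mulrC ler_wpM2r ?snorm_ge0 // ltW.
Qed.

Lemma usim_refl u : usim u u.
Proof.
have gen_eq a a' : @gen R d u u a a' -> a = a' by elim=> // *; congruence.
by apply: usim_of_weakly_contained => a a' /gen_eq -> M _.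
Qed.

(** An intertwining isometry satisfies J p(u) = p(v) J, so the norm of p(u) is read on the range of
    [J]. *)
Lemma weakly_contained_of_intertwiner u v (J : usp u -> usp v) :
  linear J -> (forall x, hnorm (J x) = hnorm x) ->
  (forall l x, J (letter u l x) = letter v l (J x)) -> weakly_contained u v.
Proof.
move=> lJ nJ hJ a a' g M M0 hM x; rewrite -(nJ (a x)).
have -> : J (a x) = a' (J x).
  elim: g x {hM} => [l|c f f' g g' _ IHf _ IHg|f f' g g' _ IHf _ IHg] x //=.
    by rewrite (linD _ _ lJ) (linZ _ _ lJ) IHf IHg.
  by rewrite IHf IHg.
by rewrite -(nJ x).
Qed.

Local Notation Word := (seq ('I_d * bool)).
Definition word_op u (w : Word) (x : usp u) : usp u :=
  foldr (fun l y => letter u l y) x w.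

Lemma word_op_dot u (w : seq (_ * _)) x y : hdot (usp u) (@word_op u w x) (@word_op u w y) = hdot (usp u) x y.
Proof. by elim: w => //= l w IH; rewrite letter_dot. Qed.

Lemma big_option (V : nmodType) (I : finType) (F : option I -> V) :
  \sum_o F o = F None + \sum_i F (Some i).
Proof.
rewrite (bigD1 None) //=; congr (_ + _).
rewrite (reindex_omap Some id) /=; last by case.
by apply: eq_bigl => i; rewrite eqxx.
Qed.

(** A sum of Gram matrices is the Gram matrix of vectors in a direct sum. The single index [k]
    measures both the number of vectors taken into account and the precision, so that every fixed
    pair is eventually approximated. *)
Lemma gram_approximants u v (c : R) (a : nat -> usp u) : range_incl c u v ->
  exists ys : forall k : nat, seq (nat -> usp v),
    forall k s s', (s < k)%N -> (s' < k)%N -> forall q : option 'I_d,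
    normc (\sum_(y <- ys k) hdot (usp v) (ext v q (y s)) (y s') -
      (if q is Some _ then c^-1%:C else 1) * hdot (usp u) (ext u q (a s)) (a s'))
    < k.+1%:R^-1.
Proof.
move=> h.
suff /choice[ys hys] : forall k : nat, exists ys : seq (nat -> usp v),
    forall s s', (s < k)%N -> (s' < k)%N -> forall q : option 'I_d,
    normc (\sum_(y <- ys) hdot (usp v) (ext v q (y s)) (y s') -
      (if q is Some _ then c^-1%:C else 1) * hdot (usp u) (ext u q (a s)) (a s'))
    < k.+1%:R^-1 by exists ys.
move=> k; have lv i : linear (v i) by exact: (@letter_linear R d v (i, true)).
have [ys hys] := dual_approx_gram lv (h k (fun j : 'I_k => a j)) (invS_gt0 R k).
(* Families indexed by the first [k] integers are extended by 0. *)
exists [seq (fun s => if insub s is Some j then y j else 0) | y : 'I_k -> usp v <- ys].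
move=> s s' hs hs' q; have := hys (q, Ordinal hs', Ordinal hs).
rewrite big_map /gram /=.
have -> : scale_pencil c^-1 (fun z : pindex k => hdot (usp u) (ext u z.1.1 (a z.2)) (a z.1.2))
    (q, Ordinal hs', Ordinal hs) =
    (if q is Some _ then c^-1%:C else 1) * hdot (usp u) (ext u q (a s)) (a s').
  by case: q => [i|] //; rewrite /scale_pencil /= mul1r.
congr (normc (_ - _) < _); apply: eq_bigr => y _.
by rewrite !insubT.
Qed.

Lemma projection_dot (U V : utuple R d) (J : usp U -> usp V) (P : usp V -> usp U) :
  (forall x y, hdot (usp V) (J x) (J y) = hdot (usp U) x y) ->
  (forall k h, hdot (usp V) (k - J (P k)) (J h) = 0) ->
  forall k h, hdot (usp U) (P k) h = hdot (usp V) k (J h).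
Proof.
move=> dJ hP k h; rewrite -dJ; apply/eqP.
by rewrite eq_sym -subr_eq0 -(sdBl (hdot_semidot _)); apply/eqP; exact: hP.
Qed.

(** [J] sends [a s] to the class of the families [y s], for [y] in [ys k]. The coordinates of the
    unit are not scaled, so [J] is isometric; those of the unitaries carry the inverse of [c], so
    [c V_i] compresses to [u_i], [P] being adjoint to [J]. *)
Lemma dilation_exists u v (c : R) : 0 < c -> range_incl c u v ->
  exists (V : utuple R d) (J : usp u -> usp V) (P : usp V -> usp u),
  [/\ weakly_contained V v /\ weakly_contained v V, linear J,
      forall x y, hdot (usp V) (J x) (J y) = hdot (usp u) x y,
      forall k h, hdot (usp V) (k - J (P k)) (J h) = 0 &
      forall i h, u i h = P (c%:C *: V i (J h))].
Proof.
move=> c0 huv; have su := hdot_semidot (usp u); have sv := hdot_semidot (usp v).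
have [a ha] := hilbert_dense_seq (usp u); have ta := dense_total ha.
have [z hz] := hilbert_dense_seq (usp v).
have [ys hys] := gram_approximants a huv.
pose I k : finType := option 'I_(size (ys k)).
(* The index [(b, s, w)] stands for the word [w] applied to the image of [a s]
   when [b] is true, and to [z s] in a copy of the space of [v] otherwise; this
   copy makes [v] weakly contained in [V]. *)
pose base k (b : bool) (s : nat) : I k -> usp v := fun o =>
  match o with
  | Some i => if b && (s < k)%N then nth (fun _ => 0) (ys k) i s else 0
  | None => if b then 0 else z s
  end.
pose eta k (n : nat) : I k -> usp v := match (unpickle n : option (bool * nat * Word)) with
  | Some (b, s, w) => fun o => @word_op v w (base k b s o)
  | None => fun _ => 0
  end.
pose sigma l (n : nat) : nat := match (unpickle n : option (bool * nat * Word)) with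
  | Some (b, s, w) => pickle (b, s, l :: w)
  | None => n
  end.
(* A bound independent of [k]: the squared norm of the approximants of [a s] differs from that of
   [a s] by less than 1, and words act isometrically. *)
pose B (n : nat) : R := match (unpickle n : option (bool * nat * Word)) with
  | Some (b, s, w) => hnorm (a s) + 1 + hnorm (z s)
  | None => 0
  end.
have base_dot k s s' q : (s < k)%N -> (s' < k)%N ->
    \sum_o hdot (usp v) (ext v q (base k true s o)) (base k true s' o) =
    \sum_(y <- ys k) hdot (usp v) (ext v q (y s)) (y s').
  move=> hs hs'; rewrite big_option /= (sd0r sv) add0r.
  rewrite (big_nth (fun _ => 0)) big_mkord; apply: eq_bigr => i _.
  by rewrite hs hs'.
have eta_bound k n : snorm (@adot R (I k) (usp v)) (eta k n) <= B n.
  rewrite /eta /B; case: (unpickle n) => [[[b s] w]|]; last first.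
    by rewrite /snorm /adot big1 ?sqrtr0 // => o _; exact: sd0l.
  have -> : snorm (@adot R (I k) (usp v)) (fun o => word_op w (base k b s o)) =
      snorm (@adot R (I k) (usp v)) (base k b s).
    by rewrite /snorm /adot; congr (Num.sqrt (Re _)); apply: eq_bigr => o _; rewrite word_op_dot.
  have a0 := hnorm_ge0 (a s); have z0 := hnorm_ge0 (z s).
  have asv := adot_semidot (I k) (usp v).
  case: b.
    have [hs|hs] := ltnP s k; last first.
      rewrite /snorm /adot big1 ?sqrtr0 => [|[r|] _]; try exact: sd0l; first by lra.
      by rewrite /= ltnNge hs; exact: sd0l.
    rewrite -(ler_pXn2r (ltn0Sn 1)) ?nnegrE ?snorm_ge0 ?addr_ge0 // (snorm_sqr asv).
    have := base_dot k s s None hs hs; rewrite /adot /= => ->.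
    have := hys k s s hs hs None; rewrite mul1r /= => h.
    have := Re_le (\sum_(y <- ys k) hdot (usp v) (y s) (y s) - hdot (usp u) (a s) (a s)).
    rewrite ReB -(snorm_sqr su) -/(hnorm _).
    have := invS_le1 R k.
    by move: h; set X := normc _; set Y := _^-1 => *; nra.
  rewrite /snorm /adot big_option big1 => [|o _]; last by rewrite /=; exact: sd0l.
  by rewrite addr0 /=; rewrite -/(snorm _ (z s)) -/(hnorm (z s)); lra.
have eta_sigma k l n : eta k (sigma l n) = fun o => letter v l (eta k n o).
  rewrite /sigma /eta; case e: (unpickle n) => [[[b s] w]|]; first by rewrite pickleK.
  by rewrite e; apply/funext => o; rewrite (lin0 (@letter_linear R d v l)).
have [V [b [tb bE bV VwV]]] := ultraproduct_representation eta_bound eta_sigma.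
have sK := hdot_semidot (usp V).
pose beta (t : bool) (s : nat) (w : Word) := b (pickle (t, s, w)).
have etaE k (t : bool) (s : nat) (w : Word) : eta k (pickle (t, s, w)) = fun o => @word_op v w (base k t s o).
  by rewrite /eta pickleK.
have beta_letter l t s w : letter V l (beta t s w) = beta t s (l :: w).
  by rewrite /beta bV /sigma pickleK.
have beta_ext q s : ext V q (beta true s [::]) =
    if q is Some i then beta true s [:: (i, true)] else beta true s [::].
  by case: q => [i|] //=; rewrite -beta_letter.
have beta_gram q s s' : hdot (usp V) (ext V q (beta true s [::])) (beta true s' [::]) =
    (if q is Some _ then c^-1%:C else 1) * hdot (usp u) (ext u q (a s)) (a s').
  rewrite beta_ext.
  set n := pickle (true, s, if q is Some i then [:: (i, true)] else [::]) .
  have -> : (if q is Some i then beta true s [:: (i, true)] else beta true s [::]) = b n.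
    by rewrite /n {n}; case: q.
  apply: (ucvg_unique (bE n (pickle (true, s', [::] : Word)))).
  apply: ucvg_lim => e e0; have [N hN] := invS_small e0.
  exists (maxn N (maxn s.+1 s'.+1)) => k; rewrite !geq_max => /and3P[hk hs hs'].
  have -> : @adot R (I k) (usp v) (eta k n) (eta k (pickle (true, s', [::] : Word))) =
      \sum_(y <- ys k) hdot (usp v) (ext v q (y s)) (y s').
    rewrite /n !etaE -base_dot // /adot; apply: eq_bigr => o _.
    by case: (q) => [i|].
  exact: lt_trans (hys k s s' hs hs' q) (hN k hk).
have [J [lJ dJ Ja]] : exists J : usp u -> usp V, [/\ linear J,
    forall x y, hdot (usp V) (J x) (J y) = hdot (usp u) x y &
    forall s, J (a s) = beta true s [::]].
  apply: (isometry_extend ta) => s s'.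
  by have := beta_gram None s s'; rewrite /= mul1r.
(* Words are included in the family, although the [z s] alone are already total, so that the
   intertwining relation for [J1] can be checked on its members. *)
pose y n := if (unpickle n : option (nat * Word)) is Some (s, w) then @word_op v w (z s) else 0.
pose g n := if (unpickle n : option (nat * Word)) is Some (s, w) then beta false s w else 0.
have ty : htotal y.
  apply: htotal_sub (dense_total hz) _ => s; exists (pickle (s, [::] : Word)).
  by rewrite /y pickleK.
have [J1 [lJ1 dJ1 J1y]] : exists J : usp v -> usp V, [/\ linear J,
    forall x x', hdot (usp V) (J x) (J x') = hdot (usp v) x x' &
    forall n, J (y n) = g n].
  apply: (isometry_extend ty) => n m; rewrite /y /g.
  case: (unpickle n) => [[s w]|]; last by rewrite (sd0l sK) (sd0l sv).
  case: (unpickle m) => [[s' w']|]; last by rewrite (sd0r sK) (sd0r sv).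
  apply: (ucvg_unique (bE _ _)).
  rewrite (_ : (fun k => _) = fun _ => hdot (usp v) (word_op w (z s)) (word_op w' (z s'))).
    exact: ucvg_cst.
  apply/funext => k; rewrite !etaE /adot big_option /= big1 ?addr0 // => o _ /=.
  have w0 w1 : @word_op v w1 0 = 0.
    by elim: w1 => //= l w1 IH; rewrite /word_op /= -/(@word_op v w1 0) IH (lin0 (@letter_linear R d v l)).
  by rewrite w0 (sd0l sv).
have vwV : weakly_contained v V.
  apply: (weakly_contained_of_intertwiner lJ1 (dot_isometry dJ1)) => l x.
  have J1b : linear J1 /\ continuous J1.
    apply/bounded_opP; split => //; exists 1 => // x'.
    by rewrite (dot_isometry dJ1) mul1r.
  have mk (f : usp v -> usp V) : linear f -> (forall x, hnorm (f x) = hnorm x) ->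
      linear f /\ continuous f.
    by move=> lf nf; apply/bounded_opP; split => //; exists 1 => // x'; rewrite nf mul1r.
  have : (fun x => J1 (letter v l x)) = (fun x => letter V l (J1 x)).
    apply: (total_eq ty).
    - apply: mk => [k x1 x2|x1]; first by rewrite (@letter_linear R d v l) lJ1.
      by rewrite (dot_isometry dJ1) letter_norm.
    - apply: mk => [k x1 x2|x1]; first by rewrite lJ1 (@letter_linear R d V l).
      by rewrite letter_norm (dot_isometry dJ1).
    - move=> n; rewrite J1y /y /g; case: (unpickle n) => [[s w]|]; last first.
        rewrite (lin0 (@letter_linear R d v l)) (lin0 lJ1).
        by rewrite (lin0 (@letter_linear R d V l)).
      have := J1y (pickle (s, l :: w)); rewrite /y /g !pickleK /= => ->.
      by rewrite beta_letter.
  by move/(congr1 (@^~ x)).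
have [P hP] := isometry_projection lJ dJ.
have Pdot := projection_dot dJ hP.
exists V, J, P; split => //.
- move=> i h; apply/esym.
  have PL : linear P.
    move=> k x x'; apply: hdot_inj => t.
    by rewrite (sd_lin su) !Pdot (sd_lin sK).
  have Pn x : hnorm (P x) <= hnorm x.
    have [->|n0] := eqVneq (hnorm (P x)) 0; first exact: hnorm_ge0.
    have np : 0 < hnorm (P x) by rewrite lt0r n0 hnorm_ge0.
    rewrite -(ler_pM2r np) -expr2 {1}/hnorm (snorm_sqr su) Pdot.
    apply: le_trans (Re_le _) _; apply: le_trans (cauchy_schwarz sK _ _) _.
    by rewrite -![snorm _ _]/(hnorm _) (dot_isometry dJ).
  have : (fun h => P (c%:C *: V i (J h))) = u i.
    apply: (total_eq ta).
    - apply/bounded_opP; split.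
        have lVi : linear (V i) := @letter_linear R d V (i, true).
        by move=> k x x'; rewrite lJ lVi -PL scalerDr !scalerA (mulrC k).
      exists c => [|x]; first exact: ltW.
      apply: le_trans (Pn _) _; rewrite hilbert_normZ normc_real gtr0_norm //.
      by have := letter_norm (i, true) (J x); rewrite /letter /= => ->;
        rewrite (dot_isometry dJ).
    - by have [] := uopP u i.
    - move=> s; apply: (htotal_inj ta) => s'; rewrite Pdot (sdZl sK) !Ja.
      have := beta_gram (Some i) s s'; rewrite /= => ->.
      by rewrite mulrA -rmorphM divff ?mul1r // gt_eqF.
  by move/(congr1 (@^~ h)).
Qed.

Lemma dilates_of_range_incl u v (c : R) : 0 < c -> range_incl c u v -> dilates u v c.
Proof.
move=> c0 /(dilation_exists c0)[V [J [P [[h1 h2] lJ dJ hP hu]]]].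
exists u, V, J, P; split => //.
by split; [exact: usim_refl|exact: usim_of_weakly_contained].
Qed.

(** For an actual dilation, the scaled Gram matrix of [U] at [x] is the Gram matrix of [V] at the
    images of [x] under [J]; the two relations ~ are inclusions with constant 1. *)
Lemma range_incl_of_dilates u v (c : R) : (0 < d)%N -> 0 < c -> dilates u v c ->
  range_incl c u v.
Proof.
move=> d0 c0 [U [V [J [P [[uU vV] lJ dJ hP hU]]]]].
have h1 : range_incl 1 u U by exact: usim_range_incl.
have h2 : range_incl 1 V v by apply: usim_range_incl => //; exact: usim_sym.
suff h : range_incl c U V.
  by have := range_incl_trans h1 (range_incl_trans h h2); rewrite mul1r mulr1.
move=> n x L hL; suff -> : scale_pencil c^-1 (gram U x) = gram V (fun k => J (x k)) by exact: hL.
apply/funext => -[[[i|] j] k]; rewrite /scale_pencil /gram /=; last by rewrite dJ.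
rewrite hU (projection_dot dJ hP) (sdZl (hdot_semidot _)) mulrA -rmorphM.
by rewrite mulVf ?mul1r // gt_eqF.
Qed.

Lemma weakly_contained_trans u v w : weakly_contained u v -> weakly_contained v w ->
  weakly_contained u w.
Proof.
move=> huv hvw a b g M M0 hM.
have [A [gA gB]] : exists A, @gen R d u v a A /\ @gen R d v w A b.
  elim: g {hM} => [l|c f f' g g' _ [A [A1 A2]] _ [A' [A1' A2']]|
      f f' g g' _ [A [A1 A2]] _ [A' [A1' A2']]].
  - by exists (letter v l); split; exact: gen_letter.
  - by exists (c \*: A \+ A'); split; exact: gen_lin.
  - by exists (A \o A'); split; exact: gen_comp.
by apply: (huv _ _ gA) => //; exact: (hvw _ _ gB).
Qed.

(* A unitary dilation of a unitary reduces: [P V J x] has the norm of [V J x],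
   so that [V J x] lies in the range of [J]. *)
Lemma weakly_contained_of_range_incl u v : range_incl 1 u v -> weakly_contained u v.
Proof.
move=> /(dilation_exists ltr01)[V [J [P [[h1 h2] lJ dJ hP hu]]]].
apply: weakly_contained_trans h1; have nJ := dot_isometry dJ.
have su := hdot_semidot (usp u); have sV := hdot_semidot (usp V).
have JV i x : J (u i x) = V i (J x).
  apply/eqP; rewrite -subr_eq0; apply/eqP/hnorm_eq0/eqP.
  rewrite -sqrf_eq0 /hnorm (snormB_sqr sV) -![snorm _ _]/(hnorm _) nJ.
  rewrite (sd_Re_sym sV) -(projection_dot dJ hP).
  have := hu i x; rewrite scale1r => <-.
  have := letter_norm (i, true) x; have := letter_norm (i, true) (J x).
  rewrite /letter /= => -> ->; rewrite nJ -(snorm_sqr su).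
  have := letter_norm (i, true) x; rewrite /letter /= -/(hnorm _) => ->.
  by apply/eqP; ring.
apply: (weakly_contained_of_intertwiner lJ nJ) => -[i []] x; first exact: JV.
have -> : J x = letter V (i, true) (J (letter u (i, false) x)).
  by rewrite -[in LHS](letterK (i, false) x); exact: JV.
by have := letterK (i, true) (J (letter u (i, false) x)) => /= ->.
Qed.

Lemma usim_iff_range_incl u v : (0 < d)%N ->
  usim u v <-> range_incl 1 u v /\ range_incl 1 v u.
Proof.
move=> d0; split=> [h|[h1 h2]].
  by split; apply: usim_range_incl => //; exact: usim_sym.
by apply: usim_of_weakly_contained; exact: weakly_contained_of_range_incl.
Qed.

End Dilation.

(** * Matrix ranges *)

Section MatrixRange.
Context {R : realType} {d : nat}.
Local Notation C := R[i].
Implicit Types u v : utuple R d.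

Definition mx_pencil n (X : 'I_d -> 'M[C]_n) (z : pindex (d := d) n) : C :=
  if z.1.1 is Some i then X i z.1.2 z.2 else (z.1.2 == z.2)%:R.

Lemma ucvg_ge0 (x : nat -> C) l : ucvg x l -> (forall n, 0 <= x n) -> 0 <= l.
Proof.
move=> h x0; rewrite ge0cE; apply/andP; split; last first.
  apply: (ucvg_Re_ge h); apply: (@freeU_tail _ 0%N) => n _ /=.
  by have := x0 n; rewrite ge0cE => /andP[].
rewrite -normr_eq0 eq_le normr_ge0 andbT; apply/ler_addgt0Pr => e e0; rewrite add0r.
have [n /= hn] := freeU_ex (h e e0).
have := x0 n; rewrite ge0cE => /andP[/eqP i0 _].
have := Im_le_normc (x n - l); rewrite ImD ImN i0 sub0r normrN => h1.
exact: ltW (le_lt_trans h1 hn).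
Qed.

Lemma adjoint_mxE n (M : 'M[C]_n) (x y : 'cV[C]_n) :
  (map_mx Num.conj x^T *m M *m y) 0 0 = \sum_j \sum_k conjc (x j 0) * M j k * y k 0.
Proof.
rewrite mxE exchange_big; apply: eq_bigr => k _; rewrite mxE mulr_suml.
by apply: eq_bigr => j _; rewrite !mxE.
Qed.

Lemma delta_form n (M : 'M[C]_n) (a b : C) (j k : 'I_n) :
  (map_mx Num.conj (a *: delta_mx j 0 : 'cV[C]_n)^T *m M *m (b *: delta_mx k 0 : 'cV[C]_n)) 0 0 =
  conjc a * M j k * b.
Proof.
rewrite adjoint_mxE (bigD1 j) //= [X in _ + X]big1 ?addr0 => [|i /negPf ij]; last first.
  by rewrite big1 // => l _; rewrite !mxE ij mulr0 conjc0 !mul0r.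
rewrite (bigD1 k) //= [X in _ + X]big1 ?addr0 => [|i /negPf ik]; last by rewrite !mxE ik !mulr0.
by rewrite !mxE !eqxx !mulr1.
Qed.

Lemma sum_ord2 (F : 'I_2 -> C) : \sum_i F i = F 0 + F 1.
Proof. by rewrite big_ord_recl big_ord1; congr (_ + F _); exact: val_inj. Qed.

Section Ucp.
Variables (u : utuple R d) (n : nat) (phi : (usp u -> usp u) -> 'M[C]_n.+1).
Hypothesis phiP : is_ucp phi.

Lemma ucp_lin (c : C) a b : bounded_op a -> bounded_op b ->
  phi (c \*: a \+ b) = c *: phi a + phi b.
Proof. by have [h _ _] := phiP; exact: h. Qed.

Lemma ucp_unit : phi idfun = 1%:M. Proof. by have [_ h _] := phiP. Qed.

Lemma ucp0 : phi (fun _ => 0) = 0.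
Proof.
have := ucp_lin (-1) (@bounded_op_id _ _) (@bounded_op_id _ (usp u)).
rewrite (_ : -1 \*: idfun \+ idfun = fun _ => 0); last first.
  by apply/funext => x /=; rewrite scaleN1r addNr.
by rewrite scaleN1r addNr.
Qed.

Lemma bounded_op0 : bounded_op (fun _ : usp u => 0 : usp u).
Proof.
have := bounded_op_lin (-1) (@bounded_op_id _ _) (@bounded_op_id _ (usp u)).
congr bounded_op; by apply/funext => x /=; rewrite scaleN1r addNr.
Qed.

Lemma ucpZ (c : C) a : bounded_op a -> phi (fun x => c *: a x) = c *: phi a.
Proof.
move=> ba; have := ucp_lin c ba bounded_op0; rewrite ucp0 addr0 => <-.
by congr phi; apply/funext => x /=; rewrite addr0.
Qed.

Lemma ucpD a b : bounded_op a -> bounded_op b -> phi (fun x => a x + b x) = phi a + phi b.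
Proof.
move=> ba bb; have := ucp_lin 1 ba bb; rewrite scale1r => <-.
by congr phi; apply/funext => x /=; rewrite scale1r.
Qed.

Lemma bounded_opD (a b : usp u -> usp u) : bounded_op a -> bounded_op b ->
  bounded_op (fun x => a x + b x).
Proof.
move=> ba bb; have := bounded_op_lin 1 ba bb; congr bounded_op.
by apply/funext => x /=; rewrite scale1r.
Qed.

Lemma bounded_opZ (c : C) (a : usp u -> usp u) : bounded_op a -> bounded_op (fun x => c *: a x).
Proof.
move=> ba; have := bounded_op_lin c ba bounded_op0; congr bounded_op.
by apply/funext => x /=; rewrite addr0.
Qed.

Lemma ucp_sum (I : Type) (r : seq I) (f : I -> usp u -> usp u) : (forall i, bounded_op (f i)) ->
  bounded_op (fun x => \sum_(i <- r) f i x) /\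
  phi (fun x => \sum_(i <- r) f i x) = \sum_(i <- r) phi (f i).
Proof.
move=> hf; elim: r => [|i r [IH1 IH2]].
  rewrite big_nil (_ : (fun x => _) = fun _ => 0); last by apply/funext => x; rewrite big_nil.
  by split; [exact: bounded_op0|exact: ucp0].
rewrite big_cons (_ : (fun x => _) = fun x => f i x + \sum_(i <- r) f i x); last first.
  by apply/funext => x; rewrite big_cons.
by split; [exact: bounded_opD|rewrite ucpD ?IH2].
Qed.

(* Positivity of the block matrix [[1, u_i], [u_i^*, 1]]. *)
Lemma ucp_block i (y0 y1 : 'cV[C]_n.+1) :
  0 <= (map_mx Num.conj y0^T *m y0) 0 0 + (map_mx Num.conj y0^T *m phi (u i) *m y1) 0 0 +
       ((map_mx Num.conj y1^T *m phi (uinv u i) *m y0) 0 0 + (map_mx Num.conj y1^T *m y1) 0 0).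
Proof.
have [_ _ pos] := phiP; have s := hdot_semidot (usp u).
pose A (j k : 'I_2) : usp u -> usp u := if j == k then idfun else
  if j == 0 then u i else uinv u i.
pose Y (j : 'I_2) := if j == 0 then y0 else y1.
have [ui _] := uopP u i; have [vi adj uK _] := uinvP u i.
have A00 : A 0 0 = idfun by [].
have A11 : A 1 1 = idfun by [].
have A01 : A 0 1 = u i by [].
have A10 : A 1 0 = uinv u i by [].
have Y0 : Y 0 = y0 by [].
have Y1 : Y 1 = y1 by [].
have bA j k : bounded_op (A j k).
  by rewrite /A; case: eqP => _; [exact: bounded_op_id|case: eqP].
have := pos 2%N A bA _ Y; rewrite !sum_ord2 A00 A11 A01 A10 Y0 Y1 ucp_unit !mulmx1; apply.
move=> x; rewrite !sum_ord2 A00 A11 A01 A10.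
have -> : hdot (usp u) (idfun (x 0)) (x 0) + hdot (usp u) (u i (x 1)) (x 0) +
   (hdot (usp u) (uinv u i (x 0)) (x 1) + hdot (usp u) (idfun (x 1)) (x 1)) =
   hdot (usp u) (x 0 + u i (x 1)) (x 0 + u i (x 1)).
  have e : hdot (usp u) (u i (x 1)) (u i (x 1)) = hdot (usp u) (x 1) (x 1).
    exact: (letter_dot (i, true)).
  by rewrite (sdDl s) !(sdDr s) e (adjoint_sym adj) addrACA.
by rewrite (sd_real s) lecR; exact: sd_ge0.
Qed.

(** The block form at [a] times a basis vector and at another basis vector must be real; the values
    a = 1 and a = i give the imaginary and the real parts of the identity. *)
Lemma ucp_adjoint i j k : phi (uinv u i) j k = conjc (phi (u i) k j).
Proof.
have key (a : C) : 0 <= conjc a * a + conjc a * phi (u i) k j + phi (uinv u i) j k * a + 1.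
  have := ucp_block i (a *: delta_mx k 0) (1 *: delta_mx j 0).
  rewrite -[map_mx _ _ *m (a *: _) in X in X -> _](congr1 (mulmx^~ _) (mulmx1 _)).
  rewrite -[map_mx _ _ *m (1 *: _) in X in X -> _](congr1 (mulmx^~ _) (mulmx1 _)).
  by rewrite !delta_form !mxE !eqxx conjc1 !mul1r !mulr1 addrA.
have := key 0; have := key 1; have := key 'i%C.
rewrite !ge0cE => /andP[/eqP h1 _] /andP[/eqP h2 _] _.
apply: complex_ext; move: h1 h2; case: (phi (u i) k j) => a b; case: (phi _ j k) => c e /=; lra.
Qed.

(** The block form at (- phi(u_i) y, y) equals |y|^2 - |phi(u_i) y|^2. *)
Lemma ucp_contraction i (y : 'cV[C]_n.+1) : l2norm (phi (u i) *m y) <= l2norm y.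
Proof.
have l2sqr m (x : 'cV[C]_m) : (map_mx Num.conj x^T *m x) 0 0 = (l2norm x ^+ 2)%:C.
  rewrite mxE sqr_sqrtr; last by apply: sumr_ge0 => j _; exact: sqr_ge0.
  by rewrite rmorph_sum; apply: eq_bigr => j _; rewrite !mxE mulrC mulc_conj.
have := ucp_block i (- (phi (u i) *m y)) y.
rewrite -[map_mx Num.conj _ *m phi (u i) *m _]mulmxA.
set x := phi (u i) *m y.
have adj : (map_mx Num.conj y^T *m phi (uinv u i) *m - x) 0 0 = - (l2norm x ^+ 2)%:C.
  rewrite mulmxN mxE; congr (- _); rewrite -l2sqr; congr (fun_of_matrix (_ *m _) _ _).
  rewrite /x trmx_mul map_mxM; congr (_ *m _).
  by apply/matrixP => j k; rewrite ucp_adjoint !mxE.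
rewrite adj (l2sqr _ y).
have xN : map_mx Num.conj (- x)^T = - map_mx Num.conj x^T by rewrite linearN map_mxN.
have -> : (map_mx Num.conj (- x)^T *m x) 0 0 = - (l2norm x ^+ 2)%:C.
  by rewrite xN mulNmx mxE l2sqr.
have -> : (map_mx Num.conj (- x)^T *m - x) 0 0 = (l2norm x ^+ 2)%:C.
  by rewrite xN mulNmx mulmxN opprK l2sqr.
rewrite subrr add0r -rmorphN -rmorphD lecR => h.
rewrite -(ler_pXn2r (ltn0Sn 1)) ?nnegrE ?sqrtr_ge0 //; lra.
Qed.

End Ucp.

Lemma ext_bounded u q : bounded_op (ext u q) /\ bounded_op (ext (uinv u) q).
Proof.
case: q => [i|]; last by split; exact: bounded_op_id.
by split; [exact: (letter_bounded u (i, true))|exact: (letter_bounded u (i, false))].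
Qed.

Lemma pencil_term_bounded u n (L : pindex n -> C) j k q :
  bounded_op (fun a => (2^-1 : C) *:
    (L (q, j, k) *: ext u q a + conjc (L (q, k, j)) *: ext (uinv u) q a)).
Proof.
have [b1 b2] := ext_bounded u q; by apply: bounded_opZ; apply: bounded_opD; exact: bounded_opZ.
Qed.

Lemma pairing_mx_pencil_ucp u n (phi : (usp u -> usp u) -> 'M[C]_n.+1)
    (L : pindex n.+1 -> C) : is_ucp phi ->
  \sum_j \sum_k phi (@pencil_op R d u n.+1 L j k) j k =
  (pairing L (mx_pencil (fun i => phi (u i))))%:C.
Proof.
move=> phiP; set t := mx_pencil _.
have phi_ext q j k : phi (ext u q) j k = t (q, j, k).
  by case: q => [i|] //=; rewrite (ucp_unit phiP) mxE.
have phi_exti q j k : phi (ext (uinv u) q) j k = conjc (t (q, k, j)).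
  case: q => [i|] /=; first by rewrite (ucp_adjoint phiP).
  by rewrite (ucp_unit phiP) mxE /t /mx_pencil /= conjc_nat eq_sym.
have e j k : phi (@pencil_op R d u n.+1 L j k) j k = \sum_q 2^-1 *
    (L (q, j, k) * t (q, j, k) + conjc (L (q, k, j) * t (q, k, j))).
  have [_ ->] := ucp_sum phiP (index_enum _) (pencil_term_bounded u L j k).
  rewrite summxE; apply: eq_bigr => q _; have [b1 b2] := ext_bounded u q.
  rewrite (ucpZ phiP); last by apply: bounded_opD; exact: bounded_opZ.
  rewrite (ucpD phiP); try exact: bounded_opZ.
  by rewrite !(ucpZ phiP) // !mxE phi_ext phi_exti conjcM.
have -> : \sum_j \sum_k phi (pencil_op L j k) j k = 2^-1 *
    (\sum_z L z * t z + conjc (\sum_z L z * t z)).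
  rewrite conjc_sum !pindex_sum mulrDr [in X in _ + X]exchange_big /= !mulr_sumr.
  rewrite -big_split; apply: eq_bigr => j _ /=; rewrite !mulr_sumr.
  rewrite -big_split; apply: eq_bigr => k _ /=; rewrite e !mulr_sumr.
  by rewrite -big_split; apply: eq_bigr => q _ /=; rewrite mulrDr.
by rewrite addcJ mulrA mulVf ?mul1r // pnatr_eq0.
Qed.

(** Complete positivity is applied to the hermitian operator matrix of the pencil, of the same size
    as [X], and tested on the standard basis: the resulting number is the pairing of the pencil with
    [X]. *)
Lemma matrix_range_dual u n (X : 'I_d -> 'M[C]_n.+1) :
  matrix_range u n X -> dual_to u (mx_pencil X).
Proof.
move=> [phi phiP ->] L hL; have [_ _ pos] := phiP.
have := pos n.+1 (@pencil_op R d u n.+1 L) _ _ (fun j => 1 *: delta_mx j 0).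
under eq_bigr do under eq_bigr do rewrite delta_form conjc1 mul1r mulr1.
rewrite pairing_mx_pencil_ucp // lecR; apply.
  move=> j k; by have [h _] := ucp_sum phiP (index_enum _) (pencil_term_bounded u L j k).
move=> x; have := pencil_op_form L x; rewrite /adot /opm.
under eq_bigr do rewrite (sd_suml (hdot_semidot _)).
by move=> ->; rewrite lecR.
Qed.

(** The maps sending [a] to the matrix of the sums of <a y_k, y_j> over [ys m] are completely
    positive by construction, and their values at the unit and at the [u i] tend to those
    prescribed. Their pointwise ultralimit is the required ucp map, defined at once on all bounded
    operators. *)
Lemma dual_matrix_range u n (X : 'I_d -> 'M[C]_n.+1) :
  dual_to u (mx_pencil X) -> matrix_range u n X.
Proof.
move=> dX; have lu i : linear (u i) by exact: (@letter_linear R d u (i, true)).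
have s := hdot_semidot (usp u).
have /choice[ys hys] (k : nat) : exists ys : seq ('I_n.+1 -> usp u),
    forall z, normc (\sum_(y <- ys) gram u y z - mx_pencil X z) < k.+1%:R^-1.
  exact: dual_approx_gram lu dX _ (invS_gt0 R k).
pose phik (a : usp u -> usp u) j k (m : nat) := \sum_(y <- ys m) hdot (usp u) (a (y k)) (y j).
pose phi (a : usp u -> usp u) : 'M[C]_n.+1 := \matrix_(j, k) ulim (phik a j k).
have phi_cvg a j k : bounded_op a -> ucvg (phik a j k) (phi a j k).
  move=> ba; rewrite mxE; have [M M0 hM] := bounded_op_bound ba.
  (* The diagonal entries at the unit tend to 1 with error below 1; this bounds all values at [a] by
     4 M uniformly in [m]. *)
  have sq j' m : \sum_(y <- ys m) hnorm (y j') ^+ 2 <= 2.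
    have := hys m (None, j', j'); rewrite /gram /mx_pencil /= eqxx => h.
    have := Re_le (\sum_(y <- ys m) hdot (usp u) (y j') (y j') - 1).
    rewrite ReB Re_sum /=; under eq_bigr do rewrite -(snorm_sqr s) -/(hnorm _).
    have := invS_le1 R m.
    by move: h; set A := normc _; set B := _^-1; set D := \sum_(_ <- _) _ => *; lra.
  apply: (@ucvg_ulim _ _ (M * 4)) => m.
  apply: le_trans (normc_sum _ _ _) _.
  apply: (@le_trans _ _ (\sum_(y <- ys m) M * (hnorm (y k) ^+ 2 + hnorm (y j) ^+ 2))).
    apply: ler_sum => y _; apply: le_trans (cauchy_schwarz s _ _) _.
    rewrite -![snorm _ _]/(hnorm _); have := hM (y k).
    have := hnorm_ge0 (y k); have := hnorm_ge0 (y j); have := hnorm_ge0 (a (y k)).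
    set A := hnorm _; set B := hnorm (y j); set D := hnorm (y k) => A0 B0 D0 hA.
    apply: (@le_trans _ _ (M * D * B)); first by rewrite ler_wpM2r.
    rewrite -mulrA ler_wpM2l //; have := sqr_ge0 (D - B); nra.
  rewrite -mulr_sumr ler_wpM2l // big_split /=; have := sq k m; have := sq j m; lra.
have phi_lin (l : C) a b : bounded_op a -> bounded_op b -> phi (l \*: a \+ b) = l *: phi a + phi b.
  move=> ba bb; apply/matrixP => j k; rewrite [RHS]mxE [X in X + _]mxE.
  apply: (ucvg_unique (phi_cvg _ j k (bounded_op_lin l ba bb))).
  have := ucvgD (ucvgZ l (phi_cvg _ j k ba)) (phi_cvg _ j k bb); congr ucvg.
  apply/funext => m; rewrite /phik mulr_sumr -big_split; apply: eq_bigr => y _ /=.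
  by rewrite (sd_lin s).
have lim q j k (a : usp u -> usp u) : bounded_op a -> a = ext u q ->
    phi a j k = mx_pencil X (q, j, k).
  move=> ba ae; apply: (ucvg_unique (phi_cvg _ j k ba)); apply: ucvg_lim => e e0.
  have [N hN] := invS_small e0; exists N => m hm; rewrite /phik ae.
  exact: lt_trans (hys m (q, j, k)) (hN m hm).
exists phi; last first.
  apply/funext => i; apply/matrixP => j k.
  by rewrite (lim (Some i)) //; have [] := uopP u i.
split; first exact: phi_lin.
  apply/matrixP => j k; rewrite (lim None) //; last exact: bounded_op_id.
  by rewrite mxE.
move=> m A bA posA y.
(* For a single family [w], the form of the image matrix at [y] is the form of [A] at these
   combinations, with [y] as coefficients. The argument [p] is a dummy, taken as 0 below. *)
pose xi p (w : 'I_n.+1 -> usp u) (i : 'I_m) := \sum_b y i b p *: w b.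
apply: (@ucvg_ge0 (fun p => \sum_(w <- ys p) \sum_i \sum_j
    hdot (usp u) (A i j (xi 0 w j)) (xi 0 w i))); last first.
  by move=> p; apply: sumr_ge0 => w _; exact: posA.
rewrite (_ : (fun p => _) = fun p => \sum_i \sum_j \sum_a \sum_b
    conjc (y i a 0) * y j b 0 * phik (A i j) a b p); last first.
  apply/funext => p; rewrite exchange_big; apply: eq_bigr => i _.
  rewrite exchange_big; apply: eq_bigr => j _ /=.
  under [RHS]eq_bigr do under eq_bigr do rewrite /phik mulr_sumr.
  under [RHS]eq_bigr do rewrite exchange_big /=.
  rewrite [RHS]exchange_big /=; apply: eq_bigr => w _.
  have lA := bounded_op_linear (bA i j).
  rewrite /xi (lin_sum _ _ _ lA) (sd_sumr s); apply: eq_bigr => a _.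
  rewrite (sd_suml s); apply: eq_bigr => b _.
  by rewrite (linZ _ _ lA) (sdZl s) (sdZr s); ring.
under eq_bigr do under eq_bigr do rewrite adjoint_mxE.
apply: (@ucvg_sum R 'I_m _ (fun i p => \sum_j \sum_a \sum_b
    conjc (y i a 0) * y j b 0 * phik (A i j) a b p)) => i.
apply: (@ucvg_sum R 'I_m _ (fun j p => \sum_a \sum_b
    conjc (y i a 0) * y j b 0 * phik (A i j) a b p)) => j.
apply: (@ucvg_sum R 'I_n.+1 _ (fun a p => \sum_b
    conjc (y i a 0) * y j b 0 * phik (A i j) a b p)) => a.
apply: (@ucvg_sum R 'I_n.+1 _ (fun b p =>
    conjc (y i a 0) * y j b 0 * phik (A i j) a b p)) => b.
rewrite mulrAC; exact: ucvgZ (phi_cvg _ a b (bA i j)).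
Qed.

Lemma matrix_range_iff u n (X : 'I_d -> 'M[C]_n.+1) :
  matrix_range u n X <-> dual_to u (mx_pencil X).
Proof. by split; [exact: matrix_range_dual|exact: dual_matrix_range]. Qed.

End MatrixRange.

(** * Operator norm and trace pairing of matrices *)

Section Matrices.
Context {R : realType}.
Local Notation C := R[i].

Definition cvdot n (x y : 'cV[C]_n) : C := \sum_j x j 0 * conjc (y j 0).

Lemma cvdot_semidot n : semidot (@cvdot n).
Proof.
split=> [a x y z|x y|x].
- rewrite /cvdot mulr_sumr -big_split; apply: eq_bigr => j _; rewrite !mxE /=; ring.
- rewrite /cvdot conjc_sum; apply: eq_bigr => j _.
  by rewrite conjcM conjcK mulrC.
- rewrite /cvdot Re_sum; apply: sumr_ge0 => j _.
  by rewrite mulc_conj /= sqr_ge0.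
Qed.

Lemma l2normE n (x : 'cV[C]_n) : l2norm x = snorm (@cvdot n) x.
Proof.
rewrite /l2norm /snorm /cvdot Re_sum; congr Num.sqrt.
by apply: eq_bigr => j _; rewrite mulc_conj.
Qed.

Lemma l2norm_ge0 n (x : 'cV[C]_n) : 0 <= l2norm x. Proof. exact: sqrtr_ge0. Qed.

Lemma l2normZ n (a : C) (x : 'cV[C]_n) : l2norm (a *: x) = normc a * l2norm x.
Proof. by rewrite !l2normE (snormZ (cvdot_semidot n)). Qed.

Lemma l2norm_entry n (x : 'cV[C]_n) j : normc (x j 0) <= l2norm x.
Proof.
rewrite -[normc _]ger0_norm ?normc_ge0 // -sqrtr_sqr; apply: ler_wsqrtr.
rewrite (bigD1 j) //= lerDl; apply: sumr_ge0 => i _; exact: sqr_ge0.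
Qed.

Lemma l2norm_eq0 n (x : 'cV[C]_n) : l2norm x = 0 -> x = 0.
Proof.
move=> h; apply/matrixP => j k; rewrite ord1 mxE; apply/eqP.
by rewrite -normc_eq0 eq_le normc_ge0 andbT -h l2norm_entry.
Qed.

Lemma l2norm_delta n (j : 'I_n) : l2norm (delta_mx j 0 : 'cV[C]_n) = 1.
Proof.
rewrite /l2norm (bigD1 j) //= !mxE !eqxx Normc.normc1 expr1n big1 ?addr0 ?sqrtr1 //.
by move=> i /negPf ij; rewrite !mxE ij Normc.normc0 expr0n.
Qed.

Lemma l2norm_le_sum n (x : 'cV[C]_n) : l2norm x <= \sum_j normc (x j 0).
Proof.
have {1}-> : x = \sum_j x j 0 *: delta_mx j 0.
  apply/matrixP => j k; rewrite ord1 summxE (bigD1 j) //= !mxE !eqxx mulr1.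
  by rewrite big1 ?addr0 // => i /negPf ij; rewrite !mxE eq_sym ij mulr0.
rewrite l2normE; apply: le_trans (snorm_sum (cvdot_semidot n) _ _ _) _.
by apply: ler_sum => j _; rewrite -l2normE l2normZ l2norm_delta mulr1.
Qed.

Lemma mxopnorm_has_sup n (X : 'M[C]_n) :
  has_sup [set l2norm (X *m y) | y in [set y | l2norm y <= 1]].
Proof.
split; first by exists (l2norm (X *m 0)), 0 => //=; rewrite l2normE (snorm0 (cvdot_semidot n)).
exists (\sum_j \sum_k normc (X j k)) => _ [y /= hy <-].
apply: le_trans (l2norm_le_sum _) _; apply: ler_sum => j _; rewrite mxE.
apply: le_trans (normc_sum _ _ _) _; apply: ler_sum => k _; rewrite Normc.normcM.
by rewrite ler_piMr ?normc_ge0 // (le_trans (l2norm_entry _ _)).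
Qed.

Lemma mxopnorm_mul n (X : 'M[C]_n) (y : 'cV[C]_n) : l2norm (X *m y) <= mxopnorm X * l2norm y.
Proof.
have [y0|y0] := eqVneq (l2norm y) 0.
  by rewrite y0 mulr0 (l2norm_eq0 y0) mulmx0 l2normE (snorm0 (cvdot_semidot n)).
have yp : 0 < l2norm y by rewrite lt0r y0 l2norm_ge0.
have [_ hb] := mxopnorm_has_sup X.
have h : l2norm (X *m ((l2norm y)^-1%:C *: y)) <= mxopnorm X.
  apply: ub_le_sup => //; exists ((l2norm y)^-1%:C *: y) => //=.
  by rewrite l2normZ normc_real ger0_norm ?invr_ge0 ?l2norm_ge0 // mulVf.
move: h; rewrite -scalemxAr l2normZ normc_real ger0_norm ?invr_ge0 ?l2norm_ge0 //.
by rewrite ler_pdivrMl // mulrC.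
Qed.

Lemma mxopnorm_ge0 n (X : 'M[C]_n) : 0 <= mxopnorm X.
Proof.
have [_ hb] := mxopnorm_has_sup X; apply: le_trans (ub_le_sup hb _); first exact: (l2norm_ge0 (X *m 0)).
by exists 0 => //=; rewrite l2normE (snorm0 (cvdot_semidot n)).
Qed.

Lemma mxopnorm_le n (X : 'M[C]_n) (K : R) : 0 <= K ->
  (forall y, l2norm (X *m y) <= K * l2norm y) -> mxopnorm X <= K.
Proof.
move=> K0 h; have [hn _] := mxopnorm_has_sup X; apply: ge_sup => // _ [y /= hy <-].
by apply: le_trans (h y) _; rewrite ler_piMr.
Qed.

Lemma mxopnormN n (X : 'M[C]_n) : mxopnorm (- X) = mxopnorm X.
Proof.
have le (Y : 'M[C]_n) : mxopnorm (- Y) <= mxopnorm Y.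
  apply: mxopnorm_le => [|y]; first exact: mxopnorm_ge0.
  by rewrite mulNmx l2normE (snormN (cvdot_semidot n)) -l2normE mxopnorm_mul.
by apply/eqP; rewrite eq_le le /= -[X in mxopnorm X <= _]opprK le.
Qed.

Lemma mxopnormD n (X Y : 'M[C]_n) : mxopnorm (X + Y) <= mxopnorm X + mxopnorm Y.
Proof.
apply: mxopnorm_le => [|y]; first by rewrite addr_ge0 // mxopnorm_ge0.
rewrite mulmxDl mulrDl l2normE; apply: le_trans (snormD (cvdot_semidot n) _ _) _.
by rewrite -!l2normE lerD // mxopnorm_mul.
Qed.

Lemma mxopnormZ_le n (c : R) (X : 'M[C]_n) : 0 <= c -> mxopnorm (c%:C *: X) <= c * mxopnorm X.
Proof.
move=> c0; apply: mxopnorm_le => [|y]; first by rewrite mulr_ge0 // mxopnorm_ge0.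
by rewrite -scalemxAl l2normZ normc_real ger0_norm // -mulrA ler_wpM2l // mxopnorm_mul.
Qed.

Definition qform n (M : 'M[C]_n) (x : 'I_n -> C) : C := \sum_j \sum_k conjc (x j) * M j k * x k.

Lemma qform_mxopnorm n (E : 'M[C]_n) (x : 'I_n -> C) :
  normc (qform E x) <= mxopnorm E * \sum_j normc (x j) ^+ 2.
Proof.
pose y : 'cV[C]_n := \col_j x j.
have -> : qform E x = cvdot (E *m y) y.
  rewrite /qform /cvdot; apply: eq_bigr => j _; rewrite !mxE mulr_suml.
  by apply: eq_bigr => k _; rewrite !mxE; ring.
have -> : \sum_j normc (x j) ^+ 2 = l2norm y ^+ 2.
  rewrite sqr_sqrtr; last by apply: sumr_ge0 => j _; exact: sqr_ge0.
  by apply: eq_bigr => j _; rewrite mxE.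
apply: le_trans (cauchy_schwarz (cvdot_semidot n) _ _) _.
by rewrite -!l2normE expr2 mulrA ler_wpM2r ?l2norm_ge0 // mxopnorm_mul.
Qed.

(* Expand [M] in an orthonormal eigenbasis [f]: the trace pairing of [M] and [E]
   is the sum of the [<M f, f> <E f, f>]. *)
Lemma hermitian_pairing_bound n (M L E : 'M[C]_n) (k e : R) :
  map_mx Num.conj M^T = M -> 0 <= k -> 0 <= e ->
  (forall x, normc (qform M x) <= k * Re (qform L x)) ->
  (forall x, normc (qform E x) <= e * \sum_j normc (x j) ^+ 2) ->
  normc (\sum_i \sum_j M i j * E i j) <= k * e * Re (\sum_i L i i).
Proof.
move=> hM k0 e0 hML hE.
have /orthomx_spectralP eM : M \is normalmx by apply/normalmxP; rewrite hM.
set P := spectralmx M in eM; set sp := spectral_diag M in eM.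
have uP : P \is unitarymx by exact: spectral_unitarymx.
have PPs : P *m map_mx Num.conj P^T = 1%:M by exact/unitarymxP.
have PsP : map_mx Num.conj P^T *m P = 1%:M by exact: mulmx1C.
rewrite (invmx_unitary uP) in eM.
have MP : P *m M *m map_mx Num.conj P^T = diag_mx sp.
  by rewrite [in LHS]eM !mulmxA PPs mul1mx -mulmxA PPs mulmx1.
have spE l : sp 0 l = qform M (fun j => conjc (P l j)).
  have /matrixP /(_ l l) := MP; rewrite [RHS]mxE eqxx mulr1n => <-.
  rewrite mxE /qform exchange_big; apply: eq_bigr => j _; rewrite mxE mulr_suml.
  by apply: eq_bigr => i _; rewrite !mxE conjcK.
have -> : \sum_i \sum_j M i j * E i j = \sum_l sp 0 l * qform E (fun j => P l j).
  have Mij i j : M i j = \sum_l conjc (P l i) * sp 0 l * P l j.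
    rewrite {1}eM mxE; apply: eq_bigr => l _; rewrite mul_mx_diag !mxE //.
  under eq_bigr do under eq_bigr do rewrite Mij mulr_suml.
  under eq_bigr do rewrite exchange_big /=.
  rewrite exchange_big; apply: eq_bigr => l _; rewrite /qform mulr_sumr.
  apply: eq_bigr => i _; rewrite mulr_sumr; apply: eq_bigr => j _; ring.
have row1 l : \sum_j normc (P l j) ^+ 2 = 1.
  have /matrixP /(_ l l) := PPs; rewrite !mxE eqxx => /(congr1 (@complex.Re R)) /= <-.
  rewrite Re_sum; apply: eq_bigr => j _; rewrite !mxE.
  by have := mulc_conj (P l j) => /= ->.
have <- : Re (\sum_l qform L (fun j => conjc (P l j))) = Re (\sum_i L i i).
  congr Re; rewrite /qform exchange_big; apply: eq_bigr => i _ /=.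
  rewrite exchange_big (bigD1 i) //= [X in _ + X]big1 ?addr0 => [|j ji].
    transitivity (L i i * (map_mx Num.conj P^T *m P) i i); last by rewrite PsP mxE eqxx mulr1.
    rewrite [in RHS]mxE mulr_sumr; apply: eq_bigr => l _; rewrite !mxE conjcK.
    by rewrite -[Num.conj _]/(conjc _); ring.
  transitivity (L i j * (map_mx Num.conj P^T *m P) j i).
    rewrite [in RHS]mxE mulr_sumr; apply: eq_bigr => l _; rewrite !mxE conjcK.
    by rewrite -[Num.conj _]/(conjc _); ring.
  by rewrite PsP mxE (negPf ji) mulr0.
rewrite Re_sum mulr_sumr.
apply: le_trans (normc_sum _ _ _) _; apply: ler_sum => l _; rewrite Normc.normcM mulrAC.
apply: ler_pM; rewrite ?normc_ge0 //; first by rewrite spE; exact: hML.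
by have := hE (fun j => P l j); rewrite row1 mulr1.
Qed.

(** [M] is A(1) + i A(-i), where A(a) is the hermitian part of a M. Both parts inherit the bound on
    quadratic forms, and their sum accounts for the factor 2. *)
Lemma pairing_bound n (M L E : 'M[C]_n) (k e : R) : 0 <= k -> 0 <= e ->
  (forall x, normc (qform M x) <= k * Re (qform L x)) ->
  (forall x, normc (qform E x) <= e * \sum_j normc (x j) ^+ 2) ->
  normc (\sum_i \sum_j M i j * E i j) <= 2 * (k * e * Re (\sum_i L i i)).
Proof.
move=> k0 e0 hML hE.
pose A (a : C) : 'M[C]_n := \matrix_(i, j) (2^-1 * (a * M i j + conjc (a * M j i))).
have half : conjc (2^-1 : C) = 2^-1 by rewrite conjc_inv conjc_nat.
have hA a : map_mx Num.conj (A a)^T = A a.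
  apply/matrixP => i j; rewrite !mxE.
  rewrite -[LHS]/(conjc _) (conjcM (2^-1)) half (conjcD (a * _)) conjcK addrC //.
have qA a x : qform (A a) x = (Re (a * qform M x))%:C.
  have -> : qform (A a) x = 2^-1 * (a * qform M x + conjc (a * qform M x)).
    rewrite conjcM /qform conjc_sum mulrDr !mulr_sumr [X in _ = _ + X](_ : _ =
      \sum_i \sum_j 2^-1 * conjc a * (conjc (x i) * conjc (M j i) * x j)).
      rewrite -big_split; apply: eq_bigr => i _; rewrite !mulr_sumr -big_split.
      by apply: eq_bigr => j _; rewrite mxE conjcM /=; ring.
    rewrite exchange_big; apply: eq_bigr => i _ /=.
    rewrite conjc_sum !mulr_sumr; apply: eq_bigr => j _.
    by rewrite !conjcM conjcK; ring.
  by rewrite addcJ mulrA mulVf ?mul1r // pnatr_eq0.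
have hAL a : normc a = 1 -> normc (\sum_i \sum_j A a i j * E i j) <= k * e * Re (\sum_i L i i).
  move=> a1; apply: hermitian_pairing_bound => // x.
  rewrite qA normc_real; apply: le_trans (Re_le_normc _) _.
  by rewrite Normc.normcM a1 mul1r.
have -> : \sum_i \sum_j M i j * E i j =
    \sum_i \sum_j A 1 i j * E i j + 'i%C * \sum_i \sum_j A (- 'i%C) i j * E i j.
  rewrite mulr_sumr -big_split; apply: eq_bigr => i _ /=; rewrite mulr_sumr -big_split.
  apply: eq_bigr => j _ /=; rewrite !mxE !mul1r.
  have e1 : M i j = 2^-1 * (M i j + conjc (M j i)) +
      'i%C * (2^-1 * (- 'i%C * M i j + conjc (- 'i%C * M j i))).
    have i2 : 'i%C * 'i%C = -1 :> C by rewrite -expr2 sqr_i.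
    have ic : conjc (- 'i%C : C) = 'i%C by apply: complex_ext => /=; ring.
    have h2 : (2 : C) != 0 by rewrite pnatr_eq0.
    rewrite conjcM ic.
    have -> : 'i%C * (2^-1 * (- 'i%C * M i j + 'i%C * conjc (M j i))) =
       2^-1 * (- ('i%C * 'i%C) * M i j + ('i%C * 'i%C) * conjc (M j i)) by ring.
    by rewrite i2; field.
  by rewrite {1}e1; ring.
apply: le_trans (normcD _ _) _; rewrite Normc.normcM.
have ni : normc ('i%C : C) = 1 by rewrite /= expr0n expr1n add0r sqrtr1.
have := hAL 1 (Normc.normc1 R); have := hAL (- 'i%C); rewrite normcN ni mul1r => /(_ erefl).
lra.
Qed.

End Matrices.

Section GramSchmidt.
Context {R : realType}.
Local Notation C := R[i].
Variable H : hilbert R.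

(* [h0] makes the orthonormal family nonempty when all [x k] vanish. *)
Lemma gram_schmidt (h0 : H) : h0 != 0 -> forall m (x : 'I_m -> H),
  exists n (e : 'I_n.+1 -> H) (s : 'I_m -> 'I_n.+1 -> C),
    (forall j k, hdot H (e j) (e k) = (j == k)%:R) /\
    forall k, x k = \sum_l s k l *: e l.
Proof.
have sH := hdot_semidot H.
have unit x : x != 0 -> hdot H ((hnorm x)^-1%:C *: x) ((hnorm x)^-1%:C *: x) = 1.
  move=> x0; have n0 : hnorm x != 0 by apply: contraNneq x0 => /hnorm_eq0 ->.
  rewrite (sdZl sH) (sdZr sH) conjc_real (sd_real sH) -(snorm_sqr sH) -/(hnorm x).
  by rewrite -!rmorphM /= (_ : _ * _ = 1) //; field.
move=> h00; elim=> [|m IH] x.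
  exists 0%N, (fun _ => (hnorm h0)^-1%:C *: h0), (fun _ _ => 0); split; last by case.
  by move=> j k; rewrite !ord1 eqxx unit.
have [n [e [s [he hx]]]] := IH (fun k => x (lift ord0 k)).
pose r := x ord0 - \sum_l hdot H (x ord0) (e l) *: e l.
have re l : hdot H r (e l) = 0.
  rewrite (sdBl sH) (sd_suml sH) (bigD1 l) //= (sdZl sH) he eqxx mulr1.
  rewrite big1 ?addr0 ?subrr // => k /negPf kl.
  by rewrite (sdZl sH) he kl mulr0.
have [r0|r0] := eqVneq r 0.
  exists n, e, (fun k => if unlift ord0 k is Some k' then s k' else fun l => hdot H (x ord0) (e l)).
  split => // k; case: unliftP => [k' ->|->]; first exact: hx.
  by apply/eqP; rewrite -subr_eq0; apply/eqP.
exists n.+1, (fun l => if unlift ord0 l is Some l' then e l' else (hnorm r)^-1%:C *: r).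
exists (fun k l => match unlift ord0 k, unlift ord0 l with
  | Some k', Some l' => s k' l'
  | Some k', None => 0
  | None, Some l' => hdot H (x ord0) (e l')
  | None, None => (hnorm r)%:C end); split.
  move=> j k; case: unliftP => [j' ->|->]; case: unliftP => [k' ->|->].
  - by rewrite he (inj_eq lift_inj).
  - rewrite (sdZr sH) (sd_herm sH r) re conjc0 mulr0.
    by rewrite eq_sym (negPf (neq_lift _ _)).
  - by rewrite (sdZl sH) re mulr0 (negPf (neq_lift _ _)).
  - by rewrite unit // eqxx.
have n0 : hnorm r != 0 by apply: contraNneq r0 => /hnorm_eq0 ->.
move=> k; rewrite big_ord_recl unlift_none; under eq_bigr do rewrite liftK.
case: unliftP => [k' ->|->]; first by rewrite scale0r add0r; exact: hx.
rewrite scalerA -rmorphM divff // scale1r /r subrK //.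
Qed.

End GramSchmidt.

(** * Change of vectors in Gram matrices *)

Section Pull.
Context {R : realType} {d : nat}.
Local Notation C := R[i].
Local Notation pindex := (pindex (d := d)).

(** The effect on a Gram matrix of replacing the vectors by their combinations with coefficients
    [s]; [push] is the transposed operation on pencils. *)
Definition pull m n (s : 'I_m -> 'I_n -> C) (t : pindex n -> C) (z : pindex m) : C :=
  \sum_l' \sum_l s z.2 l * conjc (s z.1.2 l') * t (z.1.1, l', l).

Definition push m n (s : 'I_m -> 'I_n -> C) (L : pindex m -> C) (z : pindex n) : C :=
  \sum_j \sum_k L (z.1.1, j, k) * (s k z.2 * conjc (s j z.1.2)).

Lemma pairing_push m n (s : 'I_m -> 'I_n -> C) (L : pindex m -> C) (t : pindex n -> C) :
  pairing (push s L) t = pairing L (pull s t).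
Proof.
have sumE n' (F : pindex n' -> C) : \sum_z F z = \sum_q \sum_j \sum_k F (q, j, k).
  by rewrite !pair_bigA; apply: eq_bigr => -[[q j] k].
rewrite /pairing !sumE; congr Re; apply: eq_bigr => q _.
transitivity (\sum_l' \sum_l \sum_j \sum_k
  L (q, j, k) * (s k l * conjc (s j l') * t (q, l', l))).
  apply: eq_bigr => l' _; apply: eq_bigr => l _; rewrite /push mulr_suml.
  by apply: eq_bigr => j _; rewrite mulr_suml; apply: eq_bigr => k _ /=; ring.
under eq_bigr do rewrite exchange_big /=.
rewrite exchange_big; apply: eq_bigr => j _ /=.
under eq_bigr do rewrite exchange_big /=.
rewrite exchange_big; apply: eq_bigr => k _ /=.
by rewrite /pull mulr_sumr; apply: eq_bigr => l' _; rewrite mulr_sumr.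
Qed.

Lemma gram_comb (H : hilbert R) (A : 'I_d -> H -> H) m n (s : 'I_m -> 'I_n -> C) (e : 'I_n -> H) :
  (forall i, linear (A i)) ->
  gram A (fun k => \sum_l s k l *: e l) = pull s (gram A e).
Proof.
move=> lA; have sH := hdot_semidot H; apply/funext => -[[q j] k]; rewrite /gram /pull /=.
have le : linear (ext A q) by case: q => [i|] /=; [exact: lA|move=> a x y].
rewrite (lin_sum _ _ _ le) (sd_suml sH) exchange_big; apply: eq_bigr => l _ /=.
rewrite (sd_sumr sH); apply: eq_bigr => l' _.
by rewrite (linZ _ _ le) (sdZl sH) (sdZr sH); ring.
Qed.

Lemma dual_pull (H : hilbert R) (A : 'I_d -> H -> H) m n (s : 'I_m -> 'I_n -> C) t :
  (forall i, linear (A i)) -> dual_to A t -> dual_to A (pull s t).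
Proof.
move=> lA ht L hL; rewrite -pairing_push; apply: ht => y.
by rewrite pairing_push -gram_comb.
Qed.

Lemma push_pos (H : hilbert R) (A : 'I_d -> H -> H) m n (s : 'I_m -> 'I_n -> C) L :
  (forall i, linear (A i)) -> (forall x, 0 <= pairing L (gram A x)) ->
  forall x, 0 <= pairing (push s L) (gram A x).
Proof. by move=> lA hL x; rewrite pairing_push -gram_comb. Qed.

Lemma pull_scale m n (s : 'I_m -> 'I_n -> C) (c : R) (t : pindex n -> C) :
  pull s (scale_pencil c t) = scale_pencil c (pull s t).
Proof.
apply/funext => -[[[i|] j] k] //; rewrite /pull /scale_pencil /= mulr_sumr.
by apply: eq_bigr => l' _; rewrite mulr_sumr; apply: eq_bigr => l _; ring.
Qed.

Lemma scale_mx_pencil n (c : R) (X : 'I_d -> 'M[C]_n) :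
  scale_pencil c (mx_pencil X) = mx_pencil (fun i => c%:C *: X i).
Proof. by apply/funext => -[[[i|] j] k] //; rewrite /scale_pencil /mx_pencil /= mxE. Qed.

Lemma tuple_linear (u : utuple R d) i : linear (u i).
Proof. exact: (@letter_linear R d u (i, true)). Qed.

Lemma matrix_range_scale (u v : utuple R d) (c : R) n (X : 'I_d -> 'M[C]_n.+1) :
  range_incl c u v -> matrix_range u n X -> matrix_range v n (fun i => c^-1%:C *: X i).
Proof.
move=> huv /matrix_range_iff hX; apply/matrix_range_iff => L hL.
rewrite -scale_mx_pencil -pairing_scale; apply: hX => x.
by rewrite pairing_scale; exact: huv.
Qed.

(** Gram-Schmidt expresses arbitrary vectors through orthonormal ones, for which the Gram matrix is
    a compression of [u], hence a point of its matrix range; [pull] carries the inclusion back. *)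
Lemma range_incl_of_matrix_range (u v : utuple R d) (c : R) :
  (forall n (X : 'I_d -> 'M[C]_n.+1), matrix_range u n X ->
     dual_to v (scale_pencil c^-1 (mx_pencil X))) -> range_incl c u v.
Proof.
move=> h m x.
(* On the zero space there is no orthonormal family, but all Gram matrices vanish. *)
have [[h0 h00]|H0] := pselect (exists h0 : usp u, h0 != 0); last first.
  move=> L _; rewrite /pairing big1 // => -[[q j] k] _.
  have -> : gram u x = fun _ => 0.
    apply/funext => -[[q' j'] k']; rewrite /gram /=.
    have -> : x j' = 0 by apply/eqP/negPn/negP => xj; apply: H0; exists (x j').
    exact: (sd0r (hdot_semidot _)).
  by rewrite /scale_pencil /=; case: q => *; rewrite !mulr0.
have [n [e [s [he hx]]]] := gram_schmidt h00 x.
have -> : x = fun k => \sum_l s k l *: e l by apply/funext.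
rewrite gram_comb; last exact: tuple_linear.
rewrite -pull_scale; apply: dual_pull; first exact: tuple_linear.
pose X i : 'M[C]_n.+1 := \matrix_(j, k) hdot (usp u) (u i (e k)) (e j).
have eX : gram u e = mx_pencil X.
  apply/funext => -[[[i|] j] k]; rewrite /gram /mx_pencil /= ?mxE //.
  by rewrite he eq_sym.
rewrite eX; apply: h; apply/matrix_range_iff; rewrite -eX => L; exact.
Qed.

End Pull.

(** * Comparison of the metrics *)

Section Estimates.
Context {R : realType} {d : nat}.
Local Notation C := R[i].
Local Notation pindex := (pindex (d := d)).
Implicit Types u v w : utuple R d.

Definition coeff n (L : pindex n -> C) (q : option 'I_d) : 'M[C]_n := \matrix_(j, k) L (q, j, k).

Definition trace_term n (L : pindex n -> C) : R := Re (\sum_j L (None, j, j)).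

Definition linear_term n (L : pindex n -> C) (X : 'I_d -> 'M[C]_n) : R :=
  Re (\sum_i \sum_j \sum_k L (Some i, j, k) * X i j k).

Lemma pairing_mx_pencil n (L : pindex n -> C) X :
  pairing L (mx_pencil X) = trace_term L + linear_term L X.
Proof.
rewrite /pairing -ReD pindex_sum; congr Re.
transitivity (\sum_j \sum_k (L (None, j, k) * (j == k)%:R) +
    \sum_j \sum_k \sum_i L (Some i, j, k) * X i j k).
  rewrite -big_split; apply: eq_bigr => j _; rewrite -big_split; apply: eq_bigr => k _.
  by rewrite big_option.
congr (_ + _).
  apply: eq_bigr => j _; rewrite (bigD1 j) //= eqxx mulr1 big1 ?addr0 // => k.
  by rewrite eq_sym => /negPf ->; rewrite mulr0.
under eq_bigr do rewrite exchange_big /=.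
by rewrite exchange_big.
Qed.

Lemma linear_termB n (L : pindex n -> C) X Y :
  linear_term L (fun i => X i - Y i) = linear_term L X - linear_term L Y.
Proof.
rewrite /linear_term -ReB -sumrB; congr Re; apply: eq_bigr => i _; rewrite -sumrB.
apply: eq_bigr => j _; rewrite -sumrB; apply: eq_bigr => k _.
by rewrite !mxE mulrBr.
Qed.

Lemma linear_termZ n (L : pindex n -> C) (c : R) X :
  linear_term L (fun i => c%:C *: X i) = c * linear_term L X.
Proof.
rewrite /linear_term -ReZ; congr Re; rewrite mulr_sumr; apply: eq_bigr => i _.
rewrite mulr_sumr; apply: eq_bigr => j _; rewrite mulr_sumr; apply: eq_bigr => k _.
by rewrite !mxE mulrCA.
Qed.

Lemma push_qform n (xi : 'I_n -> C) (L : pindex n -> C) q :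
  push (n := 1) (fun k _ => xi k) L (q, 0, 0) = qform (coeff L q) xi.
Proof.
by apply: eq_bigr => j _; apply: eq_bigr => k _; rewrite mxE /=; ring.
Qed.

Lemma trace_term1 (L : pindex 1 -> C) : trace_term L = Re (L (None, 0, 0)).
Proof. by rewrite /trace_term big_ord1. Qed.

Lemma linear_term1 (L : pindex 1 -> C) X :
  linear_term L X = Re (\sum_i L (Some i, 0, 0) * X i 0 0).
Proof. by rewrite /linear_term; congr Re; apply: eq_bigr => i _; rewrite !big_ord1. Qed.

Definition axis (i : 'I_d) (a : C) (i' : 'I_d) : 'M[C]_1 := (if i' == i then a else 0)%:M.

Lemma axis_range v (delta : R) i a : U_ delta v -> normc a < delta -> matrix_range v 0 (axis i a).
Proof.
move=> hv ha; have := hv (a *: delta_mx i 0).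
rewrite (_ : (fun i' => _) = axis i a); last first.
  apply/funext => i'; congr (_%:M); rewrite !mxE eqxx andbT.
  by case: eqP => _; rewrite ?mulr1 ?mulr0.
by apply; rewrite l2normZ l2norm_delta mulr1.
Qed.

Lemma U_range0 v (delta : R) : 0 < delta -> U_ delta v -> matrix_range v 0 (fun=> 0).
Proof.
move=> d0 /(_ 0); rewrite (_ : (fun i => _) = fun=> 0); last first.
  by apply/funext => i; rewrite mxE raddf0.
by apply; rewrite l2normE (snorm0 (cvdot_semidot _)).
Qed.

Lemma linear_term_axis (L : pindex 1 -> C) i a :
  linear_term L (axis i a) = Re (L (Some i, 0, 0) * a).
Proof.
rewrite linear_term1 (bigD1 i) //= /axis mxE !eqxx mulr1n big1 ?addr0 // => j /negPf ->.
by rewrite mxE eqxx mulr0.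
Qed.

Lemma phase (z : C) (t : R) : 0 <= t ->
  exists2 a : C, normc a <= t & Re (z * a) = - (t * normc z).
Proof.
move=> t0; have [z0|z0] := eqVneq z 0.
  by exists 0; rewrite ?Normc.normc0 // z0 Normc.normc0 !mulr0 oppr0.
have n0 : 0 < normc z by rewrite lt0r normc_ge0 normc_eq0 z0.
exists ((- (t / normc z))%:C * conjc z).
  rewrite Normc.normcM normc_conj normc_real normrN ger0_norm; last by rewrite divr_ge0 // ltW.
  by rewrite divfK // gt_eqF.
rewrite mulrCA mulc_conj -rmorphM /= mulNr expr2 mulrA divfK // gt_eqF //.
Qed.

(** Evaluating the pencil at a point of modulus t on the i-th axis, with the worst phase, gives t
    |L_i| <= Re L_0 for all t < delta. The ball being open, a value strictly between r / l and
    [delta] is used to contradict the failure of the bound. *)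
Lemma level_one_bound v (delta : R) (L : pindex 1 -> C) i : 0 < delta -> U_ delta v ->
  (forall x, 0 <= pairing L (gram v x)) ->
  delta * normc (L (Some i, 0, 0)) <= Re (L (None, 0, 0)).
Proof.
move=> d0 hv hL; rewrite leNgt; apply/negP => neg.
pose l := normc (L (Some i, 0, 0)); pose r := Re (L (None, 0, 0)).
have key t : 0 <= t -> t < delta -> t * l <= r.
  move=> t0 td; have [a ha hz] := phase (L (Some i, 0, 0)) t0.
  have /matrix_range_iff /(_ L hL) := axis_range i hv (le_lt_trans ha td).
  by rewrite pairing_mx_pencil trace_term1 linear_term_axis hz -/l -/r subr_ge0.
have r0 : 0 <= r by have := key 0 (lexx _) d0; rewrite mul0r.
have l0 : 0 < l.
  by rewrite lt0r normc_ge0 andbT; apply: contraTneq neg => e; rewrite -leNgt -/l e mulr0.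
have rl : r / l < delta by rewrite ltr_pdivrMr.
have := key ((r / l + delta) / 2).
have rl0 : 0 <= r / l by rewrite divr_ge0 // ltW.
have h1 : 0 <= (r / l + delta) / 2 by lra.
have h2 : (r / l + delta) / 2 < delta by lra.
move=> /(_ h1 h2); rewrite -ler_pdivlMr //; lra.
Qed.

(** Compressing the pencil along the vector [xi] by [push] gives a scalar pencil, still positive on
    [v], to which the level-one bound applies. *)
Lemma qform_bound v (delta : R) n (L : pindex n -> C) i xi : 0 < delta -> U_ delta v ->
  (forall x, 0 <= pairing L (gram v x)) ->
  normc (qform (coeff L (Some i)) xi) <= delta^-1 * Re (qform (coeff L None) xi).
Proof.
move=> d0 hv hL; rewrite ler_pdivlMl // -!push_qform; apply: level_one_bound hv _ => //.
exact: push_pos (@tuple_linear _ _ v) hL.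
Qed.

(** Here [d] counts the coefficients, 1 / delta bounds each of them relative to the coefficient of
    the unit, and 2 comes from splitting a coefficient into two hermitian parts. *)
Definition slope (delta : R) : R := 2 * d%:R / delta.

Lemma slope_ge0 (delta : R) : 0 < delta -> 0 <= slope delta.
Proof. by move=> /ltW d0; rewrite divr_ge0 // mulr_ge0 // ler0n. Qed.

Lemma slope_gt0 (delta : R) : (0 < d)%N -> 0 < delta -> 0 < slope delta.
Proof. by move=> d1 d0; rewrite divr_gt0 ?mulr_gt0 ?ltr0n. Qed.

Section Positive.
Variables (v : utuple R d) (delta : R) (n : nat) (L : pindex n -> C).
Hypotheses (d0 : 0 < delta) (hv : U_ delta v) (hL : forall x, 0 <= pairing L (gram v x)).

Lemma linear_term_bound (E : 'I_d -> 'M[C]_n) (e : R) : 0 <= e ->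
  (forall i, mxopnorm (E i) <= e) ->
  `|linear_term L E| <= slope delta * e * trace_term L.
Proof.
move=> e0 hE.
apply: le_trans (Re_le_normc _) _; apply: le_trans (normc_sum _ _ _) _.
have -> : slope delta * e * trace_term L =
    \sum_(i < d) 2 * (delta^-1 * e * Re (\sum_j coeff L None j j)).
  rewrite sumr_const card_ord -mulr_natl (_ : \sum_j coeff L None j j = \sum_j L (None, j, j)).
    by rewrite /slope /trace_term; ring.
  by apply: eq_bigr => j _; rewrite mxE.
apply: ler_sum => i _.
have := @pairing_bound _ n (coeff L (Some i)) (coeff L None) (E i) delta^-1 e.
rewrite (_ : \sum_j \sum_k coeff L (Some i) j k * _ = \sum_j \sum_k L (Some i, j, k) * E i j k).
  apply => //; first by rewrite invr_ge0 ltW.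
    by move=> xi; apply: qform_bound hv hL.
  move=> xi; apply: le_trans (qform_mxopnorm _ _) _; apply: ler_wpM2r => //.
  by apply: sumr_ge0 => j _; exact: sqr_ge0.
by apply: eq_bigr => j _; apply: eq_bigr => k _; rewrite mxE.
Qed.

(** Pushed along each basis vector, the pencil is evaluated at 0, which belongs to the first level:
    every diagonal entry of the constant coefficient has nonnegative real part. *)
Lemma trace_term_ge0 : 0 <= trace_term L.
Proof.
rewrite /trace_term Re_sum; apply: sumr_ge0 => j _.
pose s (k : 'I_n) (_ : 'I_1) : C := (k == j)%:R.
have /matrix_range_iff /(_ _ (push_pos (m := n) s (@tuple_linear _ _ v) hL)) := U_range0 d0 hv.
rewrite pairing_mx_pencil trace_term1 (linear_term1 _ (fun _ => 0)) big1 ?addr0; last first.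
  by move=> i _; rewrite mxE mulr0.
rewrite /push (bigD1 j) //= (bigD1 j) //= /s eqxx conjc1 !mulr1.
rewrite big1 ?addr0 => [|k /negPf ->]; last by rewrite mul0r mulr0.
rewrite big1 ?addr0 // => k /negPf kj; rewrite big1 // => l _.
by rewrite kj conjc0 !mulr0.
Qed.

End Positive.

Lemma mxopnorm_range u n X i : matrix_range u n X -> mxopnorm (X i) <= 1.
Proof.
move=> [phi phiP ->]; apply: mxopnorm_le => // y.
by rewrite mul1r; exact: ucp_contraction.
Qed.

Lemma tuple_dist_le n (X Y : 'I_d -> 'M[C]_n) (K : R) : 0 <= K ->
  (tuple_dist X Y <= K) <-> (forall i, mxopnorm (X i - Y i) <= K).
Proof.
move=> K0; split=> [h i|h]; first by apply: le_trans h; rewrite /tuple_dist; exact: le_bigmax.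
by apply: bigmax_le.
Qed.

Lemma tuple_dist_ge0 n (X Y : 'I_d -> 'M[C]_n) : 0 <= tuple_dist X Y.
Proof. by rewrite /tuple_dist; elim/big_rec: _ => // i x _ x0; rewrite le_max x0 orbT. Qed.

Lemma tuple_distC n (X Y : 'I_d -> 'M[C]_n) : tuple_dist X Y = tuple_dist Y X.
Proof. by apply: eq_bigr => i _; rewrite -mxopnormN opprB. Qed.

Lemma tuple_dist_triangle n (X Y Z : 'I_d -> 'M[C]_n) :
  tuple_dist X Z <= tuple_dist X Y + tuple_dist Y Z.
Proof.
apply/tuple_dist_le; first by rewrite addr_ge0 // tuple_dist_ge0.
move=> i; rewrite -[X i](subrK (Y i)) -addrA.
apply: le_trans (mxopnormD _ _) _.
by apply: lerD; apply/tuple_dist_le: i => //; exact: tuple_dist_ge0.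
Qed.

(** One half of a Hausdorff bound. The slack [e] reflects that [hausdorff] is defined through
    infima, for which no attainment is required. *)
Definition near_range (r : R) u v :=
  forall n X, matrix_range u n X -> forall e : R, 0 < e ->
  exists2 Y, matrix_range v n Y & tuple_dist X Y < r + e.

(** Matrix ranges of unitaries consist of contractions, and a positive pencil of [v] varies on
    contractions by at most [slope delta] times its value at 0. This a priori inclusion is what
    makes the dilation constants finite. *)
Lemma range_incl_U (delta : R) u v : (0 < d)%N -> 0 < delta -> U_ delta v ->
  range_incl (slope delta) u v.
Proof.
move=> d1 d0 hv; have s0 := slope_gt0 d1 d0.
apply: range_incl_of_matrix_range => n X hX L hL.
rewrite scale_mx_pencil pairing_mx_pencil linear_termZ.
have := linear_term_bound d0 hv hL ler01 (fun i => mxopnorm_range i hX).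
rewrite mulr1 ler_norml => /andP[h _].
have : - trace_term L <= (slope delta)^-1 * linear_term L X.
  by rewrite ler_pdivlMl // mulrN.
lra.
Qed.

Lemma range_incl_near (delta r : R) u v : 0 < delta -> 0 <= r -> U_ delta v ->
  near_range r u v -> range_incl (1 + slope delta * r) u v.
Proof.
move=> d0 r0 hv huv; have s0 := slope_ge0 d0.
set c := 1 + _; have c1 : 1 <= c by rewrite lerDl mulr_ge0.
have c0 : 0 < c by lra.
apply: range_incl_of_matrix_range => n X hX L hL.
rewrite scale_mx_pencil pairing_mx_pencil linear_termZ.
have T0 := trace_term_ge0 d0 hv hL; set T := trace_term L in T0 *.
rewrite -(pmulr_rge0 _ c0) mulrDr mulVKf ?gt_eqF //.
apply/ler_addgt0Pr => e e0.
(* Chosen so that the slack e / K in the distance costs at most [e] in the value of the pencil. *)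
pose K := slope delta * T + 1.
have K0 : 0 < K by rewrite ltr_pwDr // mulr_ge0.
have [Y hY XY] := huv n X hX (e / K) (divr_gt0 e0 K0).
have /matrix_range_iff /(_ L hL) := hY; rewrite pairing_mx_pencil -/T => hTY.
have hb0 : 0 <= r + e / K by rewrite addr_ge0 // divr_ge0 // ltW.
have hb i : mxopnorm (X i - Y i) <= r + e / K by move: i; apply/tuple_dist_le => //; exact: ltW.
have := linear_term_bound d0 hv hL hb0 hb; rewrite linear_termB -/T ler_norml => /andP[h _].
have e1 : slope delta * T * (e / K) <= e.
  rewrite mulrA ler_pdivrMr // mulrC; apply: ler_wpM2l; [exact: ltW|by rewrite lerDl].
have eqc : c * T = T + slope delta * r * T by rewrite /c mulrDl mul1r.
move: h; rewrite (_ : slope delta * (r + e / K) * T = slope delta * r * T + slope delta * T * (e / K)).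
  lra.
by ring.
Qed.

Lemma near_range_of_incl (c : R) u v : 1 <= c -> range_incl c u v ->
  near_range (ln c) u v.
Proof.
move=> c1 huv n X hX e e0; have c0 : 0 < c by lra.
exists (fun i => c^-1%:C *: X i); first exact: matrix_range_scale.
have ci : c^-1 <= 1 by rewrite invf_le1.
have hl : 1 - c^-1 <= ln c.
  have : -1 < c^-1 - 1 by rewrite ltrBrDr addNr invr_gt0.
  by move/le_ln1Dx; rewrite addrCA subrr addr0 lnV ?posrE // lerNl opprB.
apply: le_lt_trans (_ : ln c < _); last by rewrite ltrDl.
apply/tuple_dist_le; first by rewrite ln_ge0.
move=> i; apply: le_trans hl.
rewrite -[X in X - _]scale1r -scalerBl -[1 - _](rmorphB (real_complex R)) /=.
apply: le_trans (mxopnormZ_le _ _) _; first by lra.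
by rewrite ler_piMr ?subr_ge0 // (mxopnorm_range i hX).
Qed.

Lemma near_range_refl (r : R) u : 0 <= r -> near_range r u u.
Proof.
move=> r0 n X hX e e0; exists X => //; apply: le_lt_trans (_ : 0 < _); last by lra.
apply/tuple_dist_le => // i; rewrite subrr; apply: mxopnorm_le => // y.
by rewrite mul0mx mul0r l2normE (snorm0 (cvdot_semidot _)).
Qed.

Lemma near_range_trans (r s : R) u v w :
  near_range r u v -> near_range s v w -> near_range (r + s) u w.
Proof.
move=> h1 h2 n X hX e e0; have e20 : 0 < e / 2 by lra.
have [Y hY XY] := h1 n X hX _ e20; have [Z hZ YZ] := h2 n Y hY _ e20.
exists Z => //; apply: le_lt_trans (tuple_dist_triangle _ Y _) _.
by rewrite [e]splitr addrACA ltrD.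
Qed.

(** Enlarging the constant means shrinking towards 0 inside W(v). It is obtained by composing with
    an inclusion of [v] in itself, from the trivial fact that W(v) is within any distance r of
    itself; r is solved from c' / c = 1 + slope r. *)
Lemma range_incl_mono (delta c c' : R) u v : (0 < d)%N -> 0 < delta -> U_ delta v ->
  0 < c -> c <= c' -> range_incl c u v -> range_incl c' u v.
Proof.
move=> d1 d0 hv c0 cc' huv; have s0 := slope_gt0 d1 d0.
have -> : c' = c * (1 + slope delta * ((c' / c - 1) / slope delta)).
  by field; rewrite !gt_eqF.
apply: range_incl_trans huv _; apply: (range_incl_near d0 _ hv).
  by rewrite divr_ge0 ?(ltW s0) // subr_ge0 ler_pdivlMr // mul1r.
by apply: near_range_refl; rewrite divr_ge0 ?(ltW s0) // subr_ge0 ler_pdivlMr // mul1r.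
Qed.

(** On the zero space all pencils are positive, including the constant -1, so the matrix range would
    be empty, whereas it contains 0. *)
Lemma U_nontrivial (delta : R) u : 0 < delta -> U_ delta u -> exists h : usp u, h != 0.
Proof.
move=> d0 hu; apply: contrapT => H0.
have /matrix_range_iff := U_range0 d0 hu.
move=> /(_ (fun z => if z.1.1 is None then -1 else 0)) H.
have : 0 <= pairing (fun z : pindex 1 => if z.1.1 is None then -1 else 0 : C) (mx_pencil (fun=> 0)).
  apply: H => x; rewrite /pairing big1 // => -[[q j] k] _; rewrite /gram /=.
  have -> : x j = 0 by apply/eqP/negPn/negP => xj; apply: H0; exists (x j).
  by rewrite (sd0r (hdot_semidot _)) mulr0.
rewrite pairing_mx_pencil trace_term1 (linear_term1 _ (fun _ => 0)) big1 ?addr0; last first.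
  by move=> i _; rewrite mul0r.
rewrite /= lerNr oppr0; apply/negP; rewrite -ltNge; exact: ltr01.
Qed.

End Estimates.

(** * The two metrics and their equivalence *)

Section Metrics.
Context {R : realType} {d : nat}.
Hypothesis d_gt0 : (0 < d)%N.
Local Notation C := R[i].
Local Notation pindex := (pindex (d := d)).
Implicit Types u v w : utuple R d.

(* For a unitary [v], the pencil [|x0|^2 + |x1|^2 - 2 Re <v x1, x0>] is
   positive; testing it on [u] at [x0 = u h], [x1 = h] shows [c >= 1]. *)
Lemma range_incl_ge1 (c : R) u v (h : usp u) : h != 0 -> 0 < c ->
  range_incl c u v -> 1 <= c.
Proof.
move=> h0 c0 huv; pose i0 := Ordinal d_gt0.
pose L (z : pindex 2) : C := match z.1.1 with
  | None => (z.1.2 == z.2)%:R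
  | Some i => if [&& i == i0, z.1.2 == 0 & z.2 == 1] then - 2 else 0 end.
have LE t : pairing L t = Re (t (None, 0, 0)) + Re (t (None, 1, 1)) - 2 * Re (t (Some i0, 0, 1)).
  have aux j k : \sum_q L (q, j, k) * t (q, j, k) = (j == k)%:R * t (None, j, k) +
      (if (j == 0) && (k == 1) then - 2 * t (Some i0, j, k) else 0).
    rewrite big_option /L /=; congr (_ + _); case: ifP => jk.
      rewrite (bigD1 i0) //= big1 ?addr0 // => i /negPf ->.
      by rewrite mul0r.
    by rewrite big1 // => i _; rewrite andbF mul0r.
  rewrite /pairing pindex_sum !sum_ord2 !aux /= !mul0r !mul1r !addr0 !add0r.
  by rewrite !ReD (_ : -2 = (-2)%:C) ?ReZ //; [ring|rewrite rmorphN rmorph_nat].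
have su := hdot_semidot (usp u); have sv := hdot_semidot (usp v).
have hL x : 0 <= pairing L (gram v x).
  rewrite LE /gram /=; have := sd_ge0 sv (v i0 (x 1) - x 0).
  rewrite (sdBl sv) !(sdBr sv) (@letter_dot _ _ v (i0, true)) !ReB.
  by rewrite (sd_Re_sym sv (x 0)); lra.
pose x (k : 'I_2) : usp u := if k == 0 then u i0 h else h.
have := huv _ x L hL; rewrite LE /scale_pencil /gram /x /= ReZ.
rewrite (@letter_dot _ _ u (i0, true)).
have h1 : 0 < Re (hdot (usp u) h h).
  rewrite lt0r (sd_ge0 su) andbT; apply: contraNneq h0 => e.
  by apply/eqP/hnorm_eq0; rewrite /hnorm /snorm e sqrtr0.
move=> h2; have : 0 <= 1 - c^-1.
  rewrite -(pmulr_lge0 _ h1); move: h2; set a := Re _; set b := c^-1; lra.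
by rewrite subr_ge0 invf_le1.
Qed.

Lemma ler_near_inf (T : Type) (S : set T) (f : T -> R) (r : R) :
  (ereal_inf [set (f b)%:E | b in S] <= r%:E)%E <->
  forall e : R, 0 < e -> exists2 b, S b & f b < r + e.
Proof.
split=> [h e e0|h].
  have : (ereal_inf [set (f b)%:E | b in S] < (r + e)%:E)%E.
    by apply: le_lt_trans h _; rewrite lte_fin ltrDl.
  by move=> /ereal_inf_lt[_ [b Sb <-]]; rewrite lte_fin; exists b.
apply/lee_addgt0Pr => e e0; have [b Sb fb] := h e e0.
by apply: ge_ereal_inf; exists (f b)%:E; [exists b|rewrite -EFinD lee_fin ltW].
Qed.

Lemma dmr_le u v (r : R) :
  (dmr u v <= r%:E)%E <-> near_range r u v /\ near_range r v u.
Proof.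
split.
  move=> /ereal_supP h.
  have hn n : (hausdorff (@tuple_dist R d n.+1) (matrix_range u n) (matrix_range v n) <= r%:E)%E.
    by apply: h; exists n.
  split=> n X hX; have := hn n; rewrite ge_max => /andP[/ereal_supP h1 /ereal_supP h2].
    by apply/ler_near_inf; apply: h1; exists X.
  move=> e e0; have /ler_near_inf /(_ e e0)[Y hY YX] : (ereal_inf [set (tuple_dist Y X)%:E | Y in matrix_range u n] <= r%:E)%E.
    by apply: h2; exists X.
  by exists Y; [exact: hY|rewrite tuple_distC; exact: YX].
move=> [h1 h2]; apply: ge_ereal_sup => _ [n _ <-]; rewrite ge_max; apply/andP; split.
  apply: ge_ereal_sup => _ [X hX <-]; apply/ler_near_inf; exact: h1.
apply: ge_ereal_sup => _ [X hX <-]; apply/ler_near_inf => e e0.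
by have [Y hY XY] := h2 n X hX e e0; exists Y; [exact: hY|rewrite tuple_distC; exact: XY].
Qed.

(** Suprema over empty sets are [-oo]; the point 0 of the first level of [u] provides a nonnegative
    term. *)
Lemma dmr_ge0 (delta : R) u v : 0 < delta -> U_ delta u -> (0 <= dmr u v)%E.
Proof.
move=> d0 hu; have h0 := U_range0 d0 hu.
have h : (0 <= ereal_inf [set (tuple_dist (fun=> 0) Y)%:E | Y in matrix_range v 0])%E.
  by apply: le_ereal_inf_tmp => _ [Y _ <-]; rewrite lee_fin tuple_dist_ge0.
apply: le_trans h _; apply: le_trans (_ : _ <= hausdorff (@tuple_dist R d 1) (matrix_range u 0) (matrix_range v 0))%E _.
  by rewrite le_max; apply/orP; left; apply: ereal_sup_ubound; exists (fun=> 0).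
by apply: ereal_sup_ubound; exists 0%N.
Qed.

Section Fixed.
Variable delta : R.
Hypothesis delta_gt0 : 0 < delta.

(** The admissible constants are nonempty by the a priori inclusion and bounded below by 1 because
    the space of [u] is nonzero; points of the set just above its infimum are what
    [range_incl_closed] asks for. *)
Lemma dilation_constP u v : U_ delta u -> U_ delta v ->
  exists c, [/\ 1 <= c, dilation_const u v = c%:E, range_incl c u v &
    forall c', 0 < c' -> range_incl c' u v -> c <= c'].
Proof.
move=> hu hv; have [h h0] := U_nontrivial delta_gt0 hu.
pose S := [set c : R | 0 < c /\ range_incl c u v].
have S0 : S !=set0.
  by exists (slope (d := d) delta); split; [exact: slope_gt0|exact: range_incl_U].
have S1 : lbound S 1 by move=> c [c0]; exact: range_incl_ge1 h0 c0.
have Slb : has_lbound S by exists 1.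
have c1 : 1 <= inf S by exact: lb_le_inf.
have c0 : 0 < inf S by lra.
have cmin c' : 0 < c' -> range_incl c' u v -> inf S <= c' by move=> ? ?; apply: ge_inf.
have cin : range_incl (inf S) u v.
  apply: range_incl_closed => // c2 hc2.
  have e0 : 0 < c2 - inf S by rewrite subr_gt0.
  have [c' [c'0 hc'] c'2] := inf_adherent e0 (conj S0 Slb).
  by exists c'; split => //; [exact: cmin|move: c'2; rewrite addrC subrK].
exists (inf S); split => //; apply: le_anti; apply/andP; split.
  apply: ereal_inf_lbound; exists (inf S) => //; split=> //; exact: dilates_of_range_incl.
apply: le_ereal_inf_tmp => _ [c' [c'0 hc'] <-]; rewrite lee_fin.
by apply: cmin => //; exact: range_incl_of_dilates.
Qed.

Lemma dDP u v : U_ delta u -> U_ delta v ->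
  exists c, [/\ 1 <= c, dD u v = (ln c)%:E, range_incl c u v /\ range_incl c v u &
    forall c', 0 < c' -> range_incl c' u v -> range_incl c' v u -> c <= c'].
Proof.
move=> hu hv; have [a [a1 ea ha amin]] := dilation_constP hu hv.
have [b [b1 eb hb bmin]] := dilation_constP hv hu.
have m1 : 1 <= Num.max a b by rewrite le_max a1.
exists (Num.max a b); split => //.
- by rewrite /dD ea eb -EFin_max lne_EFin //; lra.
- split.
    by apply: (range_incl_mono d_gt0 delta_gt0 hv _ _ ha); [lra|rewrite le_max lexx].
  by apply: (range_incl_mono d_gt0 delta_gt0 hu _ _ hb); [lra|rewrite le_max lexx orbT].
- by move=> c' c'0 h1 h2; rewrite ge_max amin ?bmin.
Qed.

(** Finiteness of [dmr] is deduced from that of the dilation constants. *)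
Lemma dmrP u v : U_ delta u -> U_ delta v ->
  exists r, [/\ 0 <= r, dmr u v = r%:E & near_range r u v /\ near_range r v u].
Proof.
move=> hu hv; have [c [c1 _ [h1 h2] _]] := dDP hu hv.
have : (dmr u v <= (ln c)%:E)%E.
  by apply/dmr_le; split; apply: near_range_of_incl.
have := dmr_ge0 v delta_gt0 hu; case e : (dmr u v) => [r| |] // r0 _.
by exists r; split => //; apply/dmr_le; rewrite e.
Qed.

Lemma dmr_le_dD u v : U_ delta u -> U_ delta v -> (dmr u v <= dD u v)%E.
Proof.
move=> hu hv; have [c [c1 -> [h1 h2] _]] := dDP hu hv.
by apply/dmr_le; split; apply: near_range_of_incl.
Qed.

Lemma dD_le_dmr u v : U_ delta u -> U_ delta v ->
  (dD u v <= (slope (d := d) delta)%:E * dmr u v)%E.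
Proof.
move=> hu hv; have [c [c1 -> _ cmin]] := dDP hu hv.
have [r [r0 -> [h1 h2]]] := dmrP hu hv.
have sr : 0 <= slope (d := d) delta * r by rewrite mulr_ge0 // slope_ge0.
have c0 : 0 < c by lra.
have hc : c <= 1 + slope (d := d) delta * r.
  by apply: cmin; [lra|exact: range_incl_near h1|exact: range_incl_near h2].
rewrite -EFinM lee_fin; apply: le_trans (_ : ln (1 + slope (d := d) delta * r) <= _).
  by rewrite ler_ln ?posrE //; lra.
by apply: le_ln1Dx; lra.
Qed.

Lemma dD_eq0 u v : U_ delta u -> U_ delta v -> dD u v = 0%E <-> usim u v.
Proof.
move=> hu hv; have [c [c1 -> [h1 h2] cmin]] := dDP hu hv.
have c0 : 0 < c by lra.
split=> [[] /eqP|/(usim_iff_range_incl u v d_gt0)[i1 i2]].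
  rewrite ln_eq0 // => /eqP e; move: h1 h2; rewrite e => h1 h2.
  by apply/(usim_iff_range_incl u v d_gt0).
have -> : c = 1 by apply/le_anti; rewrite c1 cmin.
by rewrite ln1.
Qed.

Lemma dmr_eq0 u v : U_ delta u -> U_ delta v -> dmr u v = 0%E <-> usim u v.
Proof.
move=> hu hv; rewrite -dD_eq0 //.
have hD := dD_le_dmr hu hv; have hm := dmr_le_dD hu hv.
split=> e.
  apply/le_anti; rewrite -{2}e hm andbT.
  by move: hD; rewrite e mule0.
by apply/le_anti; rewrite (dmr_ge0 v delta_gt0 hu) andbT -e.
Qed.

End Fixed.

Lemma dDC u v : dD u v = dD v u. Proof. by rewrite /dD maxC. Qed.

Lemma dmrC (delta : R) u v : 0 < delta -> U_ delta u -> U_ delta v -> dmr u v = dmr v u.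
Proof.
move=> d0 hu hv; have [r [_ er [h1 h2]]] := dmrP d0 hu hv.
have [s [_ es [k1 k2]]] := dmrP d0 hv hu.
by apply/le_anti; rewrite {1}es {2}er; apply/andP; split; apply/dmr_le.
Qed.

Lemma dD_triangle (delta : R) u v w : 0 < delta -> U_ delta u -> U_ delta v -> U_ delta w ->
  (dD u w <= dD u v + dD v w)%E.
Proof.
move=> d0 hu hv hw; have [c [c1 -> _ cmin]] := dDP d0 hu hw.
have [a [a1 -> [i1 i2] _]] := dDP d0 hu hv; have [b [b1 -> [j1 j2] _]] := dDP d0 hv hw.
have a0 : 0 < a by lra.
have b0 : 0 < b by lra.
have c0 : 0 < c by lra.
rewrite -EFinD lee_fin -lnM ?posrE // ler_ln ?posrE ?mulr_gt0 //.
apply: cmin; rewrite ?mulr_gt0 //; first exact: range_incl_trans i1 j1.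
by rewrite mulrC; exact: range_incl_trans j2 i2.
Qed.

Lemma dmr_triangle (delta : R) u v w : 0 < delta -> U_ delta u -> U_ delta v -> U_ delta w ->
  (dmr u w <= dmr u v + dmr v w)%E.
Proof.
move=> d0 hu hv hw; have [r [r0 -> [i1 i2]]] := dmrP d0 hu hv.
have [s [s0 -> [j1 j2]]] := dmrP d0 hv hw.
rewrite -EFinD; apply/dmr_le; split; first exact: near_range_trans i1 j1.
by rewrite addrC; exact: near_range_trans j2 i2.
Qed.

Lemma U_le (delta delta' : R) u : delta' <= delta -> U_ delta u -> U_ delta' u.
Proof. by move=> dd hu z hz; apply: hu; exact: lt_le_trans dd. Qed.

Lemma U_common2 u v : U0 u -> U0 v -> exists delta : R, [/\ 0 < delta, U_ delta u & U_ delta v].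
Proof.
move=> [a a0 hu] [b b0 hv]; exists (Num.min a b); split.
- by rewrite lt_min a0 b0.
- by apply: U_le hu; rewrite ge_min lexx.
- by apply: U_le hv; rewrite ge_min lexx orbT.
Qed.

Lemma U_common3 u v w : U0 u -> U0 v -> U0 w ->
  exists delta : R, [/\ 0 < delta, U_ delta u, U_ delta v & U_ delta w].
Proof.
move=> hu hv [c c0 hw]; have [a [a0 hu' hv']] := U_common2 hu hv.
exists (Num.min a c); split; first by rewrite lt_min a0 c0.
- by apply: U_le hu'; rewrite ge_min lexx.
- by apply: U_le hv'; rewrite ge_min lexx.
- by apply: U_le hw; rewrite ge_min lexx orbT.
Qed.

(** Each axiom involves at most three tuples, so a radius common to any three of them suffices; this
    treats [U_ delta] and [U0] together. *)
Lemma metrics_of_common (X : utuple R d -> Prop) :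
  (forall u v w, X u -> X v -> X w ->
     exists delta : R, [/\ 0 < delta, U_ delta u, U_ delta v & U_ delta w]) ->
  is_metric_mod (@usim R d) X (@dD R d) /\ is_metric_mod (@usim R d) X (@dmr R d).
Proof.
move=> hX; split; split=> [u v Xu Xv|u v Xu Xv|u v Xu Xv|u v w Xu Xv Xw].
- have [delta [d0 hu hv _]] := hX u v v Xu Xv Xv.
  by have [c [c1 -> _ _]] := dDP d0 hu hv; rewrite lee_fin ln_ge0.
- have [delta [d0 hu hv _]] := hX u v v Xu Xv Xv; exact (dD_eq0 d0 hu hv).
- exact: dDC.
- have [delta [d0 hu hv hw]] := hX u v w Xu Xv Xw; exact: dD_triangle d0 hu hv hw.
- have [delta [d0 hu hv _]] := hX u v v Xu Xv Xv.
  by have [r [r0 -> _]] := dmrP d0 hu hv; rewrite lee_fin.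
- have [delta [d0 hu hv _]] := hX u v v Xu Xv Xv; exact (dmr_eq0 d0 hu hv).
- have [delta [d0 hu hv _]] := hX u v v Xu Xv Xv; exact: dmrC d0 hu hv.
- have [delta [d0 hu hv hw]] := hX u v w Xu Xv Xw; exact: dmr_triangle d0 hu hv hw.
Qed.

(** For a scalar pencil positive on [v], let S be the sum of the |L_i| and T its value at 0. The
    points of modulus 3 delta / 4 on the axes lie in the open ball, hence in W_1(u), and are
    approximated in W_1(v) within r + e. Summing over the axes gives (3/4) delta S <= d T + d (r +
    e) S. Both d r and d e are at most delta / 8, which leaves (delta / 2) S <= d T, that is,
    positivity on the ball of radius delta / (2 d). *)
Lemma U_near (delta r : R) u v : 0 < delta -> 0 <= r -> d%:R * r <= delta / 8 ->
  U_ delta u -> near_range r u v -> U_ (delta / (2 * d%:R)) v.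
Proof.
move=> d0 r0 hr hu huv z hz; apply/matrix_range_iff => L hL.
have dp : 0 < d%:R :> R by rewrite ltr0n.
pose l i := normc (L (Some i, 0, 0)); pose T := trace_term L.
pose e := delta / (8 * d%:R).
have e0 : 0 < e by rewrite divr_gt0 // mulr_gt0.
have key i : 3 / 4 * delta * l i <= T + (r + e) * \sum_i l i.
  have t0 : 0 <= 3 / 4 * delta by lra.
  have [a ha hra] := phase (L (Some i, 0, 0)) t0.
  have ad : normc a < delta by lra.
  have [Y hY XY] := huv _ _ (axis_range i hu ad) e e0.
  have /matrix_range_iff /(_ L hL) := hY; rewrite pairing_mx_pencil -/T.
  have := linear_termB L Y (axis i a); rewrite linear_term_axis hra -/(l i).
  have : linear_term L (fun i' => Y i' - axis i a i') <= (r + e) * \sum_i l i.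
    rewrite linear_term1; apply: le_trans (Re_le _) _; apply: le_trans (normc_sum _ _ _) _.
    rewrite mulr_sumr; apply: ler_sum => j _; rewrite Normc.normcM mulrC.
    apply: ler_wpM2r; first exact: normc_ge0.
    pose y : 'cV[C]_1 := delta_mx 0 0.
    have hj : mxopnorm (Y j - axis i a j) <= r + e.
      have re0 : 0 <= r + e by lra.
      by apply: (proj1 (tuple_dist_le _ _ re0)); rewrite tuple_distC; exact: ltW XY.
    apply: le_trans hj; have := mxopnorm_mul (Y j - axis i a j) y; rewrite l2norm_delta mulr1.
    apply: le_trans; apply: le_trans (l2norm_entry _ 0).
    by rewrite [X in _ <= normc X]mxE big_ord1 [y 0 0]mxE !eqxx mulr1 mxE.
  lra.
have hsum : 3 / 4 * delta * \sum_i l i <= d%:R * T + d%:R * (r + e) * \sum_i l i.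
  rewrite mulr_sumr; apply: le_trans (ler_sum _ (fun i _ => key i)) _.
  by rewrite sumr_const card_ord -[X in X <= _]mulr_natl mulrDr mulrA.
have S0 : 0 <= \sum_i l i by apply: sumr_ge0 => i _; exact: normc_ge0.
have hS : delta / (2 * d%:R) * \sum_i l i <= T.
  have ed : d%:R * e = delta / 8 by rewrite /e; field; lra.
  have hd : d%:R * (r + e) * \sum_i l i <= delta / 4 * \sum_i l i.
    by apply: ler_wpM2r => //; rewrite mulrDr ed; lra.
  rewrite -mulrA mulrCA ler_pdivrMl ?mulr_gt0 //; lra.
rewrite pairing_mx_pencil -/T linear_term1 -[X in 0 <= X]opprK oppr_ge0 opprD.
rewrite addrC subr_le0 -ReN; apply: le_trans (Re_le _) _; rewrite normcN.
apply: le_trans (normc_sum _ _ _) _; apply: le_trans hS; rewrite mulr_sumr.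
apply: ler_sum => i _; rewrite Normc.normcM mulrC; apply: ler_wpM2r; first exact: normc_ge0.
by rewrite mxE eqxx mulr1n; apply: ltW; apply: le_lt_trans hz; exact: l2norm_entry.
Qed.

End Metrics.

Theorem corollary2p5 (R : realType) (d : nat) (d_gt0 : (0 < d)%N) :
  (forall delta : R, 0 < delta ->
     [/\ is_metric_mod (@usim R d) (@U_ R d delta) (@dD R d),
         is_metric_mod (@usim R d) (@U_ R d delta) (@dmr R d) &
         strongly_equivalent (@U_ R d delta) (@dD R d) (@dmr R d)]) /\
  [/\ is_metric_mod (@usim R d) (@U0 R d) (@dD R d),
      is_metric_mod (@usim R d) (@U0 R d) (@dmr R d) &
      equivalent_metrics (@U0 R d) (@dD R d) (@dmr R d)].
Proof.
split=> [delta d0|].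
  have [h1 h2] := metrics_of_common d_gt0 (X := @U_ R d delta)
    (fun u v w hu hv hw => ex_intro _ delta (And4 d0 hu hv hw)).
  split=> //; split.
    by exists (slope (d := d) delta) => u v hu hv; exact: dD_le_dmr.
  by exists 1 => u v hu hv; rewrite mul1e; exact: (dmr_le_dD d_gt0 d0).
have [h1 h2] := metrics_of_common d_gt0 (@U_common3 R d).
split=> // O; split=> -[OX hO]; split=> // u Ou; have [e e0 he] := hO u Ou; last first.
  exists e => // v Xv huv; apply: he => //; apply: le_lt_trans huv.
  have [delta [d0 hu hv]] := U_common2 (OX u Ou) Xv.
  exact: (dmr_le_dD d_gt0 d0).
(* The bound of [dD] by [dmr] depends on the radius of the ball in the first level, so a
   [dmr]-neighbourhood of [u] with a uniform radius is needed; the converse bound has constant 1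
   throughout. *)
have [delta d0 hu] := OX u Ou.
have dp : 0 < d%:R :> R by rewrite ltr0n.
pose delta' := delta / (2 * d%:R).
have d'0 : 0 < delta' by rewrite divr_gt0 // mulr_gt0.
have dd' : delta' <= delta.
  rewrite ler_pdivrMr ?mulr_gt0 // ler_peMr ?(ltW d0) //.
  by have d1 : 1 <= d%:R :> R; [rewrite ler1n|lra].
have s0 := slope_gt0 d_gt0 d'0.
(* The first term keeps [v] in [U_ delta'], the second then makes the bound on [dD u v] smaller than
   [e]. *)
exists (Num.min (delta / (8 * d%:R)) (e / slope (d := d) delta')).
  by rewrite lt_min !divr_gt0 // mulr_gt0.
move=> v Xv huv; apply: he => //.
have [a [a0 hu' hv']] := U_common2 (OX u Ou) Xv.
have [r [r0 er [k1 k2]]] := dmrP d_gt0 a0 hu' hv'.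
move: huv; rewrite er lte_fin lt_min => /andP[r1 r2].
have hv : U_ delta' v.
  apply: (U_near d_gt0 d0 r0 _ hu k1).
  move: r1; rewrite ltr_pdivlMr ?mulr_gt0 // => r1; nra.
apply: le_lt_trans (dD_le_dmr d_gt0 d'0 (U_le dd' hu) hv) _.
by rewrite er -EFinM lte_fin mulrC -ltr_pdivlMr.
Qed.
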